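(* Let $\Lambda=\{\lambda_n\}_{n\ge0}$ and $\mathcal M=\{\mu_n\}_{n\ge0}$ be sequences in $\mathbb D$ both satisfying the Carleson condition, such that $\lim_{n\to\infty}B_{\mathcal M}(\lambda_n)=0$. Suppose that $\widetilde{\mathcal K}_{\Lambda,B_{\mathcal M}}$ is a Riesz basis in $K_{B_{\mathcal M}}$. Then $\lim_{n\to\infty}B_\Lambda(\mu_n)=0$ and $\widetilde{\mathcal K}_{\mathcal M,B_\Lambda}$ is a Riesz basis in $K_{B_\Lambda}$.
   Context: Carleson condition for $\{z_n\}$: $\inf_n\prod_{m\ne n}\left|\frac{z_m-z_n}{1-\bar z_mz_n}\right|>0$. $B_\Lambda$, $B_{\mathcal M}$ are the Blaschke products with zero sets $\Lambda$, $\mathcal M$. For inner $\theta$: $K_\theta=H^2\ominus\theta H^2$, $k_\theta(\lambda,z)=\frac{1-\overline{\theta(\lambda)}\theta(z)}{1-\bar\lambda z}$, $\widetilde{\mathcal K}_{\Lambda,\theta}=\{k_\theta(\lambda,\cdot)/\|k_\theta(\lambda,\cdot)\|_2\}_{\lambda\in\Lambda}$. A Riesz basis of a Hilbert space $H$ is a complete family $\{x_n\}$ with $c\sum|a_n|^2\le\|\sum a_nx_n\|^2\le C\sum|a_n|^2$ for some $c,C>0$. *)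

(* Defs.v *)
From Stdlib Require Import Reals.
From Coquelicot Require Import Coquelicot.
Open Scope R_scope.

(** Limit of a complex sequence, computed componentwise
    (agrees with the genuine limit whenever the sequence converges). *)
Definition CLim (u : nat -> C) : C :=
  (real (Lim_seq (fun n => fst (u n))), real (Lim_seq (fun n => snd (u n)))).

Fixpoint Rprod (f : nat -> R) (N : nat) : R :=
  match N with O => 1 | S M => Rprod f M * f M end.
Fixpoint Cprod (f : nat -> C) (N : nat) : C :=
  match N with O => RtoC 1 | S M => Cmult (Cprod f M) (f M) end.
Fixpoint Rsum (f : nat -> R) (N : nat) : R :=
  match N with O => 0 | S M => Rsum f M + f M end.
Fixpoint Csum (f : nat -> C) (N : nat) : C :=
  match N with O => RtoC 0 | S M => Cplus (Csum f M) (f M) end.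

Definition in_disc (z : C) : Prop := Cmod z < 1.

Definition pseudo_hyp (a b : C) : R :=
  Cmod (Cdiv (Cminus a b) (Cminus (RtoC 1) (Cmult (Cconj a) b))).

Definition carleson (s : nat -> C) : Prop :=
  (forall n, in_disc (s n)) /\
  exists delta : R, 0 < delta /\
    forall n : nat,
      Rbar_le (Finite delta)
        (Lim_seq (fun N => Rprod (fun m => if Nat.eqb m n then 1
                                            else pseudo_hyp (s m) (s n)) N)).

Definition bfactor (a z : C) : C :=
  if Req_EM_T (Cmod a) 0 then z
  else Cmult (Cdiv (RtoC (Cmod a)) a)
             (Cdiv (Cminus a z) (Cminus (RtoC 1) (Cmult (Cconj a) z))).

Definition blaschke (s : nat -> C) (z : C) : C :=
  CLim (fun N => Cprod (fun n => bfactor (s n) z) N).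

(** ** Hardy space H^2, realised through Taylor coefficients. *)
Definition seqC := nat -> C.

Definition in_H2 (a : seqC) : Prop := ex_series (fun k => Cmod (a k) ^ 2).

Definition h2_eval (a : seqC) (z : C) : C :=
  CLim (fun N => Csum (fun k => Cmult (a k) (Cpow z k)) N).

Definition h2_inner (a b : seqC) : C :=
  CLim (fun N => Csum (fun k => Cmult (a k) (Cconj (b k))) N).

Definition h2_norm (a : seqC) : R := sqrt (Series (fun k => Cmod (a k) ^ 2)).

Definition h2_sub (a b : seqC) : seqC := fun k => Cminus (a k) (b k).
Definition h2_scal (c : C) (a : seqC) : seqC := fun k => Cmult c (a k).
Definition h2_lincomb (c : nat -> C) (x : nat -> seqC) (N : nat) : seqC :=
  fun k => Csum (fun n => Cmult (c n) (x n k)) N.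

Definition mult_space (theta : C -> C) (f : seqC) : Prop :=
  in_H2 f /\ exists g, in_H2 g /\
    forall z, in_disc z -> h2_eval f z = Cmult (theta z) (h2_eval g z).

Definition model_space (theta : C -> C) (f : seqC) : Prop :=
  in_H2 f /\ forall h, mult_space theta h -> h2_inner f h = RtoC 0.

Definition kernel (theta : C -> C) (l z : C) : C :=
  Cdiv (Cminus (RtoC 1) (Cmult (Cconj (theta l)) (theta z)))
       (Cminus (RtoC 1) (Cmult (Cconj l) z)).

Definition kernel_family (theta : C -> C) (L : nat -> C) (k : nat -> seqC) : Prop :=
  forall n, in_H2 (k n) /\
    forall z, in_disc z -> h2_eval (k n) z = kernel theta (L n) z.

Definition normalize (k : nat -> seqC) : nat -> seqC :=
  fun n => h2_scal (RtoC (/ h2_norm (k n))) (k n).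

Definition riesz_basis (H : seqC -> Prop) (x : nat -> seqC) : Prop :=
  (forall n, H (x n)) /\
  (forall f, H f -> forall eps, 0 < eps ->
     exists N c, h2_norm (h2_sub f (h2_lincomb c x N)) < eps) /\
  exists c C0 : R, 0 < c /\ 0 < C0 /\
    forall (N : nat) (a : nat -> C),
      let S := Rsum (fun n => Cmod (a n) ^ 2) N in
      c * S <= h2_norm (h2_lincomb a x N) ^ 2 <= C0 * S.

(* Main.v *)
Require Import Defs.
From Stdlib Require Import Reals Lra Lia FunctionalExtensionality ProofIrrelevance ClassicalEpsilon.
From Coquelicot Require Import Coquelicot.
Open Scope R_scope.

(** Write [K_s] for the model space of the Blaschke product [B_s], [x_n] and [y_n] for the
    normalised Szego kernels at [L n] and [M n], and [P], [Q] for the projections onto [K_M] and [K_L].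

    The normalised kernels at a Carleson sequence are a Riesz sequence.  For real
    coefficients the Gram form only involves the positive Poisson-type kernel
    [Re (1 / (1 - conj z_j z_k))], to which a tree-like Carleson embedding argument applies;
    this gives the upper bound, and the lower one follows because the biorthogonal system
    [B_{N,j} x_j] has, up to unimodular factors, the conjugate Gram matrix.

    The kernels of [K_M] at [L n] are the [P x_n].  Since they form a Riesz basis of [K_M],
    [P : K_L -> K_M] is invertible, hence so is its adjoint [Q : K_M -> K_L], and the [Q y_n]
    are a Riesz basis of [K_L].  As [(I - P) x_n = conj (B_M (L n)) B_M x_n] with coefficients
    tending to zero, [I - P] is compact on [K_L]; therefore the distance
    [|B_L (M n)|] of [y_n] to [K_L], at most the distance of [y_n] to the preimage
    [P^-1 y_n], tends to zero because [y_n] tends weakly to zero. *)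

(** * Finite sums and series *)

(** No projection is built as an operator: [P] and [Q] enter through their values on kernels and
    through orthogonality of residuals, and invertibility of [P] is carried by the inequality
    [lower]. It passes to the adjoint because <f, P x> = <f, x> = <Q f, x> for f in K_M and x in
    K_L: testing f against combinations of the P x_n, which are dense in K_M, bounds |f| by a
    multiple of |Q f|. Density of the Q y_n is dual to injectivity of [P].

    Multiplication by an infinite Blaschke product B is likewise replaced by finite products acting
    on Taylor coefficients and by the vectors B k_w, obtained as norm limits. The space B H^2 is
    replaced by the functions vanishing on the zeros; these zeros are simple, since a repeated point
    would annihilate a Carleson product.

    Compactness of I - P appears in coordinates: up to the isometry B_M it multiplies the
    coefficients along x_n by a null sequence. Bounded vectors whose coefficients vanish one by one
    are therefore sent to zero, and the Bessel bound for the y_n supplies this vanishing. *)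

Lemma Rsum_ext (f g : nat -> R) N :
  (forall n, (n < N)%nat -> f n = g n) -> Rsum f N = Rsum g N.
Proof.
  induction N as [|N IH]; intros H; simpl; [reflexivity|].
  rewrite IH by (intros; apply H; lia). rewrite H by lia. reflexivity.
Qed.

Lemma Rsum_le (f g : nat -> R) N :
  (forall n, (n < N)%nat -> f n <= g n) -> Rsum f N <= Rsum g N.
Proof.
  induction N as [|N IH]; intros H; simpl; [lra|].
  apply Rplus_le_compat; [apply IH; intros; apply H; lia|apply H; lia].
Qed.

Lemma Rsum_plus (f g : nat -> R) N :
  Rsum (fun n => f n + g n) N = Rsum f N + Rsum g N.
Proof. induction N as [|N IH]; simpl; [ring|rewrite IH; ring]. Qed.

Lemma Rsum_scal (c : R) (f : nat -> R) N :
  Rsum (fun n => c * f n) N = c * Rsum f N.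
Proof. induction N as [|N IH]; simpl; [ring|rewrite IH; ring]. Qed.

Lemma Rsum_0 N : Rsum (fun _ => 0) N = 0.
Proof. induction N as [|N IH]; simpl; [|rewrite IH]; ring. Qed.

Lemma Rsum_nonneg (f : nat -> R) N :
  (forall n, (n < N)%nat -> 0 <= f n) -> 0 <= Rsum f N.
Proof. intros H. rewrite <- (Rsum_0 N). apply Rsum_le, H. Qed.

Lemma Rsum_mono (f : nat -> R) N N' :
  (forall n, 0 <= f n) -> (N <= N')%nat -> Rsum f N <= Rsum f N'.
Proof. intros H; induction 1; simpl; [lra|]. specialize (H m). lra. Qed.

Lemma Rsum_term_le (f : nat -> R) N j :
  (forall n, 0 <= f n) -> (j < N)%nat -> f j <= Rsum f N.
Proof.
  intros H Hj. apply Rle_trans with (Rsum f (S j)); [|now apply Rsum_mono].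
  simpl. pose proof (Rsum_nonneg f j (fun n _ => H n)). lra.
Qed.

Lemma Rsum_swap (F : nat -> nat -> R) N N' :
  Rsum (fun i => Rsum (fun j => F i j) N') N =
  Rsum (fun j => Rsum (fun i => F i j) N) N'.
Proof.
  induction N as [|N IH]; simpl; [now rewrite Rsum_0|].
  rewrite IH, <- Rsum_plus. reflexivity.
Qed.

Lemma Rsum_sqr (f : nat -> R) N :
  Rsum f N ^ 2 = Rsum (fun i => Rsum (fun j => f i * f j) N) N.
Proof.
  transitivity (Rsum f N * Rsum f N); [ring|].
  rewrite <- Rsum_scal. apply Rsum_ext; intros i _.
  rewrite Rsum_scal. ring.
Qed.

Lemma Rsum_cauchy_schwarz (f g : nat -> R) N :
  Rsum (fun n => f n * g n) N ^ 2 <=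
  Rsum (fun n => f n ^ 2) N * Rsum (fun n => g n ^ 2) N.
Proof.
  induction N as [|N IH]; cbn [Rsum]; [lra|].
  set (A := Rsum (fun n => f n ^ 2) N) in *.
  set (B := Rsum (fun n => g n ^ 2) N) in *.
  set (X := Rsum (fun n => f n * g n) N) in *.
  assert (HA : 0 <= A) by (apply Rsum_nonneg; intros; apply pow2_ge_0).
  assert (HB : 0 <= B) by (apply Rsum_nonneg; intros; apply pow2_ge_0).
  assert (H : 2 * X * (f N * g N) <= A * g N ^ 2 + B * f N ^ 2).
  { assert (Hn : 0 <= A * g N ^ 2 + B * f N ^ 2).
    { apply Rplus_le_le_0_compat; apply Rmult_le_pos; try assumption; apply pow2_ge_0. }
    eapply Rle_trans; [apply Rle_abs|].
    rewrite <- (Rabs_pos_eq _ Hn). apply Rsqr_le_abs_0. unfold Rsqr.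
    assert (X ^ 2 * (f N * g N) ^ 2 <= A * B * (f N * g N) ^ 2)
      by (apply Rmult_le_compat_r; [apply pow2_ge_0|exact IH]).
    pose proof (pow2_ge_0 (A * g N ^ 2 - B * f N ^ 2)). lra. }
  nra.
Qed.

Lemma sum_n_Rsum (u : nat -> R) N : sum_n u N = Rsum u (S N).
Proof.
  induction N as [|N IH].
  - rewrite sum_O. simpl. ring.
  - rewrite sum_Sn, IH. reflexivity.
Qed.

(** No convergence is assumed: [Series] is itself the real part of a [Lim_seq], of partial sums
    running one index ahead of [Rsum]. *)
Lemma Lim_Rsum (u : nat -> R) : real (Lim_seq (Rsum u)) = Series u.
Proof.
  unfold Series. rewrite <- Lim_seq_incr_1. f_equal.
  apply Lim_seq_ext. intros n. symmetry; apply sum_n_Rsum.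
Qed.

Lemma is_lim_seq_Rsum (u : nat -> R) :
  ex_series u -> is_lim_seq (Rsum u) (Series u).
Proof.
  intros H. apply Series_correct in H. apply is_lim_seq_incr_1.
  eapply is_lim_seq_ext; [|exact H]. intros n. apply sum_n_Rsum.
Qed.

Lemma Rsum_le_Series (u : nat -> R) N :
  (forall n, 0 <= u n) -> ex_series u -> Rsum u N <= Series u.
Proof.
  intros H He. apply is_lim_seq_Rsum in He.
  apply (is_lim_seq_incr_compare (Rsum u) _ He).
  intros n; simpl. specialize (H n). lra.
Qed.

Lemma Series_bounded (u : nat -> R) B :
  (forall n, 0 <= u n) -> (forall N, Rsum u N <= B) ->
  ex_series u /\ Series u <= B.
Proof.
  intros H HB.
  assert (He : ex_series u).
  { destruct (ex_finite_lim_seq_incr (Rsum u) B) as [l Hl].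
    - intros n; simpl. specialize (H n). lra.
    - exact HB.
    - exists l. apply is_lim_seq_incr_1 in Hl.
      apply (is_lim_seq_ext (fun n => Rsum u (S n)) (sum_n u) l); [|exact Hl].
      intros n; symmetry; apply sum_n_Rsum. }
  split; [exact He|]. apply is_lim_seq_Rsum in He.
  apply (is_lim_seq_le (Rsum u) (fun _ => B) (Series u) B HB He).
  apply is_lim_seq_const.
Qed.

Lemma ex_series_Rmult (c : R) (u : nat -> R) :
  ex_series u -> ex_series (fun n => c * u n).
Proof. exact (ex_series_scal (K := R_AbsRing) (V := R_NormedModule) c u). Qed.

Lemma ex_series_Rplus (u v : nat -> R) :
  ex_series u -> ex_series v -> ex_series (fun n => u n + v n).
Proof. exact (ex_series_plus (K := R_AbsRing) (V := R_NormedModule) u v). Qed.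

Lemma ex_series_Rabs_le (u v : nat -> R) :
  (forall n, Rabs (u n) <= v n) -> ex_series v -> ex_series u.
Proof. exact (ex_series_le (K := R_AbsRing) (V := R_CompleteNormedModule) u v). Qed.

Lemma ex_series_Rext (u v : nat -> R) :
  (forall n, u n = v n) -> ex_series u -> ex_series v.
Proof. exact (ex_series_ext (K := R_AbsRing) (V := R_NormedModule) u v). Qed.

(** * Complex series *)

Definition CSeries (f : nat -> C) : C :=
  (Series (fun k => fst (f k)), Series (fun k => snd (f k))).

Definition ex_CSeries (f : nat -> C) : Prop :=
  ex_series (fun k => fst (f k)) /\ ex_series (fun k => snd (f k)).

Lemma fst_Csum f N : fst (Csum f N) = Rsum (fun k => fst (f k)) N.
Proof. induction N as [|N IH]; simpl; [reflexivity|now rewrite IH]. Qed.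

Lemma snd_Csum f N : snd (Csum f N) = Rsum (fun k => snd (f k)) N.
Proof. induction N as [|N IH]; simpl; [reflexivity|now rewrite IH]. Qed.

Lemma CLim_Csum f : CLim (Csum f) = CSeries f.
Proof.
  unfold CLim, CSeries. rewrite <- !Lim_Rsum.
  f_equal; f_equal; apply Lim_seq_ext; intros; [apply fst_Csum|apply snd_Csum].
Qed.

Lemma CSeries_ext f g : (forall k, f k = g k) -> CSeries f = CSeries g.
Proof. intros H. unfold CSeries. f_equal; apply Series_ext; intros; now rewrite H. Qed.

Lemma CSeries_plus f g : ex_CSeries f -> ex_CSeries g ->
  CSeries (fun k => f k + g k)%C = (CSeries f + CSeries g)%C.
Proof.
  intros [? ?] [? ?]. unfold CSeries, Cplus; simpl.
  f_equal; apply Series_plus; assumption.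
Qed.

Lemma CSeries_scal c f : ex_CSeries f ->
  CSeries (fun k => c * f k)%C = (c * CSeries f)%C.
Proof.
  intros [H1 H2]. unfold CSeries, Cmult; simpl. f_equal.
  - rewrite Series_minus, !Series_scal_l; [reflexivity| |];
      apply ex_series_Rmult; assumption.
  - rewrite Series_plus, !Series_scal_l; [reflexivity| |];
      apply ex_series_Rmult; assumption.
Qed.

Lemma CSeries_conj f : CSeries (fun k => Cconj (f k)) = Cconj (CSeries f).
Proof.
  unfold CSeries, Cconj; simpl. f_equal. apply Series_opp.
Qed.

Lemma im_le_Cmod (c : C) : Rabs (snd c) <= Cmod c.
Proof. eapply Rle_trans; [apply Rmax_r|apply Rmax_Cmod]. Qed.

Lemma ex_CSeries_dom f u : (forall k, Cmod (f k) <= u k) -> ex_series u -> ex_CSeries f.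
Proof.
  intros H Hu. split; apply (ex_series_Rabs_le _ u); try exact Hu; intros k.
  - eapply Rle_trans; [apply re_le_Cmod|apply H].
  - eapply Rle_trans; [apply im_le_Cmod|apply H].
Qed.

Lemma Cmod_sqr_plus (a b : C) : Cmod (a + b) ^ 2 <= 2 * Cmod a ^ 2 + 2 * Cmod b ^ 2.
Proof.
  pose proof (Cmod_triangle a b). pose proof (Cmod_ge_0 (a + b)).
  pose proof (pow2_ge_0 (Cmod a - Cmod b)). nra.
Qed.

Lemma Cconj_R (x : R) : Cconj (RtoC x) = RtoC x.
Proof. unfold Cconj, RtoC; simpl. f_equal. ring. Qed.

(** * The Hilbert space of square-summable sequences *)

(** With the summability proof bundled, equality of vectors is coordinatewise by [l2_ext], so vector
    identities fall to [l2ring] and can be used for rewriting. *)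
Record l2 := L2 { val :> nat -> C; valP : in_H2 val }.

Lemma l2_ext (a b : l2) : (forall k, a k = b k) -> a = b.
Proof.
  destruct a as [a Ha], b as [b Hb]; simpl. intros H.
  assert (a = b) as -> by (extensionality k; apply H).
  f_equal. apply proof_irrelevance.
Qed.

Lemma in_H2_bounded (a : seqC) B :
  (forall N, Rsum (fun k => Cmod (a k) ^ 2) N <= B) -> in_H2 a.
Proof. intros H. eapply Series_bounded; [|exact H]. intros; apply pow2_ge_0. Qed.

Lemma in_H2_add (a b : seqC) : in_H2 a -> in_H2 b -> in_H2 (fun k => a k + b k)%C.
Proof.
  intros Ha Hb.
  apply (ex_series_Rabs_le _ (fun k => 2 * Cmod (a k) ^ 2 + 2 * Cmod (b k) ^ 2)).
  - intros k. rewrite Rabs_pos_eq by apply pow2_ge_0. apply Cmod_sqr_plus.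
  - apply ex_series_Rplus; apply ex_series_Rmult; assumption.
Qed.

Lemma in_H2_scal (c : C) (a : seqC) : in_H2 a -> in_H2 (h2_scal c a).
Proof.
  intros Ha. apply (ex_series_Rext (fun k => Cmod c ^ 2 * Cmod (a k) ^ 2)).
  - intros k. unfold h2_scal. rewrite Cmod_mult. ring.
  - now apply ex_series_Rmult.
Qed.

Lemma in_H2_sub (a b : seqC) : in_H2 a -> in_H2 b -> in_H2 (h2_sub a b).
Proof.
  intros Ha Hb. apply (in_H2_scal (-(1))%C) in Hb.
  replace (h2_sub a b) with (fun k => a k + h2_scal (-(1)) b k)%C.
  - now apply in_H2_add.
  - extensionality k. unfold h2_sub, h2_scal. ring.
Qed.

Lemma in_H2_zero : in_H2 (fun _ => 0%C).
Proof.
  apply (in_H2_bounded _ 0). intros N. rewrite (Rsum_ext _ (fun _ => 0)).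
  - rewrite Rsum_0. lra.
  - intros. rewrite Cmod_0. ring.
Qed.

Definition lzero : l2 := L2 _ in_H2_zero.
Definition ladd (a b : l2) : l2 := L2 _ (in_H2_add a b (valP a) (valP b)).
Definition lsub (a b : l2) : l2 := L2 _ (in_H2_sub a b (valP a) (valP b)).
Definition lscal (c : C) (a : l2) : l2 := L2 _ (in_H2_scal c a (valP a)).

Definition ip (a b : l2) : C := h2_inner a b.
Definition nm (a : l2) : R := h2_norm a.

Ltac l2ring := apply l2_ext; intros ?k; simpl; unfold h2_sub, h2_scal; try ring.

Lemma ex_CSeries_ip (a b : l2) : ex_CSeries (fun k => a k * Cconj (b k))%C.
Proof.
  apply (ex_CSeries_dom _ (fun k => Cmod (a k) ^ 2 + Cmod (b k) ^ 2)).
  - intros k. rewrite Cmod_mult, Cmod_conj.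
    pose proof (Cmod_ge_0 (a k)). pose proof (Cmod_ge_0 (b k)).
    pose proof (pow2_ge_0 (Cmod (a k) - Cmod (b k))). nra.
  - apply ex_series_Rplus; [apply (valP a)|apply (valP b)].
Qed.

Lemma ip_CSeries (a b : l2) : ip a b = CSeries (fun k => a k * Cconj (b k))%C.
Proof. exact (CLim_Csum _). Qed.

Lemma ip_conj (a b : l2) : ip b a = Cconj (ip a b).
Proof.
  rewrite !ip_CSeries, <- CSeries_conj. apply CSeries_ext; intros k.
  rewrite Cmult_conj, Cconj_conj. ring.
Qed.

Lemma ip_add_l (a b c : l2) : ip (ladd a b) c = (ip a c + ip b c)%C.
Proof.
  rewrite !ip_CSeries, <- CSeries_plus by apply ex_CSeries_ip.
  apply CSeries_ext; intros k; simpl. ring.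
Qed.

Lemma ip_scal_l (z : C) (a b : l2) : ip (lscal z a) b = (z * ip a b)%C.
Proof.
  rewrite !ip_CSeries, <- CSeries_scal by apply ex_CSeries_ip.
  apply CSeries_ext; intros k; simpl. unfold h2_scal. ring.
Qed.

Lemma sub_add (a b : l2) : lsub a b = ladd a (lscal (-(1)) b).
Proof. l2ring. Qed.

Lemma ip_sub_l (a b c : l2) : ip (lsub a b) c = (ip a c - ip b c)%C.
Proof. rewrite sub_add, ip_add_l, ip_scal_l. ring. Qed.

Lemma ip_add_r (a b c : l2) : ip c (ladd a b) = (ip c a + ip c b)%C.
Proof. now rewrite ip_conj, ip_add_l, Cplus_conj, <- !ip_conj. Qed.

Lemma ip_scal_r (z : C) (a b : l2) : ip b (lscal z a) = (Cconj z * ip b a)%C.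
Proof. now rewrite ip_conj, ip_scal_l, Cmult_conj, <- ip_conj. Qed.

Lemma ip_sub_r (a b c : l2) : ip c (lsub a b) = (ip c a - ip c b)%C.
Proof. now rewrite ip_conj, ip_sub_l, Cminus_conj, <- !ip_conj. Qed.

Lemma lscal_0_l (a : l2) : lscal 0 a = lzero.
Proof. l2ring. Qed.

Lemma ip_zero_l (a : l2) : ip lzero a = 0%C.
Proof. rewrite <- (lscal_0_l lzero), ip_scal_l. ring. Qed.

Lemma ip_zero_r (a : l2) : ip a lzero = 0%C.
Proof. rewrite <- (lscal_0_l lzero), ip_scal_r, Cconj_R. ring. Qed.

Lemma ip_eq0_sym (a b : l2) : ip a b = 0%C -> ip b a = 0%C.
Proof. intros H. rewrite ip_conj, H. apply injective_projections; simpl; ring. Qed.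

Lemma nm_ge0 (a : l2) : 0 <= nm a.
Proof. apply sqrt_pos. Qed.

(** Divergence is harmless: an infinite limit has real part 0 by default. *)
Lemma Series_nonneg (u : nat -> R) : (forall n, 0 <= u n) -> 0 <= Series u.
Proof.
  intros H. rewrite <- (Lim_Rsum u).
  assert (HL : Rbar_le (Lim_seq (fun _ => 0)) (Lim_seq (Rsum u))).
  { apply Lim_seq_le_loc. exists 0%nat. intros n _. now apply Rsum_nonneg. }
  rewrite Lim_seq_const in HL. destruct (Lim_seq (Rsum u)); simpl in *; lra.
Qed.

Lemma nm_sqr (a : l2) : nm a ^ 2 = Series (fun k => Cmod (a k) ^ 2).
Proof. apply pow2_sqrt, Series_nonneg. intros; apply pow2_ge_0. Qed.

Lemma ip_self (a : l2) : ip a a = RtoC (nm a ^ 2).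
Proof.
  rewrite ip_CSeries, nm_sqr. unfold CSeries, RtoC. f_equal.
  - apply Series_ext; intros k. rewrite <- Cmod2_conj. reflexivity.
  - rewrite (Series_ext _ (fun _ => 0 * 0)).
    + rewrite Series_scal_l. ring.
    + intros k. rewrite <- Cmod2_conj. simpl. ring.
Qed.

Lemma nm_sqr_ip (a : l2) : nm a ^ 2 = Re (ip a a).
Proof. now rewrite ip_self. Qed.

Lemma Rle_sqr (x y : R) : 0 <= y -> x ^ 2 <= y ^ 2 -> x <= y.
Proof. intros H1 H2. apply Rnot_lt_le. intros H. nra. Qed.

Lemma coord_le_nm (a : l2) k : Cmod (a k) <= nm a.
Proof.
  apply Rle_sqr; [apply nm_ge0|]. rewrite nm_sqr.
  assert (H : forall n, 0 <= Cmod (a n) ^ 2) by (intros; apply pow2_ge_0).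
  apply Rle_trans with (Rsum (fun k => Cmod (a k) ^ 2) (S k)).
  - apply (Rsum_term_le (fun k => Cmod (a k) ^ 2)); [exact H|lia].
  - apply Rsum_le_Series; [exact H|apply (valP a)].
Qed.

Lemma nm_eq0 (a : l2) : nm a <= 0 -> a = lzero.
Proof.
  intros H. apply l2_ext; intros k; simpl. apply Cmod_eq_0.
  pose proof (coord_le_nm a k). pose proof (Cmod_ge_0 (a k)). lra.
Qed.

Lemma nm_scal (c : C) (a : l2) : nm (lscal c a) = Cmod c * nm a.
Proof.
  assert (H : nm (lscal c a) ^ 2 = (Cmod c * nm a) ^ 2).
  { rewrite Rpow_mult_distr, !nm_sqr, <- Series_scal_l.
    apply Series_ext; intros k; simpl val. unfold h2_scal. rewrite Cmod_mult. ring. }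
  pose proof (nm_ge0 (lscal c a)). pose proof (nm_ge0 a). pose proof (Cmod_ge_0 c).
  assert (0 <= Cmod c * nm a) by now apply Rmult_le_pos.
  apply Rle_antisym; apply Rle_sqr; lra.
Qed.

Lemma nm_sub_scal (a b : l2) (c : C) :
  nm (lsub a (lscal c b)) ^ 2 =
  nm a ^ 2 - 2 * Re (Cconj c * ip a b)%C + Cmod c ^ 2 * nm b ^ 2.
Proof.
  rewrite nm_sqr_ip, ip_sub_l, !ip_sub_r, !ip_scal_l, !ip_scal_r, (ip_conj a b), !ip_self.
  rewrite Cmod2_alt. unfold Re, Im. destruct c, (ip a b); simpl. ring.
Qed.

Lemma cauchy_schwarz (a b : l2) : Cmod (ip a b) <= nm a * nm b.
Proof.
  pose proof (nm_ge0 a) as Ha. pose proof (nm_ge0 b) as Hb.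
  destruct (Req_dec (nm b) 0) as [H0|H0].
  - rewrite (nm_eq0 b) by lra. rewrite ip_zero_r, Cmod_0.
    apply Rmult_le_pos; apply nm_ge0.
  - apply Rle_sqr; [now apply Rmult_le_pos|].
    (* The scalar <a, b> / |b|^2 minimises the distance from [a] to the multiples of [b];
       nonnegativity of that minimum is the inequality. *)
    pose proof (nm_sub_scal a b (ip a b / RtoC (nm b ^ 2))) as H.
    pose proof (pow2_ge_0 (nm (lsub a (lscal (ip a b / RtoC (nm b ^ 2)) b)))) as Hp.
    rewrite H in Hp. clear H.
    assert (Hn : RtoC (nm b ^ 2) <> 0%C).
    { intros E. apply RtoC_inj in E. nra. }
    assert (Hb2 : 0 < nm b ^ 2) by nra.
    rewrite Cdiv_conj, Cconj_R, Cmod_div, Cmod_R, Rabs_pos_eq in Hp by (assumption || lra).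
    replace (Cconj (ip a b) / RtoC (nm b ^ 2) * ip a b)%C
      with (RtoC (Cmod (ip a b) ^ 2 / nm b ^ 2)) in Hp.
    2:{ rewrite RtoC_div, Cmod2_conj by lra. field. exact Hn. }
    rewrite re_RtoC in Hp.
    set (X := Cmod (ip a b)) in *. set (Y := nm b) in *.
    replace (nm a ^ 2 - 2 * (X ^ 2 / Y ^ 2) + (X / Y ^ 2) ^ 2 * Y ^ 2)
      with ((nm a ^ 2 * Y ^ 2 - X ^ 2) / Y ^ 2) in Hp by (field; assumption).
    apply Rmult_le_compat_r with (r := Y ^ 2) in Hp; [|lra].
    replace ((nm a ^ 2 * Y ^ 2 - X ^ 2) / Y ^ 2 * Y ^ 2)
      with (nm a ^ 2 * Y ^ 2 - X ^ 2) in Hp by (field; assumption).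
    rewrite Rpow_mult_distr. lra.
Qed.

Lemma nm_add_sqr (a b : l2) :
  nm (ladd a b) ^ 2 = nm a ^ 2 + 2 * Re (ip a b) + nm b ^ 2.
Proof.
  rewrite nm_sqr_ip, ip_add_l, !ip_add_r, (ip_conj a b), !ip_self.
  unfold Re. destruct (ip a b); simpl. ring.
Qed.

Lemma nm_sub_sqr (a b : l2) :
  nm (lsub a b) ^ 2 = nm a ^ 2 - 2 * Re (ip a b) + nm b ^ 2.
Proof.
  rewrite nm_sqr_ip, ip_sub_l, !ip_sub_r, (ip_conj a b), !ip_self.
  unfold Re. destruct (ip a b); simpl. ring.
Qed.

Lemma Re_ip_le (a b : l2) : Rabs (Re (ip a b)) <= nm a * nm b.
Proof. eapply Rle_trans; [apply re_le_Cmod|apply cauchy_schwarz]. Qed.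

Lemma nm_triangle (a b : l2) : nm (ladd a b) <= nm a + nm b.
Proof.
  pose proof (nm_ge0 a). pose proof (nm_ge0 b).
  apply Rle_sqr; [lra|]. rewrite nm_add_sqr.
  pose proof (Re_ip_le a b) as H1. apply Rabs_le_between in H1. nra.
Qed.

Lemma nm_sub_comm (a b : l2) : nm (lsub a b) = nm (lsub b a).
Proof.
  replace (lsub a b) with (lscal (-(1)) (lsub b a)) by l2ring.
  rewrite nm_scal, Cmod_m1. ring.
Qed.

Lemma nm_sub_triangle (a b c : l2) : nm (lsub a c) <= nm (lsub a b) + nm (lsub b c).
Proof. replace (lsub a c) with (ladd (lsub a b) (lsub b c)) by l2ring. apply nm_triangle. Qed.

Lemma nm_le_sub (a b : l2) : nm a <= nm b + nm (lsub a b).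
Proof.
  replace a with (ladd b (lsub a b)) at 1 by l2ring. apply nm_triangle.
Qed.

(** * Norm convergence and completeness *)

Definition conv (u : nat -> l2) (l : l2) : Prop :=
  forall eps, 0 < eps -> exists N, forall n, (N <= n)%nat -> nm (lsub (u n) l) < eps.

Definition ccv (u : nat -> C) (l : C) : Prop :=
  forall eps, 0 < eps -> exists N, forall n, (N <= n)%nat -> Cmod (u n - l) < eps.

Lemma conv_ip_l (u : nat -> l2) l b : conv u l -> ccv (fun n => ip (u n) b) (ip l b).
Proof.
  intros Hu eps He. pose proof (nm_ge0 b) as Hb.
  destruct (Hu (eps / (nm b + 1))) as [N HN]; [apply Rdiv_lt_0_compat; lra|].
  exists N. intros n Hn. rewrite <- ip_sub_l.
  eapply Rle_lt_trans; [apply cauchy_schwarz|].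
  specialize (HN n Hn). pose proof (nm_ge0 (lsub (u n) l)).
  apply Rle_lt_trans with (nm (lsub (u n) l) * (nm b + 1)).
  - apply Rmult_le_compat_l; lra.
  - apply Rlt_div_r in HN; lra.
Qed.

Lemma eq_of_eps (a b : C) : (forall eps, 0 < eps -> Cmod (a - b) < eps) -> a = b.
Proof.
  intros H. assert (E : (a - b)%C = 0%C).
  { apply Cmod_eq_0. pose proof (Cmod_ge_0 (a - b)).
    destruct (Req_dec (Cmod (a - b)) 0) as [|Hn]; [assumption|].
    specialize (H (Cmod (a - b))). lra. }
  replace a with ((a - b) + b)%C by ring. rewrite E. ring.
Qed.

Lemma ccv_const u c l : ccv u l -> (forall n, u n = c) -> c = l.
Proof.
  intros Hu Hc. apply eq_of_eps. intros eps He.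
  destruct (Hu eps He) as [N HN]. specialize (HN N (le_n N)). now rewrite Hc in HN.
Qed.

Lemma ccv_conj u l : ccv u l -> ccv (fun n => Cconj (u n)) (Cconj l).
Proof.
  intros Hu eps He. destruct (Hu eps He) as [N HN]. exists N. intros n Hn.
  rewrite <- Cminus_conj, Cmod_conj. now apply HN.
Qed.

Lemma ccv_mult u v l m : ccv u l -> ccv v m -> ccv (fun n => u n * v n)%C (l * m)%C.
Proof.
  intros Hu Hv eps He.
  pose proof (Cmod_ge_0 l) as Hl. pose proof (Cmod_ge_0 m) as Hm.
  set (K := Cmod l + Cmod m + 1).
  set (d := Rmin 1 (eps / K)).
  assert (HK : 0 < K) by (unfold K; lra).
  assert (Hd : 0 < d) by (apply Rmin_pos; [lra|now apply Rdiv_lt_0_compat]).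
  destruct (Hu d Hd) as [N1 H1]. destruct (Hv d Hd) as [N2 H2].
  exists (Nat.max N1 N2). intros n Hn.
  specialize (H1 n ltac:(lia)). specialize (H2 n ltac:(lia)).
  replace (u n * v n - l * m)%C with
    ((u n - l) * (v n - m) + (l * (v n - m) + m * (u n - l)))%C by ring.
  eapply Rle_lt_trans; [apply Cmod_triangle|].
  eapply Rle_lt_trans; [apply Rplus_le_compat_l, Cmod_triangle|].
  rewrite !Cmod_mult.
  pose proof (Cmod_ge_0 (u n - l)). pose proof (Cmod_ge_0 (v n - m)).
  assert (d <= 1) by apply Rmin_l.
  assert (Hdk : d <= eps / K) by apply Rmin_r.
  apply Rle_div_r in Hdk; [|exact HK].
  apply Rlt_le_trans with (d * K); [|exact Hdk].
  unfold K in *. nra.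
Qed.

Lemma conv_ip_r (u : nat -> l2) l b : conv u l -> ccv (fun n => ip b (u n)) (ip b l).
Proof.
  intros Hu. rewrite ip_conj. intros eps He.
  destruct (ccv_conj _ _ (conv_ip_l u l b Hu) eps He) as [N HN].
  exists N. intros n Hn. rewrite (ip_conj (u n) b). now apply HN.
Qed.

Lemma is_lim_seq_Rsum_fin (F : nat -> nat -> R) (G : nat -> R) K :
  (forall k, is_lim_seq (fun m => F m k) (G k)) ->
  is_lim_seq (fun m => Rsum (F m) K) (Rsum G K).
Proof.
  intros H. induction K as [|K IH]; simpl; [apply is_lim_seq_const|].
  now apply (is_lim_seq_plus' (fun m => Rsum (F m) K)).
Qed.

Lemma is_lim_seq_sqr (u : nat -> R) (l : R) :
  is_lim_seq u l -> is_lim_seq (fun n => u n ^ 2) (l ^ 2).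
Proof.
  intros H. apply (is_lim_seq_ext (fun n => u n * u n)); [intros; ring|].
  replace (l ^ 2) with (l * l) by ring. now apply is_lim_seq_mult'.
Qed.

(** Coordinates are Cauchy, hence converge. The Cauchy bound is passed to the limit in finite
    partial sums, uniformly in their length, so no limit is exchanged with an infinite sum. *)
Lemma l2_complete (u : nat -> l2) :
  (forall eps, 0 < eps -> exists N, forall n m, (N <= n)%nat -> (N <= m)%nat ->
     nm (lsub (u n) (u m)) < eps) ->
  exists l, conv u l.
Proof.
  intros HC.
  assert (Hc : forall k (p : C -> R),
    (forall x y : C, Rabs (p x - p y) <= Cmod (x - y)) ->
    ex_finite_lim_seq (fun n => p (u n k))).
  { intros k p Hp. apply ex_lim_seq_cauchy_corr. intros [eps He].
    destruct (HC eps He) as [N HN]. exists N. intros n m Hn Hm.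
    eapply Rle_lt_trans; [apply Hp|]. simpl.
    eapply Rle_lt_trans; [apply (coord_le_nm (lsub (u n) (u m)) k)|]. now apply HN. }
  assert (H1 : forall k, ex_finite_lim_seq (fun n => fst (u n k))).
  { intros k. apply (Hc k fst). intros x y. apply (re_le_Cmod (x - y)). }
  assert (H2 : forall k, ex_finite_lim_seq (fun n => snd (u n k))).
  { intros k. apply (Hc k snd). intros x y. apply (im_le_Cmod (x - y)). }
  set (l := fun k => (real (Lim_seq (fun n => fst (u n k))),
                      real (Lim_seq (fun n => snd (u n k))))).
  assert (Hl : forall n k,
    is_lim_seq (fun m => Cmod (u n k - u m k) ^ 2) (Cmod (u n k - l k) ^ 2)).
  { intros n k. rewrite Cmod2_alt.
    apply (is_lim_seq_ext (fun m => (fst (u n k) - fst (u m k)) ^ 2 +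
                                    (snd (u n k) - snd (u m k)) ^ 2)).
    { intros m. rewrite Cmod2_alt. reflexivity. }
    apply is_lim_seq_plus'; apply is_lim_seq_sqr; apply is_lim_seq_minus';
      try apply is_lim_seq_const; simpl.
    - destruct (H1 k) as [x Hx]. now rewrite (is_lim_seq_unique _ _ Hx).
    - destruct (H2 k) as [x Hx]. now rewrite (is_lim_seq_unique _ _ Hx). }
  assert (Hb : forall eps, 0 < eps -> exists N, forall n, (N <= n)%nat -> forall K,
    Rsum (fun k => Cmod (u n k - l k) ^ 2) K <= eps ^ 2).
  { intros eps He. destruct (HC eps He) as [N HN]. exists N. intros n Hn K.
    apply (is_lim_seq_le_loc (fun m => Rsum (fun k => Cmod (u n k - u m k) ^ 2) K)
             (fun _ => eps ^ 2)
             (Rsum (fun k => Cmod (u n k - l k) ^ 2) K) (eps ^ 2)).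
    - exists N. intros m Hm. specialize (HN n m Hn Hm).
      apply Rle_trans with (nm (lsub (u n) (u m)) ^ 2).
      + rewrite nm_sqr. apply (Rsum_le_Series (fun k => Cmod (lsub (u n) (u m) k) ^ 2)).
        * intros; apply pow2_ge_0.
        * apply (valP (lsub (u n) (u m))).
      + pose proof (nm_ge0 (lsub (u n) (u m))). nra.
    - apply (is_lim_seq_Rsum_fin (fun m k => Cmod (u n k - u m k) ^ 2)). apply Hl.
    - apply is_lim_seq_const. }
  assert (Hin : in_H2 l).
  { destruct (Hb 1 Rlt_0_1) as [N HN]. specialize (HN N (le_n N)).
    assert (Hd : in_H2 (h2_sub (u N) l)) by (eapply in_H2_bounded; exact HN).
    replace l with (h2_sub (u N) (h2_sub (u N) l)).
    - apply in_H2_sub; [apply valP|exact Hd].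
    - extensionality k. unfold h2_sub. ring. }
  exists (L2 l Hin). intros eps He.
  destruct (Hb (eps / 2)) as [N HN]; [lra|]. exists N. intros n Hn.
  assert (nm (lsub (u n) (L2 l Hin)) <= eps / 2); [|lra].
  apply Rle_sqr; [lra|]. rewrite nm_sqr. apply Series_bounded.
  - intros; apply pow2_ge_0.
  - exact (HN n Hn).
Qed.

(** * Finite linear combinations *)

Fixpoint lsum (f : nat -> l2) (N : nat) : l2 :=
  match N with O => lzero | S M => ladd (lsum f M) (f M) end.

Definition lcomb (c : nat -> C) (x : nat -> l2) (N : nat) : l2 :=
  lsum (fun n => lscal (c n) (x n)) N.

Lemma val_lcomb c x N : val (lcomb c x N) = h2_lincomb c (fun n => val (x n)) N.
Proof.
  extensionality k. unfold h2_lincomb, lcomb.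
  induction N as [|N IH]; simpl; [reflexivity|now rewrite IH].
Qed.

Lemma Csum_ext (f g : nat -> C) N :
  (forall n, (n < N)%nat -> f n = g n) -> Csum f N = Csum g N.
Proof.
  induction N as [|N IH]; intros H; simpl; [reflexivity|].
  rewrite IH by (intros; apply H; lia). rewrite H by lia. reflexivity.
Qed.

Lemma Csum_0 N : Csum (fun _ => 0%C) N = 0%C.
Proof. induction N as [|N IH]; simpl; [|rewrite IH]; ring. Qed.

Lemma ip_lsum_l f N b : ip (lsum f N) b = Csum (fun n => ip (f n) b) N.
Proof.
  induction N as [|N IH]; simpl; [apply ip_zero_l|]. now rewrite ip_add_l, IH.
Qed.

Lemma ip_lcomb_l c x N b : ip (lcomb c x N) b = Csum (fun n => c n * ip (x n) b)%C N.
Proof.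
  unfold lcomb. rewrite ip_lsum_l. apply Csum_ext; intros. apply ip_scal_l.
Qed.

Lemma ip_lcomb_r c x N b :
  ip b (lcomb c x N) = Csum (fun n => Cconj (c n) * ip b (x n))%C N.
Proof.
  unfold lcomb. induction N as [|N IH]; simpl; [apply ip_zero_r|].
  now rewrite ip_add_r, ip_scal_r, IH.
Qed.

Lemma ip_lcomb_l_eq0 c x N b :
  (forall n, (n < N)%nat -> ip (x n) b = 0%C) -> ip (lcomb c x N) b = 0%C.
Proof.
  intros H. rewrite ip_lcomb_l, <- (Csum_0 N). apply Csum_ext; intros.
  rewrite H by assumption. ring.
Qed.

Lemma lcomb_ext c c' x x' N :
  (forall n, (n < N)%nat -> lscal (c n) (x n) = lscal (c' n) (x' n)) ->
  lcomb c x N = lcomb c' x' N.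
Proof.
  unfold lcomb. induction N as [|N IH]; intros H; simpl; [reflexivity|].
  rewrite IH by (intros; apply H; lia). rewrite H by lia. reflexivity.
Qed.

Lemma lcomb_add c c' x N :
  ladd (lcomb c x N) (lcomb c' x N) = lcomb (fun n => c n + c' n)%C x N.
Proof.
  unfold lcomb. induction N as [|N IH]; simpl; [l2ring|].
  rewrite <- IH. l2ring.
Qed.

Lemma lcomb_scal t c x N : lscal t (lcomb c x N) = lcomb (fun n => t * c n)%C x N.
Proof.
  unfold lcomb. induction N as [|N IH]; simpl; [l2ring|].
  rewrite <- IH. l2ring.
Qed.

Lemma lcomb_sub_r c x y N :
  lsub (lcomb c x N) (lcomb c y N) = lcomb c (fun n => lsub (x n) (y n)) N.
Proof.
  unfold lcomb. induction N as [|N IH]; simpl; [l2ring|].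
  rewrite <- IH. l2ring.
Qed.

(** * Closed spans and orthogonal projection *)

Definition span (x : nat -> l2) (s : l2) : Prop := exists N c, s = lcomb c x N.

(** Combinations run over initial segments, so two of them must be padded to a common length before
    they can be added. *)
Lemma lcomb_pad c x N d :
  lcomb c x N = lcomb (fun n => if (n <? N)%nat then c n else 0%C) x (N + d).
Proof.
  induction d as [|d IH].
  - rewrite Nat.add_0_r. apply lcomb_ext. intros n Hn.
    apply Nat.ltb_lt in Hn. now rewrite Hn.
  - rewrite IH, Nat.add_succ_r. unfold lcomb. simpl.
    replace (N + d <? N)%nat with false by (symmetry; apply Nat.ltb_ge; lia).
    rewrite lscal_0_l. l2ring.
Qed.

Lemma span_add x s t : span x s -> span x t -> span x (ladd s t).
Proof.
  intros [N [c ->]] [N' [c' ->]].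
  rewrite (lcomb_pad c x N N'), (lcomb_pad c' x N' N), (Nat.add_comm N' N), lcomb_add.
  eexists _, _. reflexivity.
Qed.

Lemma span_scal x s t : span x s -> span x (lscal t s).
Proof. intros [N [c ->]]. rewrite lcomb_scal. eexists _, _. reflexivity. Qed.

Lemma span_zero x : span x lzero.
Proof. exists 0%nat, (fun _ => 0%C). reflexivity. Qed.

Lemma span_elt x j : span x (x j).
Proof.
  set (c := fun n => if Nat.eqb n j then 1%C else 0%C).
  exists (S j), c.
  change (lcomb c x (S j)) with (ladd (lcomb c x j) (lscal (c j) (x j))).
  replace (lcomb c x j) with (lscal 0 (lcomb c x j)).
  - unfold c at 2. rewrite Nat.eqb_refl. l2ring.
  - rewrite lcomb_scal. apply lcomb_ext. intros n Hn. unfold c.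
    replace (Nat.eqb n j) with false by (symmetry; apply Nat.eqb_neq; lia). l2ring.
Qed.

(** Membership of [f] in the closed linear span of [x]. *)
Definition approx (x : nat -> l2) (f : l2) : Prop :=
  forall eps, 0 < eps -> exists s, span x s /\ nm (lsub f s) < eps.

Lemma approx_ip_eq0 x f b :
  approx x f -> (forall n, ip (x n) b = 0%C) -> ip f b = 0%C.
Proof.
  intros Hf H0. apply eq_of_eps. intros eps He. pose proof (nm_ge0 b) as Hb.
  destruct (Hf (eps / (nm b + 1))) as [s [[N [c ->]] Hs]]; [apply Rdiv_lt_0_compat; lra|].
  rewrite <- (ip_lcomb_l_eq0 c x N b) by auto. rewrite <- ip_sub_l.
  eapply Rle_lt_trans; [apply cauchy_schwarz|].
  pose proof (nm_ge0 (lsub f (lcomb c x N))).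
  apply Rle_lt_trans with (nm (lsub f (lcomb c x N)) * (nm b + 1)).
  - apply Rmult_le_compat_l; lra.
  - apply Rlt_div_r in Hs; lra.
Qed.

Lemma parallelogram (g s t : l2) :
  nm (lsub s t) ^ 2 =
  2 * nm (lsub g s) ^ 2 + 2 * nm (lsub g t) ^ 2 - 4 * nm (lsub g (lscal (/ 2) (ladd s t))) ^ 2.
Proof.
  assert (H : 4 * nm (lsub g (lscal (/ 2) (ladd s t))) ^ 2 =
              nm (ladd (lsub g s) (lsub g t)) ^ 2).
  { replace (ladd (lsub g s) (lsub g t)) with (lscal 2 (lsub g (lscal (/ 2) (ladd s t)))).
    - rewrite nm_scal, Cmod_R, Rabs_pos_eq by lra. ring.
    - l2ring. field. }
  rewrite H. replace (lsub s t) with (lsub (lsub g t) (lsub g s)) by l2ring.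
  rewrite nm_add_sqr, nm_sub_sqr, (ip_conj (lsub g s)), re_conj. ring.
Qed.

(** The projection of [g] onto the closed span is recorded by its residual [r]. It is the limit of a
    minimising sequence, which is Cauchy by the parallelogram law. *)
Lemma projection (x : nat -> l2) (g : l2) :
  exists r, (forall n, ip r (x n) = 0%C) /\ approx x (lsub g r).
Proof.
  (* Squared distances are negated because [completeness] yields suprema; [d] below is then their
     infimum. *)
  set (E := fun d => exists s, span x s /\ d = - nm (lsub g s) ^ 2).
  destruct (completeness E) as [m [Hub Hlub]].
  { exists 0. intros d [s [_ ->]]. pose proof (pow2_ge_0 (nm (lsub g s))). lra. }
  { exists (- nm (lsub g lzero) ^ 2), lzero. split; [apply span_zero|reflexivity]. }
  set (d := - m).
  assert (Hd : forall s, span x s -> d <= nm (lsub g s) ^ 2).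
  { intros s Hs. assert (- nm (lsub g s) ^ 2 <= m) by (apply Hub; now exists s).
    unfold d. lra. }
  assert (Hmin : forall n : nat, exists s, span x s /\ nm (lsub g s) ^ 2 < d + / (INR n + 1)).
  { intros n. pose proof (pos_INR n) as Hn.
    assert (Hp : 0 < / (INR n + 1)) by (apply Rinv_0_lt_compat; lra).
    apply NNPP. intros Hno.
    assert (m <= m - / (INR n + 1)); [|lra].
    apply Hlub. intros e [s [Hs ->]]. apply Rnot_lt_le. intros Hlt.
    apply Hno. exists s. split; [exact Hs|]. unfold d. lra. }
  destruct (choice _ Hmin) as [w Hw].
  (* The midpoint of [w n] and [w k] is in the span, so its squared distance to [g] is at least [d];
     the two copies of 2 d cancel the 4 d in the parallelogram law. *)
  assert (Hwm : forall n k, nm (lsub (w n) (w k)) ^ 2 <= 2 * / (INR n + 1) + 2 * / (INR k + 1)).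
  { intros n k. rewrite (parallelogram g).
    destruct (Hw n) as [Hs1 H1]. destruct (Hw k) as [Hs2 H2].
    pose proof (Hd _ (span_scal _ _ (/ 2)%C (span_add _ _ _ Hs1 Hs2))). lra. }
  destruct (l2_complete w) as [l Hl].
  { intros eps He. destruct (archimed_cor1 (eps ^ 2 / 4)) as [N [HN1 HN2]]; [nra|].
    exists N. intros n k Hn Hk. specialize (Hwm n k).
    assert (HNp : 0 < INR N) by (apply lt_0_INR; lia).
    assert (Hb : forall i, (N <= i)%nat -> / (INR i + 1) < / INR N).
    { intros i Hi. apply Rinv_lt_contravar.
      - apply le_INR in Hi. nra.
      - apply le_INR in Hi. lra. }
    pose proof (Hb n Hn). pose proof (Hb k Hk).
    apply Rnot_le_lt. intros Hle.
    assert (eps ^ 2 <= nm (lsub (w n) (w k)) ^ 2) by (apply pow_incr; lra). lra. }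
  exists (lsub g l). split.
  (* The limit [l] need not lie in the span. If shifting it by [s] gained [e], then shifting a late
     [w n] by [s] would still gain e/3 and fall below the infimum. *)
  - assert (Hr : forall s, span x s -> nm (lsub g l) <= nm (lsub (lsub g l) s)).
    { intros s Hs. apply Rnot_lt_le. intros Hlt.
      set (e := nm (lsub g l) - nm (lsub (lsub g l) s)).
      destruct (Hl (e / 3)) as [N HN]; [unfold e; lra|].
      destruct (archimed_cor1 (e ^ 2 / 9)) as [N' [HN1 HN2]]; [unfold e; nra|].
      set (n := Nat.max N N').
      specialize (HN n (Nat.le_max_l _ _)).
      destruct (Hw n) as [Hs1 H1].
      pose proof (Hd _ (span_add _ _ _ Hs1 Hs)) as H2.
      assert (H3 : nm (lsub g (ladd (w n) s)) <= nm (lsub (lsub g l) s) + e / 3).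
      { replace (lsub g (ladd (w n) s)) with (ladd (lsub (lsub g l) s) (lsub l (w n))) by l2ring.
        eapply Rle_trans; [apply nm_triangle|]. rewrite (nm_sub_comm l). lra. }
      assert (H4 : nm (lsub g l) <= nm (lsub g (w n)) + e / 3).
      { eapply Rle_trans; [apply (nm_sub_triangle g (w n))|]. lra. }
      assert (H5 : / (INR n + 1) < e ^ 2 / 9).
      { eapply Rlt_trans; [|exact HN1].
        assert (INR N' <= INR n) by (apply le_INR, Nat.le_max_r).
        assert (0 < INR N') by (apply lt_0_INR; lia).
        apply Rinv_lt_contravar; nra. }
      pose proof (nm_ge0 (lsub g (ladd (w n) s))).
      pose proof (nm_ge0 (lsub (lsub g l) s)).
      assert (nm (lsub g (ladd (w n) s)) ^ 2 <= (nm (lsub g (w n)) - e / 3) ^ 2).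
      { apply pow_incr. unfold e in *. lra. }
      assert (0 < e) by (unfold e; lra).
      assert (e / 3 <= nm (lsub g (w n)) - e / 3) by (unfold e in *; lra).
      nra. }
    intros n. apply Cmod_eq_0.
    set (r := lsub g l) in *. set (z := ip r (x n)).
    pose proof (Cmod_ge_0 z) as Hz.
    destruct (Req_dec (Cmod z) 0) as [|Hz0]; [assumption|exfalso].
    (* Subtracting t z x_n from [r] lowers its squared norm by t |z|^2 (2 - t |x_n|^2), positive for
       this [t]; the added 1 covers x_n = 0. *)
    set (t := / (nm (x n) ^ 2 + 1)).
    assert (Hx : 0 <= nm (x n) ^ 2) by apply pow2_ge_0.
    assert (Ht : 0 < t) by (apply Rinv_0_lt_compat; lra).
    pose proof (Hr _ (span_scal _ _ (t * z)%C (span_elt x n))) as H.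
    assert (H2 : nm r ^ 2 <= nm (lsub r (lscal (t * z) (x n))) ^ 2)
      by (apply pow_incr; split; [apply nm_ge0|exact H]).
    rewrite nm_sub_scal in H2. fold z in H2.
    rewrite Cmod_mult, Cmod_R, (Rabs_pos_eq t) in H2 by lra.
    replace (Cconj (t * z) * z)%C with (RtoC (t * Cmod z ^ 2)) in H2.
    2:{ rewrite RtoC_mult, Cmod2_conj, Cmult_conj, Cconj_R. ring. }
    rewrite re_RtoC in H2.
    assert (Htx : t * nm (x n) ^ 2 < 1).
    { unfold t. apply Rmult_lt_reg_l with (nm (x n) ^ 2 + 1); [lra|].
      field_simplify; lra. }
    assert (Hzz : 0 < Cmod z ^ 2) by nra.
    assert (0 < t * Cmod z ^ 2 * (2 - t * nm (x n) ^ 2))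
      by (apply Rmult_lt_0_compat; [apply Rmult_lt_0_compat|]; lra).
    nra.
  - intros eps He. destruct (Hl eps He) as [N HN].
    exists (w N). split; [apply Hw|].
    replace (lsub (lsub g (lsub g l)) (w N)) with (lsub l (w N)) by l2ring.
    rewrite nm_sub_comm. now apply HN.
Qed.

(** * Multiplication operators on the Hardy space *)

Definition shift_raw (f : seqC) : seqC :=
  fun k => match k with O => 0%C | S m => f m end.

Lemma in_H2_shift (f : seqC) : in_H2 f -> in_H2 (shift_raw f).
Proof. intros H. apply ex_series_incr_1. exact H. Qed.

Definition shift (f : l2) : l2 := L2 _ (in_H2_shift f (valP f)).

Lemma ip_shift (f g : l2) : ip (shift f) (shift g) = ip f g.
Proof.
  rewrite !ip_CSeries. destruct (ex_CSeries_ip (shift f) (shift g)) as [H1 H2].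
  unfold CSeries. rewrite (Series_incr_1 _ H1), (Series_incr_1 _ H2).
  simpl. f_equal; ring.
Qed.

Lemma nm_shift (f : l2) : nm (shift f) = nm f.
Proof.
  pose proof (nm_ge0 f). pose proof (nm_ge0 (shift f)).
  assert (nm (shift f) ^ 2 = nm f ^ 2) by (rewrite !nm_sqr_ip, ip_shift; reflexivity).
  apply Rle_antisym; apply Rle_sqr; lra.
Qed.

Lemma shift_add f g : shift (ladd f g) = ladd (shift f) (shift g).
Proof. apply l2_ext; intros [|k]; simpl; ring. Qed.

Lemma shift_scal c f : shift (lscal c f) = lscal c (shift f).
Proof. apply l2_ext; intros [|k]; simpl; unfold h2_scal; simpl; ring. Qed.

Lemma shift_sub f g : shift (lsub f g) = lsub (shift f) (shift g).
Proof. rewrite !sub_add, shift_add, shift_scal. reflexivity. Qed.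

(** The recursion obtained by comparing coefficients in (1 - conj a z) g = f. *)
Fixpoint ldiv_raw (a : C) (f : seqC) (n : nat) : C :=
  match n with O => f O | S m => (f (S m) + Cconj a * ldiv_raw a f m)%C end.

(** By convexity |u + conj a v|^2 <= |u|^2 / (1 - |a|) + |a| |v|^2. Summing the recursion and
    absorbing the term with factor |a| < 1 gives the bound. *)
Lemma ldiv_raw_bound (a : C) (f : seqC) N : in_disc a ->
  Rsum (fun k => Cmod (ldiv_raw a f k) ^ 2) N <=
  / (1 - Cmod a) ^ 2 * Rsum (fun k => Cmod (f k) ^ 2) N.
Proof.
  unfold in_disc. intros Ha. pose proof (Cmod_ge_0 a) as Ha0.
  set (G := fun k => Cmod (ldiv_raw a f k) ^ 2). set (F := fun k => Cmod (f k) ^ 2).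
  assert (Hstep : forall n, G (S n) <= / (1 - Cmod a) * F (S n) + Cmod a * G n).
  { intros n. unfold G, F. simpl ldiv_raw.
    set (v := ldiv_raw a f n). set (u := f (S n)).
    pose proof (Cmod_triangle u (Cconj a * v)) as Ht. rewrite Cmod_mult, Cmod_conj in Ht.
    pose proof (Cmod_ge_0 (u + Cconj a * v)). pose proof (Cmod_ge_0 u).
    pose proof (Cmod_ge_0 v).
    apply Rle_trans with ((Cmod u + Cmod a * Cmod v) ^ 2); [apply pow_incr; lra|].
    apply Rmult_le_reg_l with (1 - Cmod a); [lra|].
    rewrite Rmult_plus_distr_l, <- Rmult_assoc, Rinv_r, Rmult_1_l by lra.
    (* After multiplication by 1 - |a|, this is exactly the slack in the convexity inequality. *)
    pose proof (Rmult_le_pos _ _ Ha0 (pow2_ge_0 (Cmod u - (1 - Cmod a) * Cmod v))).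
    nra. }
  assert (Hs : forall N, Rsum G N <= / (1 - Cmod a) * Rsum F N + Cmod a * Rsum G N).
  { assert (Hs' : forall N, Rsum G (S N) <= / (1 - Cmod a) * Rsum F (S N) + Cmod a * Rsum G N).
    { induction N0 as [|n IH].
      - simpl. unfold G, F; simpl.
        assert (1 <= / (1 - Cmod a)).
        { rewrite <- Rinv_1. apply Rinv_le_contravar; lra. }
        pose proof (pow2_ge_0 (Cmod (f 0%nat))). nra.
      - change (Rsum G (S (S n))) with (Rsum G (S n) + G (S n)).
        change (Rsum F (S (S n))) with (Rsum F (S n) + F (S n)).
        change (Rsum G (S n)) with (Rsum G n + G n) at 2.
        specialize (Hstep n). lra. }
    intros [|n]; [simpl; lra|]. eapply Rle_trans; [apply Hs'|].
    apply Rplus_le_compat_l, Rmult_le_compat_l; [lra|].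
    apply Rsum_mono; [intros; apply pow2_ge_0|lia]. }
  specialize (Hs N).
  apply Rmult_le_reg_l with (1 - Cmod a); [lra|].
  replace ((1 - Cmod a) * (/ (1 - Cmod a) ^ 2 * Rsum F N))
    with (/ (1 - Cmod a) * Rsum F N) by (field; lra).
  lra.
Qed.

Lemma in_H2_ldiv (a : C) (f : seqC) : in_disc a -> in_H2 f -> in_H2 (ldiv_raw a f).
Proof.
  intros Ha Hf.
  apply (in_H2_bounded _ (/ (1 - Cmod a) ^ 2 * Series (fun k => Cmod (f k) ^ 2))).
  intros N. eapply Rle_trans; [now apply ldiv_raw_bound|].
  unfold in_disc in Ha.
  apply Rmult_le_compat_l.
  - left. apply Rinv_0_lt_compat. nra.
  - apply Rsum_le_Series; [intros; apply pow2_ge_0|exact Hf].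
Qed.

(* Division by [1 - conj a z]; the junk value is [f] when the quotient is not in [H^2]. *)
Definition ldiv (a : C) (f : l2) : l2 :=
  match excluded_middle_informative (in_H2 (ldiv_raw a f)) with
  | left H => L2 _ H
  | right _ => f
  end.

Lemma val_ldiv (a : C) (f : l2) : in_disc a -> val (ldiv a f) = ldiv_raw a f.
Proof.
  intros Ha. unfold ldiv.
  destruct (excluded_middle_informative (in_H2 (ldiv_raw a f))) as [H|H]; [reflexivity|].
  destruct H. apply in_H2_ldiv; [exact Ha|apply valP].
Qed.

Lemma nm_ldiv (a : C) (f : l2) : in_disc a -> nm (ldiv a f) <= / (1 - Cmod a) * nm f.
Proof.
  intros Ha. pose proof Ha as Ha'. unfold in_disc in Ha'.
  assert (H : 0 < / (1 - Cmod a)) by (apply Rinv_0_lt_compat; lra).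
  apply Rle_sqr.
  - apply Rmult_le_pos; [lra|apply nm_ge0].
  - rewrite Rpow_mult_distr, !nm_sqr, (val_ldiv a f Ha), pow_inv.
    apply Series_bounded; [intros; apply pow2_ge_0|]. intros N.
    eapply Rle_trans; [now apply ldiv_raw_bound|].
    apply Rmult_le_compat_l.
    + left. apply Rinv_0_lt_compat. nra.
    + apply Rsum_le_Series; [intros; apply pow2_ge_0|apply (valP f)].
Qed.

Definition den (a : C) (f : l2) : l2 := lsub f (lscal (Cconj a) (shift f)).

Lemma den_ldiv (a : C) (f : l2) : in_disc a -> den a (ldiv a f) = f.
Proof.
  intros Ha. apply l2_ext; intros [|k]; simpl; unfold h2_sub, h2_scal, shift_raw;
    rewrite (val_ldiv a f Ha); simpl; ring.
Qed.

(** The difference h satisfies h = conj a z h, and the shift is isometric, so |h| = |a| |h| with |a|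
    < 1. This reduces the commutation rules for [ldiv] to those for [den], a polynomial in the
    shift. *)
Lemma den_inj (a : C) (f g : l2) : in_disc a -> den a f = den a g -> f = g.
Proof.
  intros Ha H. unfold in_disc in Ha.
  assert (E : lsub f g = lscal (Cconj a) (shift (lsub f g))).
  { rewrite shift_sub. unfold den in H.
    replace (lsub f g) with (ladd (lsub (lsub f (lscal (Cconj a) (shift f)))
      (lsub g (lscal (Cconj a) (shift g)))) (lscal (Cconj a) (lsub (shift f) (shift g))))
      by l2ring.
    rewrite H. l2ring. }
  pose proof (nm_ge0 (lsub f g)) as H0. pose proof (Cmod_ge_0 a).
  assert (E2 : nm (lsub f g) = Cmod a * nm (lsub f g)).
  { rewrite E at 1. now rewrite nm_scal, Cmod_conj, nm_shift. }
  assert (E3 : lsub f g = lzero) by (apply nm_eq0; nra).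
  replace f with (ladd g (lsub f g)) by l2ring. rewrite E3. l2ring.
Qed.

Lemma den_add a f g : den a (ladd f g) = ladd (den a f) (den a g).
Proof. unfold den. rewrite shift_add. l2ring. Qed.

Lemma den_scal a c f : den a (lscal c f) = lscal c (den a f).
Proof. unfold den. rewrite shift_scal. l2ring. Qed.

Lemma den_shift a f : den a (shift f) = shift (den a f).
Proof. unfold den. now rewrite shift_sub, shift_scal. Qed.

Lemma den_comm a b f : den a (den b f) = den b (den a f).
Proof. unfold den. rewrite !shift_sub, !shift_scal. l2ring. Qed.

Lemma ldiv_add a f g : in_disc a -> ldiv a (ladd f g) = ladd (ldiv a f) (ldiv a g).
Proof. intros Ha. apply (den_inj a _ _ Ha). now rewrite den_add, !den_ldiv. Qed.

Lemma ldiv_scal a c f : in_disc a -> ldiv a (lscal c f) = lscal c (ldiv a f).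
Proof. intros Ha. apply (den_inj a _ _ Ha). now rewrite den_scal, !den_ldiv. Qed.

Lemma ldiv_shift a f : in_disc a -> ldiv a (shift f) = shift (ldiv a f).
Proof. intros Ha. apply (den_inj a _ _ Ha). now rewrite den_shift, !den_ldiv. Qed.

Lemma ldiv_sub a f g : in_disc a -> ldiv a (lsub f g) = lsub (ldiv a f) (ldiv a g).
Proof. intros Ha. rewrite !sub_add, ldiv_add, ldiv_scal by exact Ha. reflexivity. Qed.

Lemma ldiv_comm a b f : in_disc a -> in_disc b -> ldiv a (ldiv b f) = ldiv b (ldiv a f).
Proof.
  intros Ha Hb. apply (den_inj a _ _ Ha), (den_inj b _ _ Hb).
  rewrite den_ldiv by exact Ha. rewrite den_comm, !den_ldiv by assumption. reflexivity.
Qed.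

(* The unimodular constant of [bfactor]; at [a = 0] the factor is [z = -(0 - z)]. *)
Definition phase (a : C) : C :=
  if Req_EM_T (Cmod a) 0 then (-(1))%C else (RtoC (Cmod a) / a)%C.

Lemma Cmod_phase a : Cmod (phase a) = 1.
Proof.
  unfold phase. destruct (Req_EM_T (Cmod a) 0) as [H|H]; [apply Cmod_m1|].
  assert (a <> 0%C) by (intros ->; now rewrite Cmod_0 in H).
  rewrite Cmod_div, Cmod_R, Rabs_pos_eq by (assumption || apply Cmod_ge_0). now field.
Qed.

Lemma phase_conj a : (phase a * Cconj (phase a))%C = 1%C.
Proof. rewrite <- Cmod2_conj, Cmod_phase. f_equal. ring. Qed.

Lemma bfactor_phase a z :
  bfactor a z = (phase a * ((a - z) / (1 - Cconj a * z)))%C.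
Proof.
  unfold bfactor, phase. destruct (Req_EM_T (Cmod a) 0) as [H|H]; [|reflexivity].
  apply Cmod_eq_0 in H. subst a. rewrite Cconj_R. field.
Qed.

(** Multiplication by [bfactor a] on Taylor coefficients, as [eval_mulb] confirms at points. *)
Definition mulb (a : C) (f : l2) : l2 :=
  lscal (phase a) (lsub (lscal a (ldiv a f)) (shift (ldiv a f))).

Lemma mulb_add a f g : in_disc a -> mulb a (ladd f g) = ladd (mulb a f) (mulb a g).
Proof. intros Ha. unfold mulb. rewrite ldiv_add, shift_add by exact Ha. l2ring. Qed.

Lemma mulb_scal a c f : in_disc a -> mulb a (lscal c f) = lscal c (mulb a f).
Proof. intros Ha. unfold mulb. rewrite ldiv_scal, shift_scal by exact Ha. l2ring. Qed.

Lemma mulb_ldiv a b f : in_disc a -> in_disc b -> mulb a (ldiv b f) = ldiv b (mulb a f).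
Proof.
  intros Ha Hb. unfold mulb.
  now rewrite ldiv_scal, ldiv_sub, ldiv_scal, ldiv_shift, (ldiv_comm b a).
Qed.

Lemma mulb_shift a f : in_disc a -> mulb a (shift f) = shift (mulb a f).
Proof.
  intros Ha. unfold mulb. now rewrite shift_scal, shift_sub, shift_scal, ldiv_shift.
Qed.

Lemma mulb_comm a b f : in_disc a -> in_disc b -> mulb a (mulb b f) = mulb b (mulb a f).
Proof.
  intros Ha Hb. unfold mulb at 2. 
  rewrite mulb_scal, sub_add, mulb_add, !mulb_scal, mulb_shift, !mulb_ldiv, <- sub_add
    by assumption.
  reflexivity.
Qed.

(* With [u = ldiv a f] and [v = ldiv a g], both sides expand to
   [(1 + |a|^2) <u,v> - a <u,zv> - conj a <zu,v>]. *)
Lemma ip_mulb a f g : in_disc a -> ip (mulb a f) (mulb a g) = ip f g.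
Proof.
  intros Ha. rewrite <- (den_ldiv a f Ha) at 2. rewrite <- (den_ldiv a g Ha) at 2.
  unfold mulb, den. set (u := ldiv a f). set (v := ldiv a g).
  rewrite !ip_scal_l, !ip_scal_r, !ip_sub_l, !ip_sub_r, !ip_scal_l, !ip_scal_r, !ip_shift,
    Cconj_conj.
  rewrite Cmult_assoc, phase_conj. ring.
Qed.

Lemma nm_mulb a f : in_disc a -> nm (mulb a f) = nm f.
Proof.
  intros Ha. pose proof (nm_ge0 f). pose proof (nm_ge0 (mulb a f)).
  assert (nm (mulb a f) ^ 2 = nm f ^ 2) by (rewrite !nm_sqr_ip, ip_mulb; trivial).
  apply Rle_antisym; apply Rle_sqr; lra.
Qed.

(** * Szego kernels and point evaluation *)

Lemma in_H2_one : in_H2 (fun k => match k with O => 1%C | S _ => 0%C end).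
Proof. apply ex_series_incr_1. 
  apply (ex_series_Rext (fun k => Cmod 0 ^ 2)); [reflexivity|exact in_H2_zero].
Qed.

Definition lone : l2 := L2 _ in_H2_one.

(** The reproducing kernel 1 / (1 - conj a z). Written as a quotient of 1, it inherits the
    commutation rules of [ldiv]. *)
Definition szego (a : C) : l2 := ldiv a lone.

Lemma val_szego a k : in_disc a -> val (szego a) k = (Cconj a ^ k)%C.
Proof.
  intros Ha. unfold szego. rewrite (val_ldiv a lone Ha).
  induction k as [|k IH]; [reflexivity|].
  cbn [ldiv_raw]. rewrite IH. change (val lone (S k)) with (RtoC 0). rewrite Cpow_S. ring.
Qed.

Lemma h2_eval_ip (f : l2) z : in_disc z -> h2_eval f z = ip f (szego z).
Proof.
  intros Hz. unfold h2_eval. rewrite ip_CSeries.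
  etransitivity; [exact (CLim_Csum _)|]. apply CSeries_ext; intros k.
  rewrite val_szego, Cpow_conj, Cconj_conj by exact Hz. reflexivity.
Qed.

Lemma szego_rec z : in_disc z -> szego z = ladd lone (lscal (Cconj z) (shift (szego z))).
Proof.
  intros Hz. pose proof (den_ldiv z lone Hz) as H. unfold den in H. fold (szego z) in H.
  rewrite <- H. l2ring.
Qed.

Lemma ip_shift_one f : ip (shift f) lone = 0%C.
Proof.
  rewrite ip_CSeries.
  rewrite (CSeries_ext _ (fun k => 0 * (lone k * Cconj (lone k)))%C).
  - rewrite CSeries_scal by apply ex_CSeries_ip. ring.
  - intros [|k]; simpl; [ring|]. rewrite Cconj_R. ring.
Qed.

Lemma nm_one : nm lone = 1.
Proof.
  unfold nm, h2_norm. rewrite Series_incr_1 by apply (valP lone).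
  rewrite (Series_ext _ (fun _ => 0 * 0)).
  - rewrite Series_scal_l. simpl. rewrite Cmod_1.
    replace (1 * (1 * 1) + 0 * _) with 1 by ring. apply sqrt_1.
  - intros k. simpl. rewrite Cmod_0. ring.
Qed.

Lemma eval_shift f z : in_disc z -> ip (shift f) (szego z) = (z * ip f (szego z))%C.
Proof.
  intros Hz. rewrite (szego_rec z Hz) at 1.
  rewrite ip_add_r, ip_shift_one, ip_scal_r, ip_shift, Cconj_conj. ring.
Qed.

Lemma one_minus_ne0 a z : in_disc a -> in_disc z -> (1 - Cconj a * z)%C <> 0%C.
Proof.
  unfold in_disc. intros Ha Hz E.
  assert (E1 : (Cconj a * z)%C = 1%C).
  { replace (Cconj a * z)%C with (1 - (1 - Cconj a * z))%C by ring. rewrite E. ring. }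
  apply (f_equal Cmod) in E1. rewrite Cmod_mult, Cmod_conj, Cmod_1 in E1.
  pose proof (Cmod_ge_0 a). pose proof (Cmod_ge_0 z). nra.
Qed.

Lemma eval_ldiv a f z : in_disc a -> in_disc z ->
  ip (ldiv a f) (szego z) = (ip f (szego z) / (1 - Cconj a * z))%C.
Proof.
  intros Ha Hz. rewrite <- (den_ldiv a f Ha) at 2. unfold den.
  rewrite ip_sub_l, ip_scal_l, eval_shift by exact Hz.
  field. now apply one_minus_ne0.
Qed.

Lemma eval_one z : in_disc z -> ip lone (szego z) = 1%C.
Proof.
  intros Hz. rewrite (szego_rec z Hz), ip_add_r, ip_scal_r, ip_self, nm_one.
  rewrite (ip_eq0_sym _ _ (ip_shift_one (szego z))). rewrite pow1. ring.
Qed.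

Lemma eval_szego a z : in_disc a -> in_disc z -> ip (szego a) (szego z) = (/ (1 - Cconj a * z))%C.
Proof.
  intros Ha Hz. unfold szego at 1. rewrite eval_ldiv, eval_one by assumption.
  field. now apply one_minus_ne0.
Qed.

Lemma eval_mulb a f z : in_disc a -> in_disc z ->
  ip (mulb a f) (szego z) = (bfactor a z * ip f (szego z))%C.
Proof.
  intros Ha Hz. unfold mulb. rewrite bfactor_phase.
  rewrite ip_scal_l, ip_sub_l, ip_scal_l, eval_shift, !eval_ldiv by assumption.
  field. now apply one_minus_ne0.
Qed.

Lemma in_disc_0 : in_disc 0.
Proof. unfold in_disc. rewrite Cmod_0. lra. Qed.

Lemma CV_radius_pos (u : nat -> R) B :
  (forall k, Rabs (u k) <= B) -> Rbar_lt 0 (CV_radius u).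
Proof.
  intros H. apply Rbar_lt_le_trans with 1; [simpl; lra|].
  apply (proj1 (CV_radius_bounded u)). exists B. intros n. rewrite pow1, Rmult_1_r. apply H.
Qed.

Lemma PSeries_eq0 (u : nat -> R) B :
  (forall k, Rabs (u k) <= B) -> (forall x, Rabs x < 1 -> PSeries u x = 0) ->
  forall k, u k = 0.
Proof.
  intros HB H0 k. apply (PSeries_ext_recip u (fun _ => 0)).
  - now apply CV_radius_pos with B.
  - rewrite CV_radius_const_0. exact I.
  - exists (mkposreal 1 Rlt_0_1). intros x Hx. rewrite PSeries_const_0. apply H0.
    replace x with (x - 0) by ring. exact Hx.
Qed.

(** Real points suffice: the real and imaginary parts of the coefficients form two real power series
    vanishing on (-1, 1), and bounded coefficients give them a positive radius of convergence. *)
Lemma eval_eq0 f : (forall z, in_disc z -> ip f (szego z) = 0%C) -> f = lzero.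
Proof.
  intros H.
  assert (Hf : forall x : R, Rabs x < 1 ->
    CSeries (fun k => f k * RtoC (x ^ k))%C = 0%C).
  { intros x Hx. assert (Hd : in_disc x) by (unfold in_disc; now rewrite Cmod_R).
    rewrite <- (H x Hd), ip_CSeries. apply CSeries_ext; intros k.
    rewrite val_szego, Cpow_conj, Cconj_conj, RtoC_pow by exact Hd. reflexivity. }
  apply l2_ext; intros k; simpl. apply injective_projections; simpl.
  - apply (PSeries_eq0 (fun k => fst (f k)) (nm f)).
    + intros n. eapply Rle_trans; [apply re_le_Cmod|apply coord_le_nm].
    + intros x Hx. specialize (Hf x Hx). apply (f_equal fst) in Hf. simpl in Hf.
      rewrite <- Hf. apply Series_ext; intros n. ring.
  - apply (PSeries_eq0 (fun k => snd (f k)) (nm f)).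
    + intros n. eapply Rle_trans; [apply im_le_Cmod|apply coord_le_nm].
    + intros x Hx. specialize (Hf x Hx). apply (f_equal snd) in Hf. simpl in Hf.
      rewrite <- Hf. apply Series_ext; intros n. ring.
Qed.

Lemma eval_inj f g : (forall z, in_disc z -> ip f (szego z) = ip g (szego z)) -> f = g.
Proof.
  intros H. assert (E : lsub f g = lzero).
  { apply eval_eq0. intros z Hz. rewrite ip_sub_l, H by exact Hz. ring. }
  replace f with (ladd g (lsub f g)) by l2ring. rewrite E. l2ring.
Qed.

(* [1 - conj (b(w)) b = (1 - |a|^2) (1 - conj w z) / ((1 - a conj w) (1 - conj a z))] *)
Lemma szego_mulb a w : in_disc a -> in_disc w ->
  szego w = ladd (lscal (Cconj (bfactor a w)) (mulb a (szego w)))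
              (lscal ((1 - a * Cconj a) / (1 - a * Cconj w)) (szego a)).
Proof.
  intros Ha Hw. apply eval_inj. intros z Hz.
  rewrite ip_add_l, !ip_scal_l, eval_mulb, !eval_szego, !bfactor_phase by assumption.
  pose proof (one_minus_ne0 a z Ha Hz). pose proof (one_minus_ne0 w z Hw Hz).
  pose proof (one_minus_ne0 a w Ha Hw) as H1.
  pose proof (one_minus_ne0 w a Hw Ha) as H2.
  rewrite Cmult_conj, Cdiv_conj, !Cminus_conj, Cmult_conj, Cconj_conj, Cconj_R by exact H1.
  replace (Cconj (phase a) * ((Cconj a - Cconj w) / (1 - a * Cconj w)) *
    (phase a * ((a - z) / (1 - Cconj a * z)) * / (1 - Cconj w * z)))%C with
    ((phase a * Cconj (phase a)) * ((Cconj a - Cconj w) / (1 - a * Cconj w)) *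
    ((a - z) / (1 - Cconj a * z)) * / (1 - Cconj w * z))%C.
  - rewrite phase_conj. field. rewrite (Cmult_comm a). auto.
  - field. rewrite (Cmult_comm a). auto.
Qed.

(** * Blaschke products *)

Fixpoint iterop (F : nat -> l2 -> l2) (N : nat) (f : l2) : l2 :=
  match N with O => f | S M => F M (iterop F M f) end.

Definition mulB (s : nat -> C) (N : nat) (f : l2) : l2 :=
  iterop (fun n => mulb (s n)) N f.

Definition discseq (s : nat -> C) : Prop := forall n, in_disc (s n).

Lemma mulB_add s N f g : discseq s -> mulB s N (ladd f g) = ladd (mulB s N f) (mulB s N g).
Proof.
  intros Hs. induction N as [|N IH]; simpl; [reflexivity|].
  unfold mulB in *. simpl. now rewrite IH, mulb_add.
Qed.

Lemma mulB_scal s N c f : discseq s -> mulB s N (lscal c f) = lscal c (mulB s N f).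
Proof.
  intros Hs. induction N as [|N IH]; simpl; [reflexivity|].
  unfold mulB in *. simpl. now rewrite IH, mulb_scal.
Qed.

Lemma mulB_lcomb s N c x K : discseq s ->
  mulB s N (lcomb c x K) = lcomb c (fun n => mulB s N (x n)) K.
Proof.
  intros Hs. unfold lcomb. induction K as [|K IH]; simpl.
  - rewrite <- (lscal_0_l lzero), mulB_scal by exact Hs. l2ring.
  - now rewrite mulB_add, mulB_scal, IH.
Qed.

Lemma mulB_ldiv s N w f : discseq s -> in_disc w ->
  mulB s N (ldiv w f) = ldiv w (mulB s N f).
Proof.
  intros Hs Hw. induction N as [|N IH]; simpl; [reflexivity|].
  unfold mulB in *. simpl. now rewrite IH, mulb_ldiv.
Qed.

Lemma mulB_mulb s N a f : discseq s -> in_disc a ->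
  mulB s N (mulb a f) = mulb a (mulB s N f).
Proof.
  intros Hs Ha. induction N as [|N IH]; simpl; [reflexivity|].
  unfold mulB in *. simpl. now rewrite IH, mulb_comm.
Qed.

Lemma ip_mulB s N f g : discseq s -> ip (mulB s N f) (mulB s N g) = ip f g.
Proof.
  intros Hs. induction N as [|N IH]; simpl; [reflexivity|].
  unfold mulB in *. simpl. now rewrite ip_mulb.
Qed.

Lemma nm_mulB s N f : discseq s -> nm (mulB s N f) = nm f.
Proof.
  intros Hs. induction N as [|N IH]; simpl; [reflexivity|].
  unfold mulB in *. simpl. now rewrite nm_mulb.
Qed.

Lemma mulB_split s n k f : discseq s ->
  mulB s (n + k) f = mulB s n (mulB (fun i => s (n + i)%nat) k f).
Proof.
  intros Hs. induction k as [|k IH]; [now rewrite Nat.add_0_r|].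
  rewrite Nat.add_succ_r.
  change (mulb (s (n + k)%nat) (mulB s (n + k) f) =
    mulB s n (mulb (s (n + k)%nat) (mulB (fun i => s (n + i)%nat) k f))).
  now rewrite IH, mulB_mulb.
Qed.

Lemma eval_mulB s N f z : discseq s -> in_disc z ->
  ip (mulB s N f) (szego z) = (Cprod (fun n => bfactor (s n) z) N * ip f (szego z))%C.
Proof.
  intros Hs Hz. unfold mulB. induction N as [|N IH]; simpl; [ring|].
  rewrite eval_mulb, IH by auto. ring.
Qed.

Lemma bfactor_at_0 a : bfactor a 0 = RtoC (Cmod a).
Proof.
  unfold bfactor. destruct (Req_EM_T (Cmod a) 0) as [H|H]; [now rewrite H|].
  assert (a <> 0%C) by (intros ->; now rewrite Cmod_0 in H). now field.
Qed.

Lemma Cprod_ext f g N : (forall n, (n < N)%nat -> f n = g n) -> Cprod f N = Cprod g N.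
Proof.
  induction N as [|N IH]; intros H; simpl; [reflexivity|].
  rewrite IH by (intros; apply H; lia). rewrite H by lia. reflexivity.
Qed.

Lemma Cprod_R u N : Cprod (fun n => RtoC (u n)) N = RtoC (Rprod u N).
Proof. induction N as [|N IH]; simpl; [reflexivity|]. now rewrite IH, RtoC_mult. Qed.

Lemma Cmod_Cprod f N : Cmod (Cprod f N) = Rprod (fun n => Cmod (f n)) N.
Proof. induction N as [|N IH]; simpl; [apply Cmod_1|]. now rewrite Cmod_mult, IH. Qed.

Lemma Rprod_ge (u : nat -> R) N :
  (forall n, 0 <= u n <= 1) -> 0 <= Rprod u N <= 1 /\ 1 - Rsum (fun n => 1 - u n) N <= Rprod u N.
Proof.
  intros H. induction N as [|N [IH1 IH2]]; simpl; [lra|]. specialize (H N). split; nra.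
Qed.

(** Isometry cancels the common factors: |B_n - B_(n+k)|^2 = 2 - 2 Re <1, T>, with T the product of
    the [k] factors in between. Now T(0) is the product of their |s_i|, so the difference is
    controlled by the tail of the sum of 1 - |s_i|. *)
Lemma conv_mulB s : discseq s -> ex_series (fun n => 1 - Cmod (s n)) ->
  exists b, conv (fun N => mulB s N lone) b.
Proof.
  intros Hs Hser. apply l2_complete.
  set (u := fun n => 1 - Cmod (s n)) in *.
  assert (Hu : forall n, 0 <= u n).
  { intros n. specialize (Hs n). unfold in_disc, u in *. lra. }
  assert (Hd : forall n k, nm (lsub (mulB s n lone) (mulB s (n + k) lone)) ^ 2 <=
                           2 * (Series u - Rsum u n)).
  { intros n k. rewrite nm_sub_sqr, !nm_mulB, nm_one, mulB_split, ip_mulB by exact Hs.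
    assert (Hs' : discseq (fun i => s (n + i)%nat)) by (intros i; apply Hs).
    replace (Re (ip lone (mulB (fun i => s (n + i)%nat) k lone)))
      with (Rprod (fun i => Cmod (s (n + i)%nat)) k).
    2:{ rewrite ip_conj, re_conj.
        (* Pairing with 1 is evaluation at the origin, where the normalisation of [bfactor] makes
           every factor equal to |s_i|. *)
        replace lone with (szego 0) at 2.
        - rewrite eval_mulB, eval_one by (assumption || apply in_disc_0).
          rewrite (Cprod_ext _ (fun i => RtoC (Cmod (s (n + i)%nat))))
            by (intros; apply bfactor_at_0).
          rewrite Cprod_R, Cmult_1_r. reflexivity.
        - rewrite (szego_rec 0 in_disc_0), Cconj_R. l2ring. }
    assert (Hp : Rsum (fun i => u (n + i)%nat) k <= Series u - Rsum u n).
    { assert (E : Rsum (fun i => u (n + i)%nat) k = Rsum u (n + k) - Rsum u n).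
      { clear. induction k as [|k IH]; simpl; [rewrite Nat.add_0_r; ring|].
        rewrite Nat.add_succ_r. simpl. rewrite IH. ring. }
      rewrite E. pose proof (Rsum_le_Series u (n + k) Hu Hser). lra. }
    destruct (Rprod_ge (fun i => Cmod (s (n + i)%nat)) k) as [_ H2].
    { intros i. split; [apply Cmod_ge_0|]. specialize (Hs (n + i)%nat).
      unfold in_disc in Hs. lra. }
    fold u in H2. change (fun n0 => 1 - Cmod (s (n + n0)%nat)) with (fun i => u (n + i)%nat) in H2.
    lra. }
  intros eps He.
  assert (Hl := is_lim_seq_Rsum u Hser). apply is_lim_seq_spec in Hl.
  assert (Hep : 0 < eps ^ 2 / 2) by nra.
  destruct (Hl (mkposreal _ Hep)) as [N HN]. simpl in HN.
  assert (Hle : forall n m, (N <= n)%nat -> (n <= m)%nat ->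
    nm (lsub (mulB s n lone) (mulB s m lone)) < eps).
  { intros n m Hn Hm. replace m with (n + (m - n))%nat by lia.
    specialize (Hd n (m - n)%nat). specialize (HN n Hn).
    apply Rabs_def2 in HN.
    apply Rnot_le_lt. intros Hc.
    pose proof (pow_incr _ _ 2 (conj (Rlt_le _ _ He) Hc)). lra. }
  exists N. intros n m Hn Hm. destruct (Nat.le_ge_cases n m).
  - now apply Hle.
  - rewrite nm_sub_comm. now apply Hle.
Qed.

Lemma CLim_unique (u : nat -> C) l : ccv u l -> CLim u = l.
Proof.
  intros H. unfold CLim.
  rewrite (is_lim_seq_unique _ (fst l)), (is_lim_seq_unique _ (snd l)).
  - now destruct l.
  - apply is_lim_seq_spec. intros [eps He]. destruct (H eps He) as [N HN].
    exists N. intros n Hn. eapply Rle_lt_trans; [apply (im_le_Cmod (u n - l))|]. now apply HN.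
  - apply is_lim_seq_spec. intros [eps He]. destruct (H eps He) as [N HN].
    exists N. intros n Hn. eapply Rle_lt_trans; [apply (re_le_Cmod (u n - l))|]. now apply HN.
Qed.

(** Evaluation is an inner product, so norm convergence gives pointwise convergence; the [CLim] in
    [blaschke] is therefore a genuine limit. *)
Lemma eval_blaschke s b z : discseq s -> conv (fun N => mulB s N lone) b -> in_disc z ->
  ip b (szego z) = blaschke s z.
Proof.
  intros Hs Hb Hz. symmetry. apply CLim_unique. intros eps He.
  destruct (conv_ip_l _ _ (szego z) Hb eps He) as [N HN]. exists N. intros n Hn.
  specialize (HN n Hn). rewrite eval_mulB, eval_one, Cmult_1_r in HN by assumption.
  exact HN.
Qed.

Lemma conv_add u v l m : conv u l -> conv v m -> conv (fun n => ladd (u n) (v n)) (ladd l m).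
Proof.
  intros Hu Hv eps He. destruct (Hu (eps / 2)) as [N1 H1]; [lra|].
  destruct (Hv (eps / 2)) as [N2 H2]; [lra|].
  exists (Nat.max N1 N2). intros n Hn.
  specialize (H1 n ltac:(lia)). specialize (H2 n ltac:(lia)).
  replace (lsub (ladd (u n) (v n)) (ladd l m)) with (ladd (lsub (u n) l) (lsub (v n) m)) by l2ring.
  eapply Rle_lt_trans; [apply nm_triangle|]. lra.
Qed.

Lemma conv_bounded (T : l2 -> l2) K u l : 0 <= K ->
  (forall f g, T (lsub f g) = lsub (T f) (T g)) -> (forall f, nm (T f) <= K * nm f) ->
  conv u l -> conv (fun n => T (u n)) (T l).
Proof.
  intros HK HT Hn Hu eps He.
  destruct (Hu (eps / (K + 1))) as [N HN]; [apply Rdiv_lt_0_compat; lra|].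
  exists N. intros n Hle. rewrite <- HT. eapply Rle_lt_trans; [apply Hn|].
  specialize (HN n Hle). pose proof (nm_ge0 (lsub (u n) l)).
  apply Rle_lt_trans with (nm (lsub (u n) l) * (K + 1)).
  - nra.
  - apply Rlt_div_r in HN; lra.
Qed.

Lemma conv_scal c u l : conv u l -> conv (fun n => lscal c (u n)) (lscal c l).
Proof.
  apply (conv_bounded (lscal c) (Cmod c)).
  - apply Cmod_ge_0.
  - intros. l2ring.
  - intros. rewrite nm_scal. lra.
Qed.

Lemma conv_ldiv w u l : in_disc w -> conv u l -> conv (fun n => ldiv w (u n)) (ldiv w l).
Proof.
  intros Hw. apply (conv_bounded (ldiv w) (/ (1 - Cmod w))).
  - left. apply Rinv_0_lt_compat. unfold in_disc in Hw. lra.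
  - intros. now apply ldiv_sub.
  - intros. now apply nm_ldiv.
Qed.

Lemma conv_lcomb c (u : nat -> nat -> l2) (l : nat -> l2) K :
  (forall j, conv (fun n => u n j) (l j)) ->
  conv (fun n => lcomb c (u n) K) (lcomb c l K).
Proof.
  intros H. unfold lcomb. induction K as [|K IH]; simpl.
  - intros eps He. exists 0%nat. intros n _.
    replace (lsub lzero lzero) with (lscal 0 lzero) by l2ring.
    rewrite nm_scal, Cmod_0. lra.
  - apply conv_add; [exact IH|]. now apply conv_scal.
Qed.

Lemma conv_nm u l c : conv u l -> (forall n, nm (u n) = c) -> nm l = c.
Proof.
  intros Hu Hc. apply Rle_antisym; apply Rnot_lt_le; intros Hlt.
  - destruct (Hu (nm l - c)) as [N HN]; [lra|]. specialize (HN N (le_n N)).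
    pose proof (nm_le_sub l (u N)). rewrite nm_sub_comm in H. rewrite Hc in H. lra.
  - destruct (Hu (c - nm l)) as [N HN]; [lra|]. specialize (HN N (le_n N)).
    pose proof (nm_le_sub (u N) l). rewrite Hc in H. lra.
Qed.

(* Multiplication by the full Blaschke product is isometric. *)
Lemma nm_lcomb_blaschke s b c w K :
  discseq s -> discseq w -> conv (fun N => mulB s N lone) b ->
  nm (lcomb c (fun j => ldiv (w j) b) K) = nm (lcomb c (fun j => szego (w j)) K).
Proof.
  intros Hs Hw Hb.
  apply (conv_nm (fun N => lcomb c (fun j => ldiv (w j) (mulB s N lone)) K)).
  - apply (conv_lcomb c (fun N j => ldiv (w j) (mulB s N lone))).
    intros j. now apply conv_ldiv.
  - intros N.
    replace (lcomb c (fun j => ldiv (w j) (mulB s N lone)) K)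
      with (mulB s N (lcomb c (fun j => szego (w j)) K)).
    + now apply nm_mulB.
    + rewrite mulB_lcomb by exact Hs. apply lcomb_ext. intros. unfold szego.
      now rewrite mulB_ldiv.
Qed.

Lemma Cminus_sqr_id (a z : C) :
  Cmod (1 - Cconj a * z) ^ 2 - Cmod (a - z) ^ 2 = (1 - Cmod a ^ 2) * (1 - Cmod z ^ 2).
Proof.
  rewrite !Cmod2_alt. destruct a, z. unfold Re, Im; simpl. ring.
Qed.

Lemma in_disc_sqr a : in_disc a -> 0 < 1 - Cmod a ^ 2 <= 1.
Proof. unfold in_disc. pose proof (Cmod_ge_0 a). nra. Qed.

Lemma pseudo_hyp_sqr a z : in_disc a -> in_disc z ->
  pseudo_hyp a z ^ 2 = 1 - (1 - Cmod a ^ 2) * (1 - Cmod z ^ 2) / Cmod (1 - Cconj a * z) ^ 2.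
Proof.
  intros Ha Hz. pose proof (one_minus_ne0 a z Ha Hz) as H.
  unfold pseudo_hyp. rewrite Cmod_div by exact H. rewrite <- Cminus_sqr_id.
  apply Cmod_gt_0 in H. field. lra.
Qed.

Lemma pseudo_hyp_range a z : in_disc a -> in_disc z -> 0 <= pseudo_hyp a z < 1.
Proof.
  intros Ha Hz. split; [apply Cmod_ge_0|].
  pose proof (pseudo_hyp_sqr a z Ha Hz) as H.
  pose proof (in_disc_sqr a Ha). pose proof (in_disc_sqr z Hz).
  pose proof (one_minus_ne0 a z Ha Hz) as H3. apply Cmod_gt_0 in H3.
  assert (0 < (1 - Cmod a ^ 2) * (1 - Cmod z ^ 2) / Cmod (1 - Cconj a * z) ^ 2).
  { apply Rdiv_lt_0_compat; [apply Rmult_lt_0_compat; lra|nra]. }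
  assert (0 <= pseudo_hyp a z) by apply Cmod_ge_0. nra.
Qed.

Lemma Cmod_bfactor a z : Cmod (bfactor a z) = pseudo_hyp a z.
Proof. rewrite bfactor_phase, Cmod_mult, Cmod_phase. unfold pseudo_hyp. ring. Qed.

Lemma bfactor_self a : in_disc a -> bfactor a a = 0%C.
Proof.
  intros Ha. rewrite bfactor_phase. field. now apply one_minus_ne0.
Qed.

Lemma bfactor_ne0 a z : in_disc a -> in_disc z -> a <> z -> bfactor a z <> 0%C.
Proof.
  intros Ha Hz Hn. apply Cmod_gt_0. rewrite Cmod_bfactor. unfold pseudo_hyp.
  pose proof (one_minus_ne0 a z Ha Hz). rewrite Cmod_div by assumption.
  apply Rdiv_lt_0_compat; apply Cmod_gt_0; [|assumption].
  now apply Cminus_eq_contra.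
Qed.

Lemma Cprod_ne0 (f : nat -> C) N : (forall n, (n < N)%nat -> f n <> 0%C) -> Cprod f N <> 0%C.
Proof.
  induction N as [|N IH]; intros H; simpl.
  - intros E. apply (f_equal fst) in E. simpl in E. lra.
  - apply Cmult_neq_0; [apply IH; intros; apply H; lia|apply H; lia].
Qed.

Lemma Cprod_eq0 (f : nat -> C) N j : (j < N)%nat -> f j = 0%C -> Cprod f N = 0%C.
Proof.
  intros Hj Hf. induction Hj; simpl; [rewrite Hf; ring|]. rewrite IHHj. ring.
Qed.

(** Strictness comes from one factor: every nonempty partial product is at most the first factor in
    modulus, and this bound survives the limit. *)
Lemma Cmod_blaschke_lt1 s b z : discseq s -> conv (fun N => mulB s N lone) b -> in_disc z ->
  Cmod (blaschke s z) < 1.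
Proof.
  intros Hs Hb Hz. rewrite <- (eval_blaschke s b z Hs Hb Hz).
  pose proof (pseudo_hyp_range (s 0%nat) z (Hs 0%nat) Hz) as Hp.
  apply Rle_lt_trans with (pseudo_hyp (s 0%nat) z); [|lra].
  apply Rnot_lt_le. intros Hlt.
  destruct (conv_ip_l _ _ (szego z) Hb (Cmod (ip b (szego z)) - pseudo_hyp (s 0%nat) z))
    as [N HN]; [lra|].
  specialize (HN (S N) (Nat.le_succ_diag_r N)).
  rewrite eval_mulB, eval_one, Cmult_1_r in HN by assumption.
  assert (HP : forall N, Cmod (Cprod (fun n => bfactor (s n) z) (S N)) <= pseudo_hyp (s 0%nat) z).
  { clear N HN. induction N as [|N IH].
    - simpl. rewrite Cmult_1_l, Cmod_bfactor. lra.
    - change (Cmod (Cprod (fun n => bfactor (s n) z) (S N) * bfactor (s (S N)) z) <=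
        pseudo_hyp (s 0%nat) z).
      rewrite Cmod_mult, Cmod_bfactor.
      pose proof (pseudo_hyp_range (s (S N)) z (Hs (S N)) Hz).
      pose proof (Cmod_ge_0 (Cprod (fun n => bfactor (s n) z) (S N))). nra. }
  specialize (HP N).
  set (P := Cprod (fun n => bfactor (s n) z) (S N)) in *.
  pose proof (Cmod_triangle P (ip b (szego z) - P)) as Ht.
  replace (P + (ip b (szego z) - P))%C with (ip b (szego z)) in Ht by ring.
  replace (ip b (szego z) - P)%C with (- (P - ip b (szego z)))%C in Ht by ring.
  rewrite Cmod_opp in Ht. lra.
Qed.

(** * Functions vanishing on the zeros, and the model space *)

Definition vanishes (s : nat -> C) (g : l2) : Prop := forall n, ip g (szego (s n)) = 0%C.

(* By induction on [N]: evaluating the formula for [N] at the next zero [w = s N]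
   shows that [g] is orthogonal to [B_N k_{s N}], the only term by which the formula
   for [N + 1] differs. *)
Lemma eval_vanishing_fin s : discseq s -> (forall i j, i <> j -> s i <> s j) ->
  forall N g, (forall n, (n < N)%nat -> ip g (szego (s n)) = 0%C) ->
  forall w, in_disc w ->
  ip g (szego w) = (Cprod (fun n => bfactor (s n) w) N * ip g (mulB s N (szego w)))%C.
Proof.
  intros Hs Hd. induction N as [|N IH]; intros g Hg w Hw.
  - simpl. unfold mulB; simpl. ring.
  - assert (Hg' : forall n, (n < N)%nat -> ip g (szego (s n)) = 0%C) by (intros; apply Hg; lia).
    assert (Horth : ip g (mulB s N (szego (s N))) = 0%C).
    { pose proof (IH g Hg' (s N) (Hs N)) as E. rewrite Hg in E by lia.
      assert (Hne : Cprod (fun n => bfactor (s n) (s N)) N <> 0%C).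
      { apply Cprod_ne0. intros n Hn. apply bfactor_ne0; auto. apply Hd. lia. }
      apply NNPP. intros Hx. apply (Cmult_neq_0 _ _ Hne Hx). now symmetry. }
    rewrite (IH g Hg' w Hw).
    rewrite (szego_mulb (s N) w (Hs N) Hw) at 1.
    rewrite mulB_add, !mulB_scal, mulB_mulb, ip_add_r, !ip_scal_r, Horth, Cconj_conj by auto.
    simpl. unfold mulB; simpl. ring.
Qed.

(** The left side of the finite formula does not depend on [N], while both factors on the right
    converge. The last factor <g, B k_w> is the value at [w] of g / B, so this stands in for the
    factorisation g = B h. *)
Lemma eval_vanishing s b g w :
  discseq s -> (forall i j, i <> j -> s i <> s j) -> conv (fun N => mulB s N lone) b ->
  vanishes s g -> in_disc w ->
  ip g (szego w) = (blaschke s w * ip g (ldiv w b))%C.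
Proof.
  intros Hs Hd Hb Hg Hw. rewrite <- (eval_blaschke s b w Hs Hb Hw).
  assert (Hc := conv_ldiv w _ _ Hw Hb).
  assert (E : forall N, ip g (szego w) =
    (ip (mulB s N lone) (szego w) * ip g (ldiv w (mulB s N lone)))%C).
  { intros N. rewrite eval_mulB, eval_one, Cmult_1_r, <- mulB_ldiv by assumption.
    apply eval_vanishing_fin; auto. }
  apply (ccv_const _ _ _ (ccv_mult _ _ _ _ (conv_ip_l _ _ (szego w) Hb) (conv_ip_r _ _ g Hc))).
  intros N. symmetry. apply E.
Qed.

Lemma blaschke_zero s n : discseq s -> blaschke s (s n) = 0%C.
Proof.
  intros Hs. apply CLim_unique. intros eps He. exists (S n). intros N HN.
  rewrite (Cprod_eq0 _ N n); [|lia|now apply bfactor_self].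
  replace (0 - 0)%C with (RtoC 0) by ring. now rewrite Cmod_0.
Qed.

Lemma vanishes_ldiv s b w : discseq s -> conv (fun N => mulB s N lone) b -> in_disc w ->
  vanishes s (ldiv w b).
Proof.
  intros Hs Hb Hw n. rewrite eval_ldiv, (eval_blaschke s b), blaschke_zero by auto.
  field. now apply one_minus_ne0.
Qed.

(** Here [ldiv w b] is B k_w, so this is the coefficient vector of the model space kernel at [w]. *)
Definition kervec (s : nat -> C) (b : l2) (w : C) : l2 :=
  lsub (szego w) (lscal (Cconj (blaschke s w)) (ldiv w b)).

Lemma eval_kervec s b w z : discseq s -> conv (fun N => mulB s N lone) b ->
  in_disc w -> in_disc z -> ip (kervec s b w) (szego z) = kernel (blaschke s) w z.
Proof.
  intros Hs Hb Hw Hz. unfold kervec, kernel.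
  rewrite ip_sub_l, ip_scal_l, eval_ldiv, eval_szego, (eval_blaschke s b) by assumption.
  field. now apply one_minus_ne0.
Qed.

Lemma ip_kervec_vanishing s b g w :
  discseq s -> (forall i j, i <> j -> s i <> s j) -> conv (fun N => mulB s N lone) b ->
  vanishes s g -> in_disc w -> ip g (kervec s b w) = 0%C.
Proof.
  intros Hs Hd Hb Hg Hw. unfold kervec.
  rewrite ip_sub_r, ip_scal_r, Cconj_conj, (eval_vanishing s b g w) by assumption. ring.
Qed.

(** The component along B k_w is orthogonal to the kernel, so the squared norm is the value of the
    kernel at its own point. *)
Lemma nm_kervec s b w :
  discseq s -> (forall i j, i <> j -> s i <> s j) -> conv (fun N => mulB s N lone) b ->
  in_disc w -> nm (kervec s b w) ^ 2 = (1 - Cmod (blaschke s w) ^ 2) / (1 - Cmod w ^ 2).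
Proof.
  intros Hs Hd Hb Hw.
  assert (E : ip (kervec s b w) (kervec s b w) = ip (kervec s b w) (szego w)).
  { unfold kervec at 2. rewrite ip_sub_r, ip_scal_r.
    rewrite (ip_eq0_sym (ldiv w b) (kervec s b w)); [ring|].
    apply ip_kervec_vanishing; auto. now apply vanishes_ldiv. }
  rewrite nm_sqr_ip, E, eval_kervec by assumption. unfold kernel.
  pose proof (in_disc_sqr w Hw).
  replace ((1 - Cconj (blaschke s w) * blaschke s w) / (1 - Cconj w * w))%C
    with (RtoC ((1 - Cmod (blaschke s w) ^ 2) / (1 - Cmod w ^ 2))); [reflexivity|].
  rewrite RtoC_div, !RtoC_minus, !Cmod2_conj by lra.
  rewrite (Cmult_comm (Cconj w)), (Cmult_comm (Cconj (blaschke s w))). reflexivity.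
Qed.

Lemma mult_space_vanishes s (f : l2) : discseq s ->
  mult_space (blaschke s) f -> vanishes s f.
Proof.
  intros Hs [_ [g [_ Hg]]] n. rewrite <- h2_eval_ip by apply Hs.
  rewrite Hg, blaschke_zero by apply Hs. ring.
Qed.

Lemma mult_space_ldiv s b w : discseq s -> conv (fun N => mulB s N lone) b -> in_disc w ->
  mult_space (blaschke s) (ldiv w b).
Proof.
  intros Hs Hb Hw. split; [apply valP|]. exists (szego w). split; [apply valP|].
  intros z Hz. rewrite !h2_eval_ip, eval_ldiv, eval_szego, (eval_blaschke s b) by assumption.
  reflexivity.
Qed.

(** Functions vanishing on the zeros include [mult_space], and testing against them requires no
    quotient by B. *)
Lemma orth_vanishing_model s (f : l2) : discseq s ->
  (forall g, vanishes s g -> ip g f = 0%C) -> model_space (blaschke s) f.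
Proof.
  intros Hs H. split; [apply valP|]. intros h Hh.
  change h with (val (L2 h (proj1 Hh))). apply (ip_eq0_sym (L2 h (proj1 Hh)) f).
  apply H. now apply mult_space_vanishes.
Qed.

(* The residual of [f] vanishes on the zeros and is orthogonal to every [B k_w],
   so [eval_vanishing] kills all its values. *)
Lemma model_approx s b (f : l2) :
  discseq s -> (forall i j, i <> j -> s i <> s j) -> conv (fun N => mulB s N lone) b ->
  model_space (blaschke s) f -> approx (fun n => szego (s n)) f.
Proof.
  intros Hs Hd Hb [_ Hf].
  destruct (projection (fun n => szego (s n)) f) as [r [Hr Ha]].
  assert (E : r = lzero).
  { apply eval_eq0. intros w Hw.
    rewrite (eval_vanishing s b r w) by assumption.
    assert (H1 : ip f (ldiv w b) = 0%C) by (apply Hf; now apply mult_space_ldiv).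
    assert (H2 : ip (lsub f r) (ldiv w b) = 0%C).
    { apply (approx_ip_eq0 _ _ _ Ha). intros n. apply ip_eq0_sym.
      now apply vanishes_ldiv. }
    rewrite ip_sub_l, H1 in H2.
    replace (ip r (ldiv w b)) with (- (0 - ip r (ldiv w b)))%C by ring.
    rewrite H2. ring. }
  rewrite E in Ha. replace f with (lsub f lzero) by l2ring. exact Ha.
Qed.

(** * Carleson sequences *)

(* The averaging operator [T] dominates its own square, [T(b)^2 <= 4 T(b T(b))], because
   [d] satisfies the triangle inequality; the row sums then bound [T] on the weighted [l2]. *)
Lemma carleson_form (h b : nat -> R) (d : nat -> nat -> R) (K : R) (N : nat) :
  (forall j, 0 <= h j) -> (forall j, 0 <= b j) ->
  (forall i j, 0 < d i j) -> (forall i j, d i j = d j i) ->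
  (forall i j k, d i j <= d i k + d k j) ->
  0 <= K -> (forall j, Rsum (fun k => h j * h k / d j k ^ 2) N <= K) ->
  Rsum (fun k => h k * b k * Rsum (fun j => h j ^ 2 * b j / d j k ^ 2) N) N <=
  4 * K * Rsum (fun k => h k * b k ^ 2) N.
Proof.
  intros Hh Hb Hd Hsym Htri HK Hrow.
  set (T := fun k => Rsum (fun j => h j ^ 2 * b j / d j k ^ 2) N).
  set (w := fun i => h i ^ 2 * b i).
  assert (Hw : forall i, 0 <= w i) by (intros; apply Rmult_le_pos; [apply pow2_ge_0|apply Hb]).
  assert (Hd2 : forall i j, 0 < d i j ^ 2) by (intros; apply pow_lt, Hd).
  assert (HT0 : forall k, 0 <= T k).
  { intros k. apply Rsum_nonneg. intros j _. apply Rdiv_le_0_compat; [apply Hw|apply Hd2]. }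
  assert (HTT : forall k, T k ^ 2 <= 4 * Rsum (fun j => w j / d j k ^ 2 * T j) N).
  { intros k. unfold T at 1. rewrite Rsum_sqr.
    apply Rle_trans with (Rsum (fun i => Rsum (fun j =>
      2 * (w j / d j k ^ 2 * (w i / d i j ^ 2)) + 2 * (w i / d i k ^ 2 * (w j / d j i ^ 2))) N) N).
    - apply Rsum_le; intros i _. apply Rsum_le; intros j _. fold (w i) (w j).
      rewrite (Hsym j i).
      pose proof (Hd2 i k) as HA. pose proof (Hd2 j k) as HB. pose proof (Hd2 i j) as HD.
      (* With A, B, D as named below, D <= 2 (A + B) says 1/(A B) <= 2/(B D) + 2/(A D): a product of
         two kernels through [k] is split into two products through the pair [i], [j]. *)
      assert (HDAB : d i j ^ 2 <= 2 * (d i k ^ 2 + d j k ^ 2)).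
      { pose proof (Htri i j k) as Ht. rewrite (Hsym k j) in Ht. pose proof (Hd i j).
        pose proof (pow2_ge_0 (d i k - d j k)). nra. }
      set (A := d i k ^ 2) in *. set (B := d j k ^ 2) in *. set (D := d i j ^ 2) in *.
      replace (w i / A * (w j / B)) with (w i * w j / (A * B * D) * D) by (field; lra).
      replace (2 * (w j / B * (w i / D)) + 2 * (w i / A * (w j / D)))
        with (w i * w j / (A * B * D) * (2 * (A + B))) by (field; lra).
      apply Rmult_le_compat_l; [|exact HDAB].
      apply Rdiv_le_0_compat; [now apply Rmult_le_pos|].
      apply Rmult_lt_0_compat; [apply Rmult_lt_0_compat|]; assumption.
    - right.
      rewrite (Rsum_ext _ (fun i => 2 * Rsum (fun j => w j / d j k ^ 2 * (w i / d i j ^ 2)) N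
                           + 2 * (w i / d i k ^ 2 * T i))).
      + rewrite Rsum_plus, !Rsum_scal, Rsum_swap.
        rewrite (Rsum_ext (fun j => Rsum _ N) (fun j => w j / d j k ^ 2 * T j)).
        * ring.
        * intros j _. rewrite Rsum_scal. reflexivity.
      + intros i _. rewrite Rsum_plus, !Rsum_scal. reflexivity. }
  set (X := Rsum (fun k => h k * b k * T k) N).
  set (Y := Rsum (fun k => h k * b k ^ 2) N).
  set (W := Rsum (fun k => h k * T k ^ 2) N).
  assert (HX0 : 0 <= X).
  { apply Rsum_nonneg. intros k _. apply Rmult_le_pos; [now apply Rmult_le_pos|apply HT0]. }
  assert (HY0 : 0 <= Y).
  { apply Rsum_nonneg. intros k _. apply Rmult_le_pos; [apply Hh|apply pow2_ge_0]. }
  assert (HW : W <= 4 * K * X).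
  { apply Rle_trans with (Rsum (fun k => Rsum (fun j => 4 * (h j * b j * T j * (h j * h k / d j k ^ 2))) N) N).
    - apply Rsum_le; intros k _.
      eapply Rle_trans; [apply Rmult_le_compat_l; [apply Hh|apply HTT]|]. right.
      rewrite <- Rmult_assoc, <- Rsum_scal. apply Rsum_ext; intros j _. unfold w.
      pose proof (Hd2 j k). field. specialize (Hd j k). lra.
    - rewrite Rsum_swap. unfold X. rewrite <- Rsum_scal. apply Rsum_le; intros j _.
      rewrite !Rsum_scal.
      assert (0 <= h j * b j * T j) by (apply Rmult_le_pos; [now apply Rmult_le_pos|apply HT0]).
      pose proof (Rmult_le_compat_l _ _ _ H (Hrow j)). lra. }
  (* Cauchy-Schwarz with weight [h]. With W <= 4 K X it gives X^2 <= 4 K X Y, and one factor X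
     cancels. *)
  assert (HXW : X ^ 2 <= Y * W).
  { pose proof (Rsum_cauchy_schwarz (fun k => sqrt (h k) * b k) (fun k => sqrt (h k) * T k) N) as H.
    rewrite (Rsum_ext (fun n => sqrt (h n) * b n * (sqrt (h n) * T n)) (fun k => h k * b k * T k)) in H.
    2:{ intros k _. rewrite <- (sqrt_sqrt (h k)) at 3 by apply Hh. ring. }
    rewrite (Rsum_ext (fun n => (sqrt (h n) * b n) ^ 2) (fun k => h k * b k ^ 2)) in H.
    2:{ intros k _. rewrite <- (sqrt_sqrt (h k)) at 2 by apply Hh. ring. }
    rewrite (Rsum_ext (fun n => (sqrt (h n) * T n) ^ 2) (fun k => h k * T k ^ 2)) in H.
    2:{ intros k _. rewrite <- (sqrt_sqrt (h k)) at 2 by apply Hh. ring. }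
    exact H. }
  change (X <= 4 * K * Y).
  destruct (Req_dec X 0) as [HX|HX].
  { rewrite HX. apply Rmult_le_pos; lra. }
  apply Rmult_le_reg_l with X; [lra|].
  assert (Y * W <= Y * (4 * K * X)) by now apply Rmult_le_compat_l.
  lra.
Qed.

Definition hgap (s : nat -> C) (n : nat) : R := 1 - Cmod (s n) ^ 2.
(** Not a metric, since its diagonal value is [hgap s j], but symmetric, positive and subject to the
    triangle inequality, as [carleson_form] requires. *)
Definition hdist (s : nat -> C) (j k : nat) : R := Cmod (1 - Cconj (s j) * s k).

Lemma hgap_pos s n : discseq s -> 0 < hgap s n <= 1.
Proof. intros Hs. now apply in_disc_sqr. Qed.

Lemma hdist_pos s j k : discseq s -> 0 < hdist s j k.
Proof. intros Hs. apply Cmod_gt_0. now apply one_minus_ne0. Qed.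

Lemma hdist_sym s j k : hdist s j k = hdist s k j.
Proof.
  unfold hdist. rewrite <- Cmod_conj, Cminus_conj, Cmult_conj, Cconj_conj, Cconj_R.
  f_equal. ring.
Qed.

(** Split off conj s_i (s_k - s_j); by [Cminus_sqr_id] the Euclidean distance |s_k - s_j| is at most
    |1 - conj s_k s_j|. *)
Lemma hdist_triangle s i j k : discseq s -> hdist s i j <= hdist s i k + hdist s k j.
Proof.
  intros Hs. unfold hdist at 1.
  replace (1 - Cconj (s i) * s j)%C with
    ((1 - Cconj (s i) * s k) + Cconj (s i) * (s k - s j))%C by ring.
  eapply Rle_trans; [apply Cmod_triangle|]. fold (hdist s i k). apply Rplus_le_compat_l.
  rewrite Cmod_mult, Cmod_conj.
  pose proof (Cminus_sqr_id (s k) (s j)) as H. fold (hdist s k j) in H.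
  pose proof (in_disc_sqr _ (Hs k)). pose proof (in_disc_sqr _ (Hs j)).
  pose proof (hdist_pos s k j Hs). pose proof (Cmod_ge_0 (s k - s j)).
  assert (Cmod (s k - s j) <= hdist s k j).
  { apply Rle_sqr; [lra|].
    assert (0 <= (1 - Cmod (s k) ^ 2) * (1 - Cmod (s j) ^ 2)) by (apply Rmult_le_pos; lra). lra. }
  pose proof (Hs i) as Hi. unfold in_disc in Hi. pose proof (Cmod_ge_0 (s i)). nra.
Qed.

Lemma Rprod_nonneg (u : nat -> R) N : (forall n, 0 <= u n) -> 0 <= Rprod u N.
Proof.
  intros H. induction N as [|N IH]; simpl; [lra|]. now apply Rmult_le_pos.
Qed.

(** A substitute for logarithms: 1/x >= 1 + (1 - x) for x in (0, 1], and a product of terms 1 + t_i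
    with t_i >= 0 dominates 1 plus their sum. A lower bound on a product thus becomes an upper bound
    on a sum. *)
Lemma Rprod_sqr_sum (u : nat -> R) N : (forall n, 0 <= u n <= 1) ->
  Rprod u N ^ 2 * (1 + Rsum (fun n => 1 - u n ^ 2) N) <= 1.
Proof.
  intros H. induction N as [|N IH]; [simpl; lra|]. cbn [Rprod Rsum].
  set (P := Rprod u N ^ 2) in *. set (S0 := Rsum (fun n => 1 - u n ^ 2) N) in *.
  assert (HP : 0 <= P) by apply pow2_ge_0.
  assert (HS : 0 <= S0).
  { apply Rsum_nonneg. intros n _. specialize (H n). nra. }
  specialize (H N). rewrite Rpow_mult_distr. fold P.
  set (x := u N ^ 2) in *. assert (Hx : 0 <= x <= 1) by (unfold x; nra).
  assert (P * x * (1 + (S0 + (1 - x))) <= P * (1 + S0)).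
  { rewrite Rmult_assoc. apply Rmult_le_compat_l; [exact HP|].
    assert (0 <= S0 * (1 - x)) by (apply Rmult_le_pos; lra).
    pose proof (pow2_ge_0 (1 - x)). nra. }
  lra.
Qed.

Definition cprod (s : nat -> C) (n N : nat) : R :=
  Rprod (fun m => if Nat.eqb m n then 1 else pseudo_hyp (s m) (s n)) N.

Lemma cfactor_range s n m : discseq s ->
  0 <= (if Nat.eqb m n then 1 else pseudo_hyp (s m) (s n)) <= 1.
Proof.
  intros Hs. destruct (Nat.eqb m n); [lra|].
  pose proof (pseudo_hyp_range _ _ (Hs m) (Hs n)). lra.
Qed.

(** All factors are at most 1, so partial products decrease and each dominates the limit. *)
Lemma carleson_cprod s : carleson s ->
  discseq s /\ exists delta, 0 < delta /\ forall n N, delta <= cprod s n N.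
Proof.
  intros [Hs [delta [Hd H]]]. split; [exact Hs|]. exists delta. split; [exact Hd|].
  intros n N. specialize (H n).
  change (Rbar_le delta (cprod s n N)).
  eapply Rbar_le_trans; [exact H|]. rewrite <- Lim_seq_const. apply Lim_seq_le_loc.
  exists N. intros M HM. change (cprod s n M <= cprod s n N).
  induction HM as [|M HM IH]; [lra|]. eapply Rle_trans; [|exact IH].
  unfold cprod; cbn [Rprod].
  pose proof (cfactor_range s n M Hs).
  assert (0 <= cprod s n M) by (apply Rprod_nonneg; intros; now apply cfactor_range).
  unfold cprod in *. nra.
Qed.

Lemma carleson_distinct s : carleson s -> forall i j, i <> j -> s i <> s j.
Proof.
  intros Hc i j Hij E. destruct (carleson_cprod s Hc) as [Hs [delta [Hd H]]].
  specialize (H j (S i)). unfold cprod in H. cbn [Rprod] in H.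
  replace (Nat.eqb i j) with false in H by (symmetry; now apply Nat.eqb_neq).
  rewrite E, <- Cmod_bfactor, bfactor_self, Cmod_0 in H by apply Hs. lra.
Qed.

(** Off the diagonal the term is 1 minus the squared pseudo-hyperbolic distance, and on it the term
    is 1. [Rprod_sqr_sum] bounds the total by 1 / delta^2. *)
Lemma carleson_row s : carleson s -> exists K, 0 < K /\
  forall j N, Rsum (fun k => hgap s j * hgap s k / hdist s j k ^ 2) N <= K.
Proof.
  intros Hc. destruct (carleson_cprod s Hc) as [Hs [delta [Hd H]]].
  exists (/ delta ^ 2). split; [apply Rinv_0_lt_compat, pow_lt, Hd|]. intros j N.
  set (u := fun m => if Nat.eqb m j then 1 else pseudo_hyp (s m) (s j)).
  assert (Hu : forall m, 0 <= u m <= 1) by (intros; now apply cfactor_range).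
  pose proof (Rprod_sqr_sum u N Hu) as HP.
  pose proof (H j N) as HdN. change (cprod s j N) with (Rprod u N) in HdN.
  set (S0 := Rsum (fun n => 1 - u n ^ 2) N) in *.
  assert (HS0 : 0 <= S0) by (apply Rsum_nonneg; intros n _; specialize (Hu n); nra).
  apply Rle_trans with (1 + S0).
  - apply Rle_trans with (Rsum (fun k => (if Nat.eqb k j then 1 else 0) + (1 - u k ^ 2)) N).
    + apply Rsum_le; intros k _. unfold u.
      destruct (Nat.eqb_spec k j) as [->|Hkj].
      * right. unfold hgap, hdist.
        replace (1 - Cconj (s j) * s j)%C with (RtoC (1 - Cmod (s j) ^ 2)).
        -- rewrite Cmod_R. pose proof (in_disc_sqr _ (Hs j)).
           rewrite Rabs_pos_eq by lra. field. lra.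
        -- rewrite RtoC_minus, Cmod2_conj, Cmult_comm. reflexivity.
      * right. rewrite pseudo_hyp_sqr by apply Hs. rewrite hdist_sym. unfold hgap, hdist.
        pose proof (hdist_pos s k j Hs). unfold hdist in *. field. lra.
    + rewrite Rsum_plus. fold S0. apply Rplus_le_compat_r.
      assert (Hi : forall M, Rsum (fun k => if Nat.eqb k j then 1 else 0) M
                   = if (j <? M)%nat then 1 else 0).
      { induction M as [|M IH]; cbn [Rsum].
        - destruct (Nat.ltb_spec j 0); [lia|reflexivity].
        - rewrite IH. destruct (Nat.ltb_spec j M), (Nat.ltb_spec j (S M)), (Nat.eqb_spec M j);
            try lia; ring. }
      rewrite Hi. destruct (j <? N)%nat; lra.
  - apply Rmult_le_reg_l with (delta ^ 2); [now apply pow_lt|].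
    rewrite Rinv_r by (apply pow_nonzero; lra).
    eapply Rle_trans; [|exact HP]. apply Rmult_le_compat_r; [lra|].
    apply pow_incr. lra.
Qed.

(** Read off from row 0 of [carleson_row], whose denominators are at most 2^2. *)
Lemma carleson_sum s : carleson s -> exists H, 0 < H /\ forall N, Rsum (hgap s) N <= H.
Proof.
  intros Hc. pose proof (proj1 Hc : discseq s) as Hs.
  destruct (carleson_row s Hc) as [K [HK Hrow]].
  pose proof (hgap_pos s 0 Hs) as H0.
  exists (4 * K / hgap s 0). split; [apply Rdiv_lt_0_compat; lra|]. intros N.
  apply Rmult_le_reg_l with (hgap s 0 / 4); [lra|].
  replace (hgap s 0 / 4 * (4 * K / hgap s 0)) with K by (field; lra).
  rewrite <- Rsum_scal. eapply Rle_trans; [|apply (Hrow 0%nat N)].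
  apply Rsum_le; intros k _.
  pose proof (hgap_pos s k Hs). pose proof (hdist_pos s 0 k Hs) as Hd.
  assert (Hd2 : hdist s 0 k ^ 2 <= 4).
  { assert (hdist s 0 k <= 2); [|nra]. unfold hdist.
    replace (1 - Cconj (s 0%nat) * s k)%C with (1 + - (Cconj (s 0%nat) * s k))%C by ring.
    eapply Rle_trans; [apply Cmod_triangle|].
    rewrite Cmod_opp, Cmod_mult, Cmod_conj, Cmod_1.
    pose proof (Hs 0%nat) as Ha. pose proof (Hs k) as Hb. unfold in_disc in Ha, Hb.
    pose proof (Cmod_ge_0 (s 0%nat)). pose proof (Cmod_ge_0 (s k)). nra. }
  replace (hgap s 0 / 4 * hgap s k) with (hgap s 0 * hgap s k * / 4) by field.
  unfold Rdiv. apply Rmult_le_compat_l; [apply Rmult_le_pos; lra|].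
  apply Rinv_le_contravar; [apply pow_lt, Hd|exact Hd2].
Qed.

Lemma carleson_blaschke s : carleson s -> ex_series (fun n => 1 - Cmod (s n)).
Proof.
  intros Hc. pose proof (proj1 Hc : discseq s) as Hs.
  destruct (carleson_sum s Hc) as [H [_ HN]].
  apply (Series_bounded _ H).
  - intros n. specialize (Hs n). unfold in_disc in Hs. lra.
  - intros N. eapply Rle_trans; [|apply (HN N)]. apply Rsum_le; intros n _.
    pose proof (Hs n) as Hn. unfold in_disc in Hn. pose proof (Cmod_ge_0 (s n)).
    unfold hgap. nra.
Qed.

(* The normalised Szego kernels. *)
Definition nszego (s : nat -> C) (n : nat) : l2 := lscal (sqrt (hgap s n)) (szego (s n)).

Lemma ip_nszego s j k : discseq s ->
  ip (nszego s j) (nszego s k) = (RtoC (sqrt (hgap s j) * sqrt (hgap s k)) / (1 - Cconj (s j) * s k))%C.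
Proof.
  intros Hs. unfold nszego. rewrite ip_scal_l, ip_scal_r, eval_szego, Cconj_R, RtoC_mult by auto.
  field. now apply one_minus_ne0.
Qed.

Lemma nm_nszego s n : discseq s -> nm (nszego s n) = 1.
Proof.
  intros Hs. pose proof (hgap_pos s n Hs).
  assert (E : nm (nszego s n) ^ 2 = 1).
  { rewrite nm_sqr_ip, ip_nszego, sqrt_sqrt by (lra || exact Hs).
    replace (1 - Cconj (s n) * s n)%C with (RtoC (hgap s n)).
    - rewrite <- RtoC_div, re_RtoC by lra. field. lra.
    - unfold hgap. rewrite RtoC_minus, Cmod2_conj, Cmult_comm. reflexivity. }
  pose proof (nm_ge0 (nszego s n)). nra.
Qed.

(** With w = conj s_j s_k, 2 Re (1 / (1 - w)) = 1 + (1 - |w|^2) / |1 - w|^2, and 1 - |w|^2 is at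
    most the sum of the two gaps. Positivity allows real coefficients to be replaced by their
    absolute values in the Gram form. *)
Lemma Re_inv_bound s j k : discseq s ->
  0 <= Re (/ (1 - Cconj (s j) * s k))%C <=
  / 2 * (1 + (hgap s j + hgap s k) / hdist s j k ^ 2).
Proof.
  intros Hs. pose proof (hdist_pos s j k Hs) as Hd. assert (Hd2 : 0 < hdist s j k ^ 2) by now apply pow_lt.
  pose proof (hgap_pos s j Hs) as Hj. pose proof (hgap_pos s k Hs) as Hk.
  set (w := (Cconj (s j) * s k)%C).
  assert (Hw : Cmod w ^ 2 = (1 - hgap s j) * (1 - hgap s k)).
  { unfold w, hgap. rewrite Cmod_mult, Cmod_conj. ring. }
  assert (E : Re (/ (1 - w))%C = (hdist s j k ^ 2 + 1 - Cmod w ^ 2) / (2 * hdist s j k ^ 2)).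
  { unfold hdist in *. fold w in Hd, Hd2 |- *. rewrite Cmod2_alt in Hd2 |- *.
    rewrite Cmod2_alt. destruct w as [x y]. unfold Re, Im, Cinv in *; simpl in *.
    field. lra. }
  rewrite E, Hw. split.
  - apply Rdiv_le_0_compat; [|lra].
    assert (0 <= hgap s j * (1 - hgap s k)) by (apply Rmult_le_pos; lra). nra.
  - replace (/ 2 * (1 + (hgap s j + hgap s k) / hdist s j k ^ 2)) with
      ((hdist s j k ^ 2 + (hgap s j + hgap s k)) / (2 * hdist s j k ^ 2)) by (field; lra).
    apply Rmult_le_compat_r; [left; apply Rinv_0_lt_compat; lra|].
    assert (0 <= hgap s j * hgap s k) by (apply Rmult_le_pos; lra). lra.
Qed.

Lemma nm_lcomb_R (a : nat -> R) (x : nat -> l2) N :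
  nm (lcomb (fun n => RtoC (a n)) x N) ^ 2 =
  Rsum (fun j => Rsum (fun k => a j * a k * Re (ip (x j) (x k))) N) N.
Proof.
  rewrite nm_sqr_ip, ip_lcomb_l.
  change (Re (Csum ?f N)) with (fst (Csum f N)). rewrite fst_Csum.
  apply Rsum_ext; intros j _. rewrite ip_lcomb_r.
  change (fst (?c * ?z)%C) with (Re (c * z)%C). rewrite re_scal_l.
  change (Re (Csum ?f N)) with (fst (Csum f N)). rewrite fst_Csum, <- Rsum_scal.
  apply Rsum_ext; intros k _. rewrite Cconj_R.
  change (fst (?c * ?z)%C) with (Re (c * z)%C). rewrite re_scal_l. ring.
Qed.

Lemma bessel_real s : carleson s -> exists K, 0 < K /\ forall N (a : nat -> R),
  nm (lcomb (fun n => RtoC (a n)) (nszego s) N) ^ 2 <= K * Rsum (fun n => a n ^ 2) N.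
Proof.
  intros Hc. pose proof (proj1 Hc : discseq s) as Hs.
  destruct (carleson_row s Hc) as [K [HK Hrow]].
  destruct (carleson_sum s Hc) as [H [HH Hsum]].
  (* The constant 1 in [Re_inv_bound] contributes H/2 by Cauchy-Schwarz; the two gap terms are equal
     by symmetry, and [carleson_form] bounds them together by 4 K. *)
  exists (/ 2 * H + 4 * K). split; [lra|]. intros N a.
  set (sg := fun n => sqrt (hgap s n)).
  assert (Hsg : forall n, 0 < sg n) by (intros; apply sqrt_lt_R0; now apply hgap_pos).
  assert (Hsg2 : forall n, hgap s n = sg n * sg n).
  { intros n. unfold sg. rewrite sqrt_sqrt; [reflexivity|]. pose proof (hgap_pos s n Hs). lra. }
  (* This substitution turns the plain sum of squares of [a] into the sum of squares of [b] weighted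
     by [hgap]. *)
  set (b := fun n => Rabs (a n) / sg n).
  assert (Hb : forall n, 0 <= b n).
  { intros n. apply Rdiv_le_0_compat; [apply Rabs_pos|apply Hsg]. }
  assert (Hb2 : forall n, hgap s n * b n ^ 2 = a n ^ 2).
  { intros n. rewrite Hsg2. unfold b. rewrite <- (pow2_abs (a n)). field. specialize (Hsg n). lra. }
  assert (Hb1 : forall n, Rabs (a n) * sg n = hgap s n * b n).
  { intros n. rewrite Hsg2. unfold b. field. specialize (Hsg n). lra. }
  pose proof (carleson_form (hgap s) b (hdist s) K N) as HF.
  assert (HF' := HF (fun j => Rlt_le _ _ (proj1 (hgap_pos s j Hs))) Hb
    (fun i j => hdist_pos s i j Hs) (hdist_sym s) (fun i j k => hdist_triangle s i j k Hs)
    (Rlt_le _ _ HK) (fun j => Hrow j N)). clear HF.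
  rewrite (Rsum_ext (fun k => hgap s k * b k ^ 2) (fun k => a k ^ 2)) in HF' by (intros; apply Hb2).
  set (A := Rsum (fun n => a n ^ 2) N) in *.
  assert (HCS : Rsum (fun n => Rabs (a n) * sg n) N ^ 2 <= A * H).
  { eapply Rle_trans; [apply Rsum_cauchy_schwarz|].
    rewrite (Rsum_ext (fun n => Rabs (a n) ^ 2) (fun k => a k ^ 2)) by (intros; apply pow2_abs).
    fold A. apply Rmult_le_compat_l.
    - apply Rsum_nonneg; intros; apply pow2_ge_0.
    - rewrite (Rsum_ext _ (hgap s)); [apply Hsum|]. intros n _. rewrite Hsg2. ring. }
  rewrite nm_lcomb_R.
  apply Rle_trans with (Rsum (fun j => Rsum (fun k =>
     / 2 * (Rabs (a j) * sg j * (Rabs (a k) * sg k)) +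
     / 2 * (hgap s j * b j * (hgap s k ^ 2 * b k / hdist s k j ^ 2)
          + hgap s k * b k * (hgap s j ^ 2 * b j / hdist s j k ^ 2))) N) N).
  - apply Rsum_le; intros j _. apply Rsum_le; intros k _.
    pose proof (Re_inv_bound s j k Hs) as [Hr1 Hr2].
    rewrite ip_nszego by exact Hs. unfold Cdiv. rewrite re_scal_l. fold (sg j) (sg k).
    set (r := Re (/ (1 - Cconj (s j) * s k))%C) in *.
    apply Rle_trans with (Rabs (a j) * sg j * (Rabs (a k) * sg k) * r).
    + eapply Rle_trans; [apply Rle_abs|]. rewrite !Rabs_mult.
      rewrite (Rabs_pos_eq (sg j)), (Rabs_pos_eq (sg k)), (Rabs_pos_eq r);
        [lra|exact Hr1|apply Rlt_le, Hsg|apply Rlt_le, Hsg].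
    + assert (Hp : 0 <= Rabs (a j) * sg j * (Rabs (a k) * sg k)).
      { pose proof (Hsg j). pose proof (Hsg k).
        repeat apply Rmult_le_pos; try apply Rabs_pos; lra. }
      eapply Rle_trans; [apply Rmult_le_compat_l; [exact Hp|exact Hr2]|].
      rewrite !Hb1, (hdist_sym s k j). right. pose proof (hdist_pos s j k Hs). field. lra.
  - rewrite (Rsum_ext _ (fun j =>
       / 2 * (Rabs (a j) * sg j * Rsum (fun k => Rabs (a k) * sg k) N) +
       / 2 * (hgap s j * b j * Rsum (fun k => hgap s k ^ 2 * b k / hdist s k j ^ 2) N
         + Rsum (fun k => hgap s k * b k * (hgap s j ^ 2 * b j / hdist s j k ^ 2)) N))).
    2:{ intros j _. rewrite Rsum_plus, !Rsum_scal, Rsum_plus, !Rsum_scal. reflexivity. }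
    rewrite Rsum_plus, !Rsum_scal, Rsum_plus.
    rewrite (Rsum_swap (fun i j => hgap s j * b j * (hgap s i ^ 2 * b i / hdist s i j ^ 2))).
    rewrite (Rsum_ext (fun j => Rsum (fun i => hgap s j * b j * (hgap s i ^ 2 * b i / hdist s i j ^ 2)) N)
      (fun j => hgap s j * b j * Rsum (fun i => hgap s i ^ 2 * b i / hdist s i j ^ 2) N))
      by (intros; apply Rsum_scal).
    rewrite (Rsum_ext (fun n => Rabs (a n) * sg n * Rsum (fun k => Rabs (a k) * sg k) N)
      (fun n => Rsum (fun k => Rabs (a k) * sg k) N * (Rabs (a n) * sg n))) by (intros; ring).
    rewrite Rsum_scal.
    set (Q := Rsum (fun k => Rabs (a k) * sg k) N) in *.
    set (X := Rsum (fun k => hgap s k * b k * Rsum _ N) N) in *. nra.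
Qed.

Definition bessel (x : nat -> l2) (K : R) : Prop := forall N (a : nat -> C),
  nm (lcomb a x N) ^ 2 <= K * Rsum (fun n => Cmod (a n) ^ 2) N.

Lemma carleson_bessel s : carleson s -> exists K, 0 < K /\ bessel (nszego s) K.
Proof.
  intros Hc. destruct (bessel_real s Hc) as [K [HK HB]].
  (* Real and imaginary parts of the coefficients are treated separately, at the price |u + i v|^2
     <= 2 |u|^2 + 2 |v|^2. *)
  exists (2 * K). split; [lra|]. intros N a.
  replace (lcomb a (nszego s) N) with
    (ladd (lcomb (fun n => RtoC (fst (a n))) (nszego s) N)
          (lscal Ci (lcomb (fun n => RtoC (snd (a n))) (nszego s) N))).
  - set (u := lcomb (fun n => RtoC (fst (a n))) (nszego s) N).
    set (v := lcomb (fun n => RtoC (snd (a n))) (nszego s) N).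
    pose proof (HB N (fun n => fst (a n))) as H1. cbv beta in H1. fold u in H1.
    pose proof (HB N (fun n => snd (a n))) as H2. cbv beta in H2. fold v in H2.
    pose proof (nm_triangle u (lscal Ci v)) as Ht. rewrite nm_scal, Cmod_Ci, Rmult_1_l in Ht.
    pose proof (nm_ge0 (ladd u (lscal Ci v))). pose proof (pow2_ge_0 (nm u - nm v)).
    rewrite (Rsum_ext (fun n => Cmod (a n) ^ 2) (fun n => fst (a n) ^ 2 + snd (a n) ^ 2))
      by (intros; apply Cmod2_alt).
    rewrite Rsum_plus.
    assert (nm (ladd u (lscal Ci v)) ^ 2 <= (nm u + nm v) ^ 2) by (apply pow_incr; lra).
    lra.
  - rewrite lcomb_scal, lcomb_add. apply lcomb_ext. intros n _. f_equal.
    destruct (a n) as [x y]. apply injective_projections; simpl; ring.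
Qed.

(** * The dual system and the lower bound for Szego kernels *)

Definition skipB (s : nat -> C) (j N : nat) (f : l2) : l2 :=
  iterop (fun n => if Nat.eqb n j then (fun g => g) else mulb (s n)) N f.

Lemma skipB_out s j N f : (N <= j)%nat -> skipB s j N f = mulB s N f.
Proof.
  intros HN. unfold skipB, mulB. induction N as [|N IH]; simpl; [reflexivity|].
  replace (Nat.eqb N j) with false by (symmetry; apply Nat.eqb_neq; lia).
  rewrite IH by lia. reflexivity.
Qed.

Lemma mulb_skipB s j N f : discseq s -> (j < N)%nat ->
  mulb (s j) (skipB s j N f) = mulB s N f.
Proof.
  intros Hs. induction N as [|N IH]; intros Hj; [lia|].
  unfold skipB. simpl. fold (skipB s j N f).
  destruct (Nat.eqb_spec N j) as [E|E].
  - subst j. rewrite skipB_out by lia. reflexivity.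
  - rewrite mulb_comm, IH by (auto || lia). reflexivity.
Qed.

Lemma ip_skipB_self s j N f g : discseq s -> (j < N)%nat ->
  ip (skipB s j N f) (skipB s j N g) = ip f g.
Proof.
  intros Hs Hj. rewrite <- (ip_mulb (s j)), !mulb_skipB by auto. now apply ip_mulB.
Qed.

(** Applying the isometries of the factors at [s j] and [s k] to both sides completes each product
    to the full B_N, which then drops out; one factor is left over on each side. *)
Lemma ip_skipB s j k N f g : discseq s -> (j < N)%nat -> (k < N)%nat ->
  ip (skipB s j N f) (skipB s k N g) = ip (mulb (s k) f) (mulb (s j) g).
Proof.
  intros Hs Hj Hk.
  rewrite <- (ip_mulb (s j)), <- (ip_mulb (s k)), mulb_skipB by auto.
  rewrite (mulb_comm (s k) (s j)), mulb_skipB, <- !mulB_mulb by auto.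
  now apply ip_mulB.
Qed.

Lemma eval_skipB s j N f z : discseq s -> in_disc z ->
  ip (skipB s j N f) (szego z) =
  (Cprod (fun n => if Nat.eqb n j then 1 else bfactor (s n) z) N * ip f (szego z))%C.
Proof.
  intros Hs Hz. unfold skipB. induction N as [|N IH]; simpl; [ring|].
  destruct (Nat.eqb N j).
  - rewrite IH. ring.
  - rewrite eval_mulb, IH by auto. ring.
Qed.

(* Both sides are computed from [u = k_a k_c]. *)
Lemma ip_mulb_szego a c : in_disc a -> in_disc c ->
  ip (mulb c (szego a)) (mulb a (szego c)) = (phase c * Cconj (phase a) * ip (szego c) (szego a))%C.
Proof.
  intros Ha Hc. set (u := ldiv a (ldiv c lone)).
  assert (E1 : ldiv c (szego a) = u) by (unfold szego, u; now rewrite ldiv_comm).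
  assert (E2 : ldiv a (szego c) = u) by reflexivity.
  assert (E3 : szego c = den a u) by (unfold u; now rewrite den_ldiv).
  assert (E4 : szego a = den c u) by (rewrite <- E1; now rewrite den_ldiv).
  unfold mulb. rewrite E1, E2, E3, E4. unfold den.
  rewrite !ip_scal_l, !ip_scal_r, !ip_sub_l, !ip_sub_r, !ip_scal_l, !ip_scal_r, !ip_shift,
    Cconj_conj. ring.
Qed.

Lemma ip_skipB_nszego s j k N : discseq s -> (j < N)%nat -> (k < N)%nat ->
  ip (skipB s j N (nszego s j)) (skipB s k N (nszego s k)) =
  (phase (s k) * Cconj (phase (s j)) * ip (nszego s k) (nszego s j))%C.
Proof.
  intros Hs Hj Hk. destruct (Nat.eq_dec j k) as [<-|Hjk].
  - rewrite ip_skipB_self, phase_conj by assumption. ring.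
  - rewrite ip_skipB by assumption. unfold nszego.
    rewrite !mulb_scal, !ip_scal_l, !ip_scal_r, ip_mulb_szego, !Cconj_R by apply Hs. ring.
Qed.

Lemma Csum_scal c (f : nat -> C) N : Csum (fun n => c * f n)%C N = (c * Csum f N)%C.
Proof. induction N as [|N IH]; simpl; [ring|rewrite IH; ring]. Qed.

Lemma Csum_plus (f g : nat -> C) N :
  Csum (fun n => f n + g n)%C N = (Csum f N + Csum g N)%C.
Proof. induction N as [|N IH]; simpl; [ring|rewrite IH; ring]. Qed.

Lemma Csum_swap (F : nat -> nat -> C) N N' :
  Csum (fun i => Csum (fun j => F i j) N') N = Csum (fun j => Csum (fun i => F i j) N) N'.
Proof.
  induction N as [|N IH]; simpl; [now rewrite Csum_0|].
  rewrite IH, <- Csum_plus. reflexivity.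
Qed.

Lemma Csum_single (f : nat -> C) N i : (i < N)%nat ->
  (forall j, (j < N)%nat -> j <> i -> f j = 0%C) -> Csum f N = f i.
Proof.
  induction N as [|N IH]; intros Hi H; [lia|]. simpl.
  destruct (Nat.eq_dec i N) as [->|Hn].
  - rewrite (Csum_ext f (fun _ => 0%C)), Csum_0 by (intros; apply H; lia). ring.
  - rewrite IH, (H N) by (try (intros; apply H); lia). ring.
Qed.

Lemma Csum_R (u : nat -> R) N : Csum (fun n => RtoC (u n)) N = RtoC (Rsum u N).
Proof. induction N as [|N IH]; simpl; [reflexivity|]. now rewrite IH, RtoC_plus. Qed.

Lemma ip_lcomb_lcomb c x c' y N :
  ip (lcomb c x N) (lcomb c' y N) =
  Csum (fun j => Csum (fun k => c j * Cconj (c' k) * ip (x j) (y k))%C N) N.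
Proof.
  rewrite ip_lcomb_l. apply Csum_ext; intros j _. rewrite ip_lcomb_r, <- Csum_scal.
  apply Csum_ext; intros k _. ring.
Qed.

(* The dual system [B_{N,j} k_j] has, up to unimodular factors, the conjugate Gram matrix,
   so the Bessel bound for the kernels also bounds the dual system. *)
Lemma carleson_lower s : carleson s -> exists K, 0 < K /\
  forall N (a : nat -> C),
    Rsum (fun n => Cmod (a n) ^ 2) N <= K * nm (lcomb a (nszego s) N) ^ 2.
Proof.
  intros Hc. destruct (carleson_bessel s Hc) as [K [HK HB]].
  destruct (carleson_cprod s Hc) as [Hs [delta [Hd Hprod]]].
  assert (Hd2 : 0 < delta ^ 2) by now apply pow_lt.
  exists (K / delta ^ 2). split; [now apply Rdiv_lt_0_compat|]. intros N a.
  set (g := fun j => skipB s j N (nszego s j)).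
  set (p := fun j => Cprod (fun n => if Nat.eqb n j then 1%C else bfactor (s n) (s j)) N).
  assert (Hp : forall j, delta <= Cmod (p j)).
  { intros j. unfold p. rewrite Cmod_Cprod. eapply Rle_trans; [apply (Hprod j N)|].
    right. unfold cprod. f_equal. extensionality m.
    destruct (Nat.eqb m j); [now rewrite Cmod_1|]. now rewrite Cmod_bfactor. }
  assert (Hp0 : forall j, p j <> 0%C).
  { intros j. apply Cmod_gt_0. specialize (Hp j). lra. }
  (* The dual vector pairs with its own kernel to conj p_j, so dividing by [p j] makes the pairing
     of the two combinations equal to the sum of |a_j|^2. *)
  set (c := fun j => (a j / p j)%C).
  (* Conjugating the coefficients matches the transposition of the Gram matrix, and the phases
     absorb its unimodular factors. *)
  set (e := fun j => (Cconj (c j) * phase (s j))%C).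
  set (A := Rsum (fun n => Cmod (a n) ^ 2) N).
  assert (Hg : nm (lcomb c g N) ^ 2 = nm (lcomb e (nszego s) N) ^ 2).
  { rewrite !nm_sqr_ip. f_equal. rewrite !ip_lcomb_lcomb.
    rewrite (Csum_swap (fun j k => e j * Cconj (e k) * ip (nszego s j) (nszego s k))%C).
    apply Csum_ext; intros j Hj. apply Csum_ext; intros k Hk.
    unfold g. rewrite ip_skipB_nszego by assumption. unfold e.
    rewrite Cmult_conj, Cconj_conj. ring. }
  assert (He : Rsum (fun n => Cmod (e n) ^ 2) N <= / delta ^ 2 * A).
  { unfold A. rewrite <- Rsum_scal. apply Rsum_le; intros j _. unfold e, c.
    rewrite Cmod_mult, Cmod_conj, Cmod_phase, Cmod_div, Rmult_1_r by auto.
    unfold Rdiv. rewrite Rpow_mult_distr, Rmult_comm, pow_inv.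
    apply Rmult_le_compat_r; [apply pow2_ge_0|].
    apply Rinv_le_contravar; [exact Hd2|]. apply pow_incr. specialize (Hp j). lra. }
  assert (Hdual : forall i j, (i < N)%nat -> (j < N)%nat ->
    ip (nszego s i) (g j) = if Nat.eqb j i then Cconj (p i) else 0%C).
  { intros i j Hi Hj. rewrite ip_conj. unfold g. unfold nszego at 2. rewrite ip_scal_r, eval_skipB by auto.
    destruct (Nat.eqb_spec j i) as [->|Hji].
    - f_equal. fold (p i). unfold nszego. rewrite ip_scal_l, eval_szego, Cconj_R by auto.
      pose proof (hgap_pos s i Hs) as Hh.
      replace (1 - Cconj (s i) * s i)%C with (RtoC (hgap s i)).
      + rewrite <- (sqrt_sqrt (hgap s i)) at 3 by lra. rewrite RtoC_mult.
        field. intros E. apply RtoC_inj in E. apply sqrt_eq_0 in E; lra.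
      + unfold hgap. rewrite RtoC_minus, Cmod2_conj, Cmult_comm. reflexivity.
    - rewrite (Cprod_eq0 _ N i Hi).
      + replace (Cconj (sqrt (hgap s i)) * (0 * ip (nszego s j) (szego (s i))))%C with (RtoC 0) by ring.
        apply Cconj_R.
      + replace (Nat.eqb i j) with false by (symmetry; apply Nat.eqb_neq; lia).
        now apply bfactor_self. }
  assert (HA : ip (lcomb a (nszego s) N) (lcomb c g N) = RtoC A).
  { unfold A. rewrite ip_lcomb_lcomb, <- Csum_R. apply Csum_ext; intros i Hi.
    rewrite (Csum_single _ N i Hi).
    - rewrite Hdual, Nat.eqb_refl, Cmod2_conj by assumption. unfold c.
      rewrite Cdiv_conj by auto. field. intros E.
      apply (f_equal Cmod) in E. rewrite Cmod_conj, Cmod_0 in E. specialize (Hp i). lra.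
    - intros j Hj Hji. rewrite Hdual by assumption.
      replace (Nat.eqb j i) with false by (symmetry; now apply Nat.eqb_neq). ring. }
  assert (HA0 : 0 <= A) by (apply Rsum_nonneg; intros; apply pow2_ge_0).
  pose proof (cauchy_schwarz (lcomb a (nszego s) N) (lcomb c g N)) as HCS.
  rewrite HA, Cmod_R, Rabs_pos_eq in HCS by exact HA0.
  pose proof (HB N e) as HBe. rewrite <- Hg in HBe.
  set (F := nm (lcomb a (nszego s) N)) in *. set (G := nm (lcomb c g N)) in *.
  destruct (Req_dec A 0) as [E|E].
  { rewrite E. apply Rmult_le_pos; [|apply pow2_ge_0]. apply Rdiv_le_0_compat; lra. }
  assert (HG : G ^ 2 <= K / delta ^ 2 * A).
  { eapply Rle_trans; [exact HBe|]. unfold Rdiv. rewrite Rmult_assoc.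
    apply Rmult_le_compat_l; lra. }
  assert (HAA : A ^ 2 <= (F * G) ^ 2) by (apply pow_incr; lra).
  rewrite Rpow_mult_distr in HAA.
  apply Rmult_le_reg_l with A; [lra|].
  assert (F ^ 2 * G ^ 2 <= F ^ 2 * (K / delta ^ 2 * A))
    by (apply Rmult_le_compat_l; [apply pow2_ge_0|exact HG]).
  lra.
Qed.

(** * Transferring the Riesz property *)

Definition lower (x : nat -> l2) (K : R) : Prop := forall N (a : nat -> C),
  Rsum (fun n => Cmod (a n) ^ 2) N <= K * nm (lcomb a x N) ^ 2.

Lemma lcomb_delta (x : nat -> l2) N j : (j < N)%nat ->
  lcomb (fun n => if Nat.eqb n j then 1%C else 0%C) x N = x j.
Proof.
  intros Hj. unfold lcomb. induction N as [|N IH]; [lia|]. simpl.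
  destruct (Nat.eqb_spec N j) as [E|E].
  - subst j. clear IH Hj.
    assert (H : forall M, (M <= N)%nat ->
      lsum (fun n => lscal (if Nat.eqb n N then 1%C else 0%C) (x n)) M = lzero).
    { induction M as [|M IH]; intros HM; simpl; [reflexivity|]. rewrite IH by lia.
      replace (Nat.eqb M N) with false by (symmetry; apply Nat.eqb_neq; lia). l2ring. }
    rewrite H by lia. l2ring.
  - rewrite IH by lia. l2ring.
Qed.

Lemma approx_rescale (x x' : nat -> l2) (t : nat -> C) f :
  (forall n, t n <> 0%C) -> (forall n, x' n = lscal (t n) (x n)) ->
  approx x f -> approx x' f.
Proof.
  intros Ht Hx Hf eps He. destruct (Hf eps He) as [s [[N [c ->]] Hs]].
  exists (lcomb c x N). split; [|exact Hs].
  exists N, (fun n => c n / t n)%C. apply lcomb_ext. intros n _. rewrite Hx.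
  l2ring. field. apply Ht.
Qed.

Lemma le_of_eps (A B K : R) : 0 <= K -> (forall eps, 0 < eps -> A <= B + K * eps) -> A <= B.
Proof.
  intros HK H. apply Rnot_lt_le. intros Hlt.
  specialize (H ((A - B) / (2 * (K + 1)))).
  assert (Hp : 0 < (A - B) / (2 * (K + 1))) by (apply Rdiv_lt_0_compat; lra).
  specialize (H Hp). set (e := (A - B) / (2 * (K + 1))) in *.
  assert (e * (2 * (K + 1)) = A - B) by (unfold e; field; lra). nra.
Qed.

(* [f = sum b y] is nearly [sum a p], and [g = sum a x] satisfies
   [<f, f> ~ <f, sum a p> = <f, g> = <sum b q, g>]. *)
Lemma lower_transfer (x y p q : nat -> l2) (C c : R) :
  0 < C -> 0 < c -> bessel x C -> lower p c ->
  (forall n j, ip (y n) (lsub (x j) (p j)) = 0%C) ->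
  (forall n j, ip (lsub (y n) (q n)) (x j) = 0%C) ->
  (forall N b, approx p (lcomb b y N)) ->
  exists K, 0 < K /\ forall N b, nm (lcomb b y N) <= K * nm (lcomb b q N).
Proof.
  intros HC Hc HB HL Hxp Hyq Hap.
  (* This bounds the norm of the map sending sum a p to sum a x: its squared value is at most [C]
     times the sum of |a|^2, itself at most [c] times |sum a p|^2. *)
  exists (sqrt (C * c)). split; [apply sqrt_lt_R0; nra|]. intros N b.
  set (K := sqrt (C * c)). set (f := lcomb b y N). set (h := lcomb b q N).
  assert (HK0 : 0 <= K) by apply sqrt_pos.
  assert (HK2 : K ^ 2 = C * c) by (apply pow2_sqrt; nra).
  pose proof (nm_ge0 f) as Hf0. pose proof (nm_ge0 h) as Hh0.
  assert (Hmain : nm f ^ 2 <= K * nm h * nm f).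
  { apply (le_of_eps _ _ (nm f + K * nm h)).
    - apply Rplus_le_le_0_compat; [exact Hf0|now apply Rmult_le_pos].
    - intros eps He. destruct (Hap N b eps He) as [s [[n [a ->]] Hs]]. fold f in Hs.
      set (s := lcomb a p n) in *. set (g := lcomb a x n).
      assert (E1 : ip f (lsub g s) = 0%C).
      { unfold f, g, s. rewrite lcomb_sub_r. apply ip_lcomb_l_eq0. intros i _.
        apply ip_eq0_sym. apply ip_lcomb_l_eq0. intros j _. apply ip_eq0_sym, Hxp. }
      assert (E2 : ip (lsub f h) g = 0%C).
      { unfold f, g, h. rewrite lcomb_sub_r. apply ip_lcomb_l_eq0. intros i _.
        apply ip_eq0_sym. apply ip_lcomb_l_eq0. intros j _. apply ip_eq0_sym, Hyq. }
      assert (E3 : ip f f = (ip f (lsub f s) + ip h g)%C).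
      { rewrite ip_sub_r in E1 |- *. rewrite ip_sub_l in E2.
        transitivity (ip f f - ip f s + ip h g + (ip f g - ip h g) - (ip f g - ip f s))%C;
          [ring|]. rewrite E1, E2. ring. }
      assert (Hg : nm g <= K * (nm f + eps)).
      { pose proof (nm_le_sub s f) as Hsf. rewrite nm_sub_comm in Hsf.
        pose proof (nm_ge0 s). apply Rle_trans with (K * nm s).
        - apply Rle_sqr; [now apply Rmult_le_pos|].
          rewrite Rpow_mult_distr, HK2. unfold g.
          eapply Rle_trans; [apply HB|]. rewrite Rmult_assoc.
          apply Rmult_le_compat_l; [lra|apply HL].
        - apply Rmult_le_compat_l; lra. }
      rewrite nm_sqr_ip, E3, re_plus.
      pose proof (Re_ip_le f (lsub f s)) as H1. pose proof (Re_ip_le h g) as H2.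
      apply Rabs_le_between in H1, H2.
      assert (nm f * nm (lsub f s) <= nm f * eps) by (apply Rmult_le_compat_l; lra).
      assert (nm h * nm g <= nm h * (K * (nm f + eps))) by (apply Rmult_le_compat_l; lra).
      nra. }
  destruct (Req_dec (nm f) 0) as [E|E].
  - rewrite E. now apply Rmult_le_pos.
  - apply Rmult_le_reg_l with (nm f); nra.
Qed.

(** A biorthogonal vector: the residual of p_j after projection onto the other p_i. It is nonzero
    because p_j minus any combination of the others has coefficient 1 at [j], hence squared norm at
    least 1/c. *)
Lemma lower_dual (p : nat -> l2) (c : R) j : 0 < c -> lower p c ->
  exists r, 0 < nm r /\ (forall i, i <> j -> ip (p i) r = 0%C) /\
    ip (p j) r = RtoC (nm r ^ 2).
Proof.
  intros Hc HL.
  (* Zeroing the entry [j] removes it from the span without reindexing the family. *)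
  set (v := fun i => if Nat.eqb i j then lzero else p i).
  destruct (projection v (p j)) as [r [Hr Ha]]. exists r.
  assert (Hv : forall i, ip (v i) r = 0%C) by (intros; apply ip_eq0_sym, Hr).
  split; [|split].
  - pose proof (nm_ge0 r). apply Rnot_le_lt. intros Hr0. apply nm_eq0 in Hr0. subst r.
    destruct (Ha (/ sqrt c)) as [s [[N [a ->]] Hs]].
    { apply Rinv_0_lt_compat, sqrt_lt_R0, Hc. }
    set (a' := fun n => if (n <? N)%nat then (if Nat.eqb n j then RtoC 0 else a n) else RtoC 0).
    set (e := fun n => ((if Nat.eqb n j then RtoC 1 else RtoC 0) + (-(1)) * a' n)%C).
    assert (E : lsub (lsub (p j) lzero) (lcomb a v N) = lcomb e p (N + S j)).
    { unfold e. rewrite <- lcomb_add, <- lcomb_scal, lcomb_delta by lia.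
      assert (Eav : lcomb a v N = lcomb a' p (N + S j)).
      { unfold a'. rewrite <- (lcomb_pad (fun n => if Nat.eqb n j then RtoC 0 else a n)).
        apply lcomb_ext. intros n _. unfold v.
        destruct (Nat.eqb n j); l2ring. }
      rewrite Eav. l2ring. }
    rewrite E in Hs.
    pose proof (HL (N + S j)%nat e) as Hle.
    assert (H1 : 1 <= Rsum (fun n => Cmod (e n) ^ 2) (N + S j)).
    { eapply Rle_trans; [|apply (Rsum_term_le _ _ j)]; [|intros; apply pow2_ge_0|lia].
      cbv beta. unfold e, a'. rewrite Nat.eqb_refl.
      replace (1 + - (1) * (if (j <? N)%nat then RtoC 0 else RtoC 0))%C with (RtoC 1)
        by (destruct (j <? N)%nat; ring).
      rewrite Cmod_1. lra. }
    assert (H2 : nm (lcomb e p (N + S j)) ^ 2 < (/ sqrt c) ^ 2).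
    { pose proof (nm_ge0 (lcomb e p (N + S j))). nra. }
    rewrite pow_inv, pow2_sqrt in H2 by lra.
    assert (c * nm (lcomb e p (N + S j)) ^ 2 < c * / c) by (apply Rmult_lt_compat_l; lra).
    rewrite Rinv_r in H0 by lra. lra.
  - intros i Hi. specialize (Hv i). unfold v in Hv.
    replace (Nat.eqb i j) with false in Hv by (symmetry; now apply Nat.eqb_neq). exact Hv.
  - assert (E : ip (lsub (p j) r) r = 0%C) by (apply (approx_ip_eq0 _ _ _ Ha); exact Hv).
    rewrite ip_sub_l, ip_self in E.
    replace (ip (p j) r) with (ip (p j) r - RtoC (nm r ^ 2) + RtoC (nm r ^ 2))%C by ring.
    rewrite E. ring.
Qed.

(** Testing the Bessel bound with coefficients conj <y_n, r> shows that the |<y_n, r>|^2 are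
    summable, so they tend to zero. *)
Lemma bessel_weak_null (y : nat -> l2) K r : 0 < K -> bessel y K ->
  forall eps, 0 < eps -> exists n0, forall n, (n0 <= n)%nat -> Cmod (ip (y n) r) < eps.
Proof.
  intros HK HB.
  assert (HS : forall N, Rsum (fun n => Cmod (ip (y n) r) ^ 2) N <= K * nm r ^ 2).
  { intros N. set (a := fun n => Cconj (ip (y n) r)).
    set (A := Rsum (fun n => Cmod (ip (y n) r) ^ 2) N).
    assert (HA0 : 0 <= A) by (apply Rsum_nonneg; intros; apply pow2_ge_0).
    assert (E : ip (lcomb a y N) r = RtoC A).
    { unfold A. rewrite ip_lcomb_l, <- Csum_R. apply Csum_ext; intros n _.
      rewrite Cmod2_conj. unfold a. ring. }
    pose proof (cauchy_schwarz (lcomb a y N) r) as HCS.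
    rewrite E, Cmod_R, Rabs_pos_eq in HCS by exact HA0.
    pose proof (HB N a) as Hb.
    rewrite (Rsum_ext _ (fun n => Cmod (ip (y n) r) ^ 2)) in Hb
      by (intros; unfold a; now rewrite Cmod_conj).
    fold A in Hb. pose proof (nm_ge0 r). pose proof (nm_ge0 (lcomb a y N)).
    destruct (Req_dec A 0) as [EA|EA]; [rewrite EA; nra|].
    apply Rmult_le_reg_l with A; [lra|].
    assert (HAA : A ^ 2 <= (nm (lcomb a y N) * nm r) ^ 2) by (apply pow_incr; lra).
    rewrite Rpow_mult_distr in HAA.
    assert (nm (lcomb a y N) ^ 2 * nm r ^ 2 <= K * A * nm r ^ 2)
      by (apply Rmult_le_compat_r; [apply pow2_ge_0|exact Hb]).
    lra. }
  destruct (Series_bounded _ _ (fun n => pow2_ge_0 (Cmod (ip (y n) r))) HS) as [He _].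
  apply ex_series_lim_0 in He. apply is_lim_seq_spec in He.
  intros eps Heps. assert (Hp : 0 < eps ^ 2) by nra.
  destruct (He (mkposreal _ Hp)) as [n0 Hn0]. exists n0. intros n Hn.
  specialize (Hn0 n Hn). simpl pos in Hn0. cbv beta in Hn0.
  rewrite Rminus_0_r, Rabs_pos_eq in Hn0 by apply pow2_ge_0.
  pose proof (Cmod_ge_0 (ip (y n) r)). nra.
Qed.

(* [y n] is nearly [sum a p] with coefficients tending to zero one by one as [n] grows;
   since [beta j -> 0], the combination [sum a x] is then close to [sum a p]. *)
Lemma limit_transfer (x y p : nat -> l2) (beta : nat -> C) (C c K : R) :
  0 < C -> 0 < c -> 0 < K -> lower p c -> bessel y K ->
  (forall n, nm (y n) = 1) -> (forall n, approx p (y n)) ->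
  (forall n, Cmod (beta n) <= 1) -> ccv beta 0 ->
  (forall N a, nm (lcomb a (fun n => lsub (x n) (p n)) N) ^ 2 <=
     C * Rsum (fun n => Cmod (a n) ^ 2 * Cmod (beta n) ^ 2) N) ->
  forall eps, 0 < eps -> exists n0, forall n, (n0 <= n)%nat ->
    exists g, span x g /\ nm (lsub (y n) g) < eps.
Proof.
  intros HC Hc HK HL HB Hy Hap Hb1 Hb0 Hxp eps Heps.
  (* Chosen so that C e^2 (4 c + 1) = (eps/2)^2: here 4 c bounds the sum of all squared
     coefficients, and the extra 1 pays for the first [J] of them. *)
  set (e := eps / (2 * sqrt (C * (4 * c + 1)))).
  assert (HD : 0 < C * (4 * c + 1)) by nra.
  assert (HsD : 0 < sqrt (C * (4 * c + 1))) by now apply sqrt_lt_R0.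
  assert (He : 0 < e) by (apply Rdiv_lt_0_compat; lra).
  destruct (Hb0 e He) as [J HJ].
  (* Then J eta^2 <= e^2, and the 1 in the denominator covers J = 0. *)
  set (eta := e / (INR J + 1)). pose proof (pos_INR J) as HJ0.
  assert (Heta : 0 < eta) by (apply Rdiv_lt_0_compat; lra).
  assert (Hcoef : forall J', exists n0 d, 0 < d /\ forall n, (n0 <= n)%nat ->
    forall a N, nm (lsub (y n) (lcomb a p N)) < d ->
    forall j, (j < J')%nat -> (j < N)%nat -> Cmod (a j) <= eta).
  { induction J' as [|J' [n1 [d1 [Hd1 IH]]]].
    - exists 0%nat, 1. split; [lra|]. intros. lia.
    (* Pairing with [r] reads off the coefficient at [J'] times |r|^2. The pairing is small because
       <y_n, r> tends to 0 and the combination is close to y_n. *)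
    - destruct (lower_dual p c J' Hc HL) as [r [Hr0 [Hr1 Hr2]]].
      assert (Hdr : 0 < eta * nm r) by now apply Rmult_lt_0_compat.
      assert (Hdl : 0 < eta * nm r ^ 2 / 2).
      { replace (eta * nm r ^ 2 / 2) with (eta * nm r * nm r / 2) by field.
        apply Rdiv_lt_0_compat; [now apply Rmult_lt_0_compat|lra]. }
      destruct (bessel_weak_null y K r HK HB _ Hdl) as [n2 Hn2].
      set (d := Rmin d1 (eta * nm r / 2)).
      exists (Nat.max n1 n2), d. split; [apply Rmin_pos; lra|].
      intros n Hn a N Hs j Hj HjN.
      assert (Hsd1 : nm (lsub (y n) (lcomb a p N)) < d1)
        by (eapply Rlt_le_trans; [exact Hs|apply Rmin_l]).
      assert (Hsd2 : nm (lsub (y n) (lcomb a p N)) < eta * nm r / 2)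
        by (eapply Rlt_le_trans; [exact Hs|apply Rmin_r]).
      destruct (Nat.eq_dec j J') as [->|Hne].
      2:{ apply (IH n ltac:(lia) a N Hsd1 j); lia. }
      assert (E : ip (lcomb a p N) r = (a J' * RtoC (nm r ^ 2))%C).
      { rewrite ip_lcomb_l, (Csum_single _ N J' HjN), Hr2; [reflexivity|].
        intros i _ Hi. rewrite Hr1 by exact Hi. ring. }
      specialize (Hn2 n ltac:(lia)).
      pose proof (cauchy_schwarz (lsub (y n) (lcomb a p N)) r) as HCS.
      pose proof (Cmod_triangle (ip (y n) r) (- ip (lsub (y n) (lcomb a p N)) r)) as Ht.
      replace (ip (y n) r + - ip (lsub (y n) (lcomb a p N)) r)%C
        with (a J' * RtoC (nm r ^ 2))%C in Ht by (rewrite ip_sub_l, E; ring).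
      rewrite Cmod_opp, Cmod_mult, Cmod_R, Rabs_pos_eq in Ht by apply pow2_ge_0.
      apply Rmult_le_reg_r with (nm r ^ 2); [now apply pow_lt|].
      assert (nm (lsub (y n) (lcomb a p N)) * nm r <= eta * nm r / 2 * nm r)
        by (apply Rmult_le_compat_r; lra).
      lra. }
  destruct (Hcoef J) as [n0 [d [Hd Hn0]]]. exists n0. intros n Hn.
  destruct (Hap n (Rmin d (Rmin 1 (eps / 2)))) as [s [[N [a ->]] Hs]].
  { repeat apply Rmin_pos; lra. }
  assert (Hs1 : nm (lsub (y n) (lcomb a p N)) < d)
    by (eapply Rlt_le_trans; [exact Hs|apply Rmin_l]).
  assert (Hs2 : nm (lsub (y n) (lcomb a p N)) < 1).
  { eapply Rlt_le_trans; [exact Hs|]. eapply Rle_trans; [apply Rmin_r|apply Rmin_l]. }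
  assert (Hs3 : nm (lsub (y n) (lcomb a p N)) < eps / 2).
  { eapply Rlt_le_trans; [exact Hs|]. eapply Rle_trans; [apply Rmin_r|apply Rmin_r]. }
  exists (lcomb a x N). split; [now exists N, a|].
  set (A := Rsum (fun j => Cmod (a j) ^ 2) N).
  (* The combination is within 1 of a unit vector, so its norm is at most 2. *)
  assert (HA : A <= 4 * c).
  { unfold A. eapply Rle_trans; [apply HL|].
    pose proof (nm_le_sub (lcomb a p N) (y n)) as H1. rewrite Hy, nm_sub_comm in H1.
    pose proof (nm_ge0 (lcomb a p N)).
    assert (nm (lcomb a p N) ^ 2 <= 2 ^ 2) by (apply pow_incr; lra). nra. }
  assert (HJs : forall N', Rsum (fun j => if (j <? J)%nat then eta ^ 2 else 0) N' <= INR J * eta ^ 2).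
  { intros N'. assert (Hm : Rsum (fun j => if (j <? J)%nat then eta ^ 2 else 0) N'
      = INR (Nat.min N' J) * eta ^ 2).
    { induction N' as [|N' IHN]; cbn [Rsum]; [simpl; ring|]. rewrite IHN.
      destruct (Nat.ltb_spec N' J).
      - rewrite !Nat.min_l by lia. rewrite S_INR. ring.
      - rewrite !Nat.min_r by lia. ring. }
    rewrite Hm. apply Rmult_le_compat_r; [apply pow2_ge_0|]. apply le_INR. lia. }
  assert (Hsum : Rsum (fun j => Cmod (a j) ^ 2 * Cmod (beta j) ^ 2) N <= e ^ 2 * (4 * c + 1)).
  { apply Rle_trans with (Rsum (fun j => e ^ 2 * Cmod (a j) ^ 2 +
        (if (j <? J)%nat then eta ^ 2 else 0)) N).
    - apply Rsum_le. intros j Hj. pose proof (Cmod_ge_0 (beta j)) as Hbj.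
      pose proof (pow2_ge_0 (Cmod (a j))) as Haj.
      destruct (Nat.ltb_spec j J) as [HjJ|HjJ].
      + pose proof (Hn0 n Hn a N Hs1 j HjJ Hj) as Hea.
        assert (Cmod (a j) ^ 2 <= eta ^ 2)
          by (apply pow_incr; split; [apply Cmod_ge_0|exact Hea]).
        assert (Cmod (beta j) ^ 2 <= 1 ^ 2) by (apply pow_incr; auto).
        pose proof (pow2_ge_0 e). nra.
      + specialize (HJ j HjJ). replace (beta j - 0)%C with (beta j) in HJ by ring.
        assert (Cmod (beta j) ^ 2 <= e ^ 2) by (apply pow_incr; lra).
        nra.
    - rewrite Rsum_plus, Rsum_scal. fold A.
      assert (Hee : INR J * eta ^ 2 <= e ^ 2).
      { unfold eta. replace (INR J * (e / (INR J + 1)) ^ 2)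
          with (e ^ 2 * (INR J / (INR J + 1) ^ 2)) by (field; lra).
        rewrite <- (Rmult_1_r (e ^ 2)) at 2. apply Rmult_le_compat_l; [apply pow2_ge_0|].
        apply Rle_div_l; nra. }
      pose proof (HJs N). pose proof (pow2_ge_0 e). nra. }
  assert (Hgs : nm (lsub (lcomb a x N) (lcomb a p N)) <= eps / 2).
  { rewrite lcomb_sub_r. apply Rle_sqr; [lra|].
    eapply Rle_trans; [apply Hxp|].
    apply Rle_trans with (C * (e ^ 2 * (4 * c + 1))); [apply Rmult_le_compat_l; lra|].
    right. replace (C * (e ^ 2 * (4 * c + 1))) with (e ^ 2 * (C * (4 * c + 1))) by ring.
    rewrite <- (pow2_sqrt (C * (4 * c + 1))) by lra. unfold e. field. lra. }
  eapply Rle_lt_trans; [apply (nm_sub_triangle _ (lcomb a p N))|].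
  rewrite (nm_sub_comm (lcomb a p N)). lra.
Qed.

(** * Projected kernels and the model space bases *)

Definition blaschke_vec (s : nat -> C) (b : l2) : Prop :=
  discseq s /\ (forall i j, i <> j -> s i <> s j) /\ conv (fun N => mulB s N lone) b.

Lemma carleson_blaschke_vec s : carleson s -> exists b, blaschke_vec s b.
Proof.
  intros Hc. destruct (conv_mulB s (proj1 Hc) (carleson_blaschke s Hc)) as [b Hb].
  exists b. split; [exact (proj1 Hc)|]. split; [now apply carleson_distinct|exact Hb].
Qed.

(* The projection of the normalised kernel [nszego t n] to the model space of the Blaschke
   product [b] with zeros [s]. *)
Definition pszego (s : nat -> C) (b : l2) (t : nat -> C) (n : nat) : l2 :=
  lscal (sqrt (hgap t n)) (kervec s b (t n)).

Lemma sqrt_hgap_pos t n : discseq t -> 0 < sqrt (hgap t n).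
Proof. intros Ht. apply sqrt_lt_R0. now apply hgap_pos. Qed.

Lemma nszego_sub_pszego s b t n : lsub (nszego t n) (pszego s b t n) =
  lscal (sqrt (hgap t n) * Cconj (blaschke s (t n))) (ldiv (t n) b).
Proof. unfold nszego, pszego, kervec. l2ring. Qed.

Lemma vanishes_scal s c f : vanishes s f -> vanishes s (lscal c f).
Proof. intros H n. rewrite ip_scal_l, H. ring. Qed.

Lemma vanishes_nszego_sub_pszego s b t n : blaschke_vec s b -> discseq t ->
  vanishes s (lsub (nszego t n) (pszego s b t n)).
Proof.
  intros [Hs [_ Hb]] Ht. rewrite nszego_sub_pszego. apply vanishes_scal. now apply vanishes_ldiv.
Qed.

Lemma ip_pszego_vanishing s b t g n : blaschke_vec s b -> discseq t -> vanishes s g ->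
  ip g (pszego s b t n) = 0%C.
Proof.
  intros [Hs [Hd Hb]] Ht Hg. unfold pszego.
  rewrite ip_scal_r, ip_kervec_vanishing by auto. ring.
Qed.

Lemma ip_nszego_vanishing s g n : vanishes s g -> ip g (nszego s n) = 0%C.
Proof. intros Hg. unfold nszego. rewrite ip_scal_r, Hg. ring. Qed.

Lemma ip_nszego_vanishes s g : discseq s -> (forall n, ip g (nszego s n) = 0%C) -> vanishes s g.
Proof.
  intros Hs H n. specialize (H n). unfold nszego in H. rewrite ip_scal_r, Cconj_R in H.
  apply NNPP. intros Hx. revert H. apply Cmult_neq_0; [|exact Hx].
  intros E. apply RtoC_inj in E. pose proof (sqrt_hgap_pos s n Hs). lra.
Qed.

Lemma nm_pszego s b t n : blaschke_vec s b -> discseq t ->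
  nm (pszego s b t n) ^ 2 = 1 - Cmod (blaschke s (t n)) ^ 2.
Proof.
  intros [Hs [Hd Hb]] Ht. unfold pszego. pose proof (hgap_pos t n Ht).
  rewrite nm_scal, Rpow_mult_distr, nm_kervec, Cmod_R, pow2_abs, pow2_sqrt by (auto || lra).
  fold (hgap t n). field. lra.
Qed.

Lemma nm_pszego_pos s b t n : blaschke_vec s b -> discseq t -> 0 < nm (pszego s b t n) <= 1.
Proof.
  intros Hb Ht. pose proof (nm_pszego s b t n Hb Ht) as E. destruct Hb as [Hs [_ Hb]].
  pose proof (Cmod_blaschke_lt1 s b (t n) Hs Hb (Ht n)).
  pose proof (Cmod_ge_0 (blaschke s (t n))). pose proof (nm_ge0 (pszego s b t n)). nra.
Qed.

(** The left vector is B times the combination on the right, and multiplication by B is isometric.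
    The complementary projection thereby acts as a diagonal multiplier on coefficients. *)
Lemma nm_lcomb_nszego_sub_pszego s b t a N : blaschke_vec s b -> discseq t ->
  nm (lcomb a (fun n => lsub (nszego t n) (pszego s b t n)) N) =
  nm (lcomb (fun n => a n * Cconj (blaschke s (t n)))%C (nszego t) N).
Proof.
  intros [Hs [_ Hb]] Ht.
  set (c := fun n => (a n * (sqrt (hgap t n) * Cconj (blaschke s (t n))))%C).
  transitivity (nm (lcomb c (fun n => ldiv (t n) b) N)).
  - f_equal. apply lcomb_ext. intros n _. rewrite nszego_sub_pszego. unfold c. l2ring.
  - rewrite (nm_lcomb_blaschke s b c t N Hs Ht Hb). f_equal. apply lcomb_ext.
    intros n _. unfold c, nszego. l2ring.
Qed.

(** Pythagoras: the discarded part vanishes on the zeros of B, so it is orthogonal to the model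
    space kernels. *)
Lemma nm_lcomb_pszego_le s b t a N : blaschke_vec s b -> discseq t ->
  nm (lcomb a (pszego s b t) N) <= nm (lcomb a (nszego t) N).
Proof.
  intros Hb Ht. set (f := lcomb a (nszego t) N). set (h := lcomb a (pszego s b t) N).
  assert (E : ip (lsub f h) h = 0%C).
  { unfold f, h. rewrite lcomb_sub_r. apply ip_lcomb_l_eq0. intros i _.
    apply ip_eq0_sym, ip_lcomb_l_eq0. intros j _. apply ip_eq0_sym.
    apply ip_pszego_vanishing; auto. now apply vanishes_nszego_sub_pszego. }
  assert (Ef : nm f ^ 2 = nm (lsub f h) ^ 2 + nm h ^ 2).
  { replace f with (ladd (lsub f h) h) at 1 by l2ring. rewrite nm_add_sqr, E, re_RtoC. ring. }
  apply Rle_sqr; [apply nm_ge0|]. pose proof (pow2_ge_0 (nm (lsub f h))). lra.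
Qed.

Definition npszego (s : nat -> C) (b : l2) (t : nat -> C) (n : nat) : l2 :=
  lscal (RtoC (/ nm (pszego s b t n))) (pszego s b t n).

Lemma kernel_family_kervec s b t : blaschke_vec s b -> discseq t ->
  kernel_family (blaschke s) t (fun n => val (kervec s b (t n))).
Proof.
  intros [Hs [_ Hb]] Ht n. split; [apply valP|]. intros z Hz.
  rewrite h2_eval_ip by exact Hz. now apply eval_kervec.
Qed.

(** Values on the disc determine the coefficients, so the quantification over kernel families in the
    theorem concerns a single family. *)
Lemma kernel_family_unique s b t k : blaschke_vec s b -> discseq t ->
  kernel_family (blaschke s) t k -> k = (fun n => val (kervec s b (t n))).
Proof.
  intros [Hs [_ Hb]] Ht Hk. extensionality n. destruct (Hk n) as [H1 H2].
  change (k n) with (val (L2 (k n) H1)). f_equal. apply eval_inj. intros z Hz.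
  rewrite eval_kervec by auto. rewrite <- h2_eval_ip by exact Hz. now apply H2.
Qed.

Lemma normalize_kervec s b t : discseq t ->
  normalize (fun n => val (kervec s b (t n))) = (fun n => val (npszego s b t n)).
Proof.
  intros Ht. extensionality n. unfold normalize.
  change (h2_norm (kervec s b (t n))) with (nm (kervec s b (t n))).
  change (val (lscal (RtoC (/ nm (kervec s b (t n)))) (kervec s b (t n))) = val (npszego s b t n)).
  f_equal. unfold npszego, pszego. pose proof (sqrt_hgap_pos t n Ht) as Hp.
  rewrite nm_scal, Cmod_R, Rabs_pos_eq, Rinv_mult, !RtoC_mult, (RtoC_inv (sqrt _)) by lra.
  l2ring. field. intros E. apply RtoC_inj in E. lra.
Qed.

Lemma riesz_basis_l2 (H : seqC -> Prop) (x : nat -> l2) : (forall f, H f -> in_H2 f) ->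
  (riesz_basis H (fun n => val (x n)) <->
   (forall n, H (x n)) /\ (forall f : l2, H f -> approx x f) /\
   exists c C0 : R, 0 < c /\ 0 < C0 /\ forall N a,
     c * Rsum (fun n => Cmod (a n) ^ 2) N <= nm (lcomb a x N) ^ 2 <=
     C0 * Rsum (fun n => Cmod (a n) ^ 2) N).
Proof.
  intros HH. unfold riesz_basis. split; intros [H1 [H2 [c [C0 [Hc [HC Hb]]]]]].
  - split; [exact H1|]. split.
    + intros f Hf eps He. destruct (H2 f Hf eps He) as [N [a Ha]].
      exists (lcomb a x N). split; [now exists N, a|].
      unfold nm. simpl. rewrite val_lcomb. exact Ha.
    + exists c, C0. split; [exact Hc|]. split; [exact HC|]. intros N a.
      unfold nm. rewrite val_lcomb. exact (Hb N a).
  - split; [exact H1|]. split.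
    + intros f Hf eps He.
      destruct (H2 (L2 f (HH f Hf)) Hf eps He) as [s [[N [a ->]] Hs]].
      exists N, a. unfold nm in Hs. simpl in Hs. rewrite val_lcomb in Hs. exact Hs.
    + exists c, C0. split; [exact Hc|]. split; [exact HC|]. intros N a.
      rewrite <- val_lcomb. exact (Hb N a).
Qed.

Lemma model_space_H2 s f : model_space (blaschke s) f -> in_H2 f.
Proof. now intros [H _]. Qed.

(** The uniform structure on [C] is that of a product, with squares for balls; hence the factor sqrt
    2. *)
Lemma ccv_filterlim (u : nat -> C) l : ccv u l <-> filterlim u eventually (locally l).
Proof.
  split.
  - intros H. apply filterlim_locally. intros [eps He]. destruct (H eps He) as [N HN].
    exists N. intros n Hn. apply C_NormedModule_mixin_compat1. exact (HN n Hn).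
  - intros H eps He. assert (H2 : 0 < sqrt 2) by (apply sqrt_lt_R0; lra).
    assert (Hp : 0 < eps / sqrt 2) by now apply Rdiv_lt_0_compat.
    destruct (proj1 (filterlim_locally u l) H (mkposreal _ Hp)) as [N HN].
    exists N. intros n Hn. specialize (HN n Hn).
    apply C_NormedModule_mixin_compat2 in HN. simpl in HN.
    replace (sqrt 2 * (eps / sqrt 2)) with eps in HN by (field; lra). exact HN.
Qed.

(** The limit controls the tail and a minimum controls the rest. By [nm_pszego] this bounds the
    norms of the projected kernels from below, so that normalisation costs only a constant. *)
Lemma ccv0_bounded_away (beta : nat -> C) : ccv beta 0 -> (forall n, Cmod (beta n) < 1) ->
  exists eta, 0 < eta /\ forall n, eta <= 1 - Cmod (beta n) ^ 2.
Proof.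
  intros H0 H1. destruct (H0 (/ 2)) as [J HJ]; [lra|].
  assert (Hfin : forall K, exists eta, 0 < eta /\ forall n, (n < K)%nat -> eta <= 1 - Cmod (beta n) ^ 2).
  { induction K as [|K [eta [He IH]]]; [exists 1; split; [lra|]; intros; lia|].
    exists (Rmin eta (1 - Cmod (beta K) ^ 2)). split.
    - apply Rmin_pos; [exact He|]. specialize (H1 K). pose proof (Cmod_ge_0 (beta K)). nra.
    - intros n Hn. destruct (Nat.eq_dec n K) as [->|Hne]; [apply Rmin_r|].
      eapply Rle_trans; [apply Rmin_l|]. apply IH. lia. }
  destruct (Hfin J) as [eta [He Hlt]]. exists (Rmin eta (3 / 4)).
  split; [apply Rmin_pos; lra|]. intros n.
  destruct (Nat.lt_ge_cases n J) as [Hn|Hn].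
  - eapply Rle_trans; [apply Rmin_l|]. now apply Hlt.
  - eapply Rle_trans; [apply Rmin_r|]. specialize (HJ n Hn).
    replace (beta n - 0)%C with (beta n) in HJ by ring.
    pose proof (Cmod_ge_0 (beta n)). nra.
Qed.

(* Any residual [r] of [f] is orthogonal to the kernels at [M], so projecting
   a combination of the [nszego L] close to [r] gives almost zero; [lower] forces [r = 0]. *)
Lemma completeness_transfer L M bL bM C c (f : l2) :
  blaschke_vec L bL -> blaschke_vec M bM -> 0 < C -> 0 < c ->
  bessel (nszego L) C -> lower (pszego M bM L) c ->
  model_space (blaschke L) f -> approx (pszego L bL M) f.
Proof.
  intros HbL HbM HC Hc HB HL Hf.
  pose proof (proj1 HbL) as HsL. pose proof (proj1 HbM) as HsM.
  assert (Hkap : forall g : l2, model_space (blaschke L) g -> approx (nszego L) g).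
  { intros g Hg. destruct HbL as [_ [Hd Hb]].
    apply (approx_rescale (fun n => szego (L n)) _ (fun n => RtoC (sqrt (hgap L n)))).
    - intros n E. apply RtoC_inj in E. pose proof (sqrt_hgap_pos L n HsL). lra.
    - reflexivity.
    - now apply (model_approx L bL). }
  destruct (projection (pszego L bL M) f) as [r [Hr Ha]].
  assert (Hrv : forall g, vanishes L g -> ip g r = 0%C).
  { intros g Hg.
    assert (H1 : ip f g = 0%C).
    { apply (approx_ip_eq0 _ _ _ (Hkap f Hf)). intros n.
      apply ip_eq0_sym. now apply ip_nszego_vanishing. }
    assert (H2 : ip (lsub f r) g = 0%C).
    { apply (approx_ip_eq0 _ _ _ Ha). intros n. apply ip_eq0_sym. now apply ip_pszego_vanishing. }
    apply ip_eq0_sym. rewrite ip_sub_l, H1 in H2.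
    replace (ip r g) with (- (0 - ip r g))%C by ring. rewrite H2. ring. }
  (* The residual is orthogonal to Q y_n by construction and, lying in K_L, also to y_n - Q y_n. *)
  assert (HrM : vanishes M r).
  { apply ip_nszego_vanishes; [exact HsM|]. intros n.
    replace (nszego M n) with (ladd (lsub (nszego M n) (pszego L bL M n)) (pszego L bL M n)) by l2ring.
    rewrite ip_add_r, Hr, (ip_eq0_sym _ _ (Hrv _ (vanishes_nszego_sub_pszego L bL M n HbL HsM))). ring. }
  assert (Hra : approx (nszego L) r) by (apply Hkap, orth_vanishing_model; assumption).
  assert (Hr0 : nm r <= 0).
  { set (K := sqrt (C * c)).
    assert (HK0 : 0 <= K) by apply sqrt_pos.
    assert (HK2 : K ^ 2 = C * c) by (apply pow2_sqrt; nra).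
    apply (le_of_eps _ _ (1 + K)); [lra|]. intros eps He.
    destruct (Hra eps He) as [g [[N [a ->]] Hg]].
    set (g := lcomb a (nszego L) N) in *. set (s := lcomb a (pszego M bM L) N).
    assert (E1 : ip s (lsub g s) = 0%C).
    { unfold g, s. rewrite lcomb_sub_r. apply ip_lcomb_l_eq0. intros i _.
      apply ip_eq0_sym, ip_lcomb_l_eq0. intros j _.
      apply ip_pszego_vanishing; auto. now apply vanishes_nszego_sub_pszego. }
    assert (E2 : ip s r = 0%C).
    { apply ip_lcomb_l_eq0. intros j _. apply ip_eq0_sym. now apply ip_pszego_vanishing. }
    assert (E3 : ip s s = ip s (lsub g r)).
    { rewrite ip_sub_r, E2. rewrite ip_sub_r in E1.
      transitivity (ip s g - (ip s g - ip s s))%C; [ring|]. rewrite E1. ring. }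
    pose proof (nm_ge0 s) as Hs0. rewrite nm_sub_comm in Hg.
    assert (Hs : nm s <= eps).
    { pose proof (Re_ip_le s (lsub g r)) as H1. apply Rabs_le_between in H1.
      rewrite <- E3, <- nm_sqr_ip in H1. nra. }
    assert (Hgs : nm g <= K * nm s).
    { apply Rle_sqr; [now apply Rmult_le_pos|].
      rewrite Rpow_mult_distr, HK2. unfold g.
      eapply Rle_trans; [apply HB|]. rewrite Rmult_assoc.
      apply Rmult_le_compat_l; [lra|apply HL]. }
    pose proof (nm_le_sub r g) as H1. rewrite nm_sub_comm in H1.
    assert (K * nm s <= K * eps) by (apply Rmult_le_compat_l; lra). lra. }
  apply nm_eq0 in Hr0. subst r. replace f with (lsub f lzero) by l2ring. exact Ha.
Qed.

Theorem theorem6 (L M : nat -> C) :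
  carleson L -> carleson M ->
  filterlim (fun n => blaschke M (L n)) eventually (locally (RtoC 0)) ->
  (forall k, kernel_family (blaschke M) L k ->
     riesz_basis (model_space (blaschke M)) (normalize k)) ->
  filterlim (fun n => blaschke L (M n)) eventually (locally (RtoC 0)) /\
  (forall k, kernel_family (blaschke L) M k ->
     riesz_basis (model_space (blaschke L)) (normalize k)).
Proof.
  intros HcL HcM Hlim Hriesz. apply ccv_filterlim in Hlim.
  pose proof (proj1 HcL : discseq L) as HsL. pose proof (proj1 HcM : discseq M) as HsM.
  destruct (carleson_blaschke_vec L HcL) as [bL HbL].
  destruct (carleson_blaschke_vec M HcM) as [bM HbM].
  destruct (carleson_bessel L HcL) as [C1 [HC1 HBL]].
  destruct (carleson_bessel M HcM) as [C2 [HC2 HBM]].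
  destruct (carleson_lower M HcM) as [K2 [HK2 HLM]].
  specialize (Hriesz _ (kernel_family_kervec M bM L HbM HsL)).
  rewrite normalize_kervec in Hriesz by exact HsL.
  apply riesz_basis_l2 in Hriesz; [|apply model_space_H2].
  destruct Hriesz as [_ [Hcomp [c0 [C0 [Hc0 [_ Hbnd]]]]]].
  assert (Hb1 : forall n, Cmod (blaschke M (L n)) < 1).
  { intros n. destruct HbM as [_ [_ Hb]]. now apply (Cmod_blaschke_lt1 M bM). }
  destruct (ccv0_bounded_away _ Hlim Hb1) as [eta [Heta Hge]].
  (* Here [c0] is the lower Riesz bound of the normalised family and [eta] a lower bound for the
     squared norms removed by the normalisation. *)
  set (c := / (c0 * eta)).
  assert (Hc : 0 < c) by (apply Rinv_0_lt_compat; nra).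
  set (p := pszego M bM L). set (q := pszego L bL M).
  assert (Hpp : forall n, 0 < nm (p n) <= 1) by (intros; now apply nm_pszego_pos).
  assert (HLp : lower p c).
  { intros N a. specialize (Hbnd N (fun n => (a n * nm (p n))%C)).
    replace (lcomb (fun n => (a n * nm (p n))%C) (npszego M bM L) N) with (lcomb a p N) in Hbnd.
    2:{ apply lcomb_ext. intros n _. specialize (Hpp n). unfold npszego. fold p.
        rewrite RtoC_inv by lra. l2ring. field. intros E. apply RtoC_inj in E. lra. }
    destruct Hbnd as [Hlow _].
    apply Rmult_le_reg_l with (c0 * eta); [nra|].
    unfold c. rewrite <- Rmult_assoc, Rinv_r, Rmult_1_l by nra.
    eapply Rle_trans; [|exact Hlow]. rewrite Rmult_assoc.
    apply Rmult_le_compat_l; [lra|]. rewrite <- Rsum_scal. apply Rsum_le. intros n _.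
    rewrite Cmod_mult, Rpow_mult_distr, Cmod_R, pow2_abs, Rmult_comm.
    apply Rmult_le_compat_l; [apply pow2_ge_0|].
    unfold p. rewrite nm_pszego by assumption. apply Hge. }
  assert (Happ : forall f : l2, model_space (blaschke M) f -> approx p f).
  { intros f Hf. apply (approx_rescale (npszego M bM L) _ (fun n => RtoC (nm (p n)))).
    - intros n E. apply RtoC_inj in E. specialize (Hpp n). lra.
    - intros n. specialize (Hpp n). unfold npszego. fold p. rewrite RtoC_inv by lra.
      l2ring. field. intros E. apply RtoC_inj in E. lra.
    - now apply Hcomp. }
  assert (Hmod : forall N a, model_space (blaschke M) (lcomb a (nszego M) N)).
  { intros N a. apply orth_vanishing_model; [exact HsM|]. intros g Hg.
    apply ip_eq0_sym, ip_lcomb_l_eq0. intros n _. apply ip_eq0_sym. now apply ip_nszego_vanishing. }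
  split.
  - apply ccv_filterlim.
    assert (Hy : forall n, approx p (nszego M n)).
    { intros n. rewrite <- (lcomb_delta (nszego M) (S n) n) by lia. apply Happ, Hmod. }
    pose proof (limit_transfer (nszego L) (nszego M) p (fun n => blaschke M (L n)) C1 c C2
      HC1 Hc HC2 HLp HBM (fun n => nm_nszego M n HsM) Hy (fun n => Rlt_le _ _ (Hb1 n)) Hlim) as HT.
    intros eps He. destruct (HT) with (eps := eps) as [n0 Hn0]; [|exact He|].
    { intros N a. unfold p. rewrite nm_lcomb_nszego_sub_pszego by assumption.
      eapply Rle_trans; [apply HBL|]. right. f_equal. apply Rsum_ext. intros n _.
      rewrite Cmod_mult, Cmod_conj. ring. }
    exists n0. intros n Hn. destruct (Hn0 n Hn) as [g [[N [a ->]] Hg]].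
    replace (blaschke L (M n) - 0)%C with (blaschke L (M n)) by ring.
    (* The component of y_n orthogonal to K_L, whose norm is |B_L(mu_n)|. *)
    set (w := lsub (nszego M n) (q n)).
    assert (Hwv : vanishes L w) by (apply vanishes_nszego_sub_pszego; assumption).
    assert (Hwn : nm w = Cmod (blaschke L (M n))).
    { pose proof (nm_lcomb_nszego_sub_pszego L bL M (fun m => if Nat.eqb m n then 1%C else 0%C) (S n) HbL HsM) as E.
      rewrite lcomb_delta in E by lia. unfold w, q. rewrite E.
      rewrite (lcomb_ext _ (fun m => Cconj (blaschke L (M n)) * (if Nat.eqb m n then RtoC 1 else RtoC 0))%C
                 (nszego M) (nszego M)).
      - rewrite <- lcomb_scal, lcomb_delta, nm_scal, Cmod_conj, nm_nszego by (assumption || lia). ring.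
      - intros m _. destruct (Nat.eqb_spec m n) as [->|]; l2ring. }
    (* Since [w] is orthogonal to K_L, any element of K_L may be subtracted from y_n; hence |w| is
       at most the distance from y_n to the combination just found. *)
    assert (E : ip w w = ip w (lsub (nszego M n) (lcomb a (nszego L) N))).
    { unfold w at 2. rewrite !ip_sub_r.
      rewrite (ip_pszego_vanishing L bL M w n HbL HsM Hwv : ip w (q n) = 0%C).
      rewrite (ip_eq0_sym (lcomb a (nszego L) N) w); [reflexivity|].
      apply ip_lcomb_l_eq0. intros j _. apply ip_eq0_sym. now apply ip_nszego_vanishing. }
    pose proof (Re_ip_le w (lsub (nszego M n) (lcomb a (nszego L) N))) as H1.
    apply Rabs_le_between in H1. rewrite <- E, <- nm_sqr_ip in H1.
    rewrite <- Hwn. pose proof (nm_ge0 w). nra.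
  - intros k Hk. rewrite (kernel_family_unique L bL M k HbL HsM Hk), normalize_kervec by exact HsM.
    apply riesz_basis_l2; [apply model_space_H2|].
    (* The resulting [K] satisfies |f| <= K |Q f| for every combination f of the y_n. *)
    destruct (lower_transfer (nszego L) (nszego M) p q C1 c) as [K [HK HKb]]; try assumption.
    { intros n j. apply ip_eq0_sym, ip_nszego_vanishing. now apply vanishes_nszego_sub_pszego. }
    { intros n j. apply ip_nszego_vanishing. now apply vanishes_nszego_sub_pszego. }
    { intros N b. apply Happ, Hmod. }
    assert (Hqp : forall n, 0 < nm (q n) <= 1) by (intros; now apply nm_pszego_pos).
    assert (Hqn : forall n, RtoC (nm (q n)) <> 0%C).
    { intros n E. apply RtoC_inj in E. specialize (Hqp n). lra. }
    (* The same bound applied to a single unit vector y_n keeps |Q y_n| above 1/K. *)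
    assert (HqK : forall n, 1 <= K * nm (q n)).
    { intros n. rewrite <- (nm_nszego M n HsM) at 1.
      pose proof (HKb (S n) (fun m => if Nat.eqb m n then 1%C else 0%C)) as H.
      rewrite !lcomb_delta in H by lia. exact H. }
    split; [|split].
    + intros n. apply orth_vanishing_model; [exact HsL|]. intros g Hg.
      unfold npszego. rewrite ip_scal_r, ip_pszego_vanishing by assumption. ring.
    + intros f Hf. apply (approx_rescale q _ (fun n => RtoC (/ nm (q n)))).
      * intros n E. apply RtoC_inj in E. specialize (Hqp n).
        assert (0 < / nm (q n)) by (apply Rinv_0_lt_compat; lra). lra.
      * reflexivity.
      * now apply (completeness_transfer L M bL bM C1 c).
    (* [K2] and [C2] are the bounds for the y_n. Below, K^2 is the loss in passing from y_n to Q
       y_n; above, projecting costs nothing and K^2 comes from normalising, as 1/K <= |Q y_n| <=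
       1. *)
    + exists (/ (K2 * K ^ 2)), (C2 * K ^ 2).
      assert (HKK : 0 < K ^ 2) by now apply pow_lt.
      split; [apply Rinv_0_lt_compat; nra|]. split; [nra|]. intros N a.
      set (e := fun n => (a n / nm (q n))%C).
      replace (lcomb a (npszego L bL M) N) with (lcomb e q N).
      2:{ apply lcomb_ext. intros n _. unfold e, npszego. fold q.
          specialize (Hqp n). rewrite RtoC_inv by lra. l2ring. field. apply Hqn. }
      assert (He : forall n, Cmod (e n) = Cmod (a n) / nm (q n)).
      { intros n. unfold e. rewrite Cmod_div, Cmod_R, Rabs_pos_eq by
          (apply Hqn || apply nm_ge0). reflexivity. }
      set (A := Rsum (fun n => Cmod (a n) ^ 2) N).
      set (E := Rsum (fun n => Cmod (e n) ^ 2) N).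
      assert (HAE : A <= E).
      { apply Rsum_le. intros n _. rewrite He. apply pow_incr. split; [apply Cmod_ge_0|].
        specialize (Hqp n). apply Rle_div_r; [lra|]. pose proof (Cmod_ge_0 (a n)). nra. }
      assert (HEA : E <= K ^ 2 * A).
      { unfold A. rewrite <- Rsum_scal. apply Rsum_le. intros n _.
        rewrite He, <- Rpow_mult_distr. specialize (Hqp n). specialize (HqK n).
        pose proof (Cmod_ge_0 (a n)). apply pow_incr. split.
        - apply Rdiv_le_0_compat; lra.
        - apply Rle_div_l; [lra|]. nra. }
      split.
      * apply Rmult_le_reg_l with (K2 * K ^ 2); [nra|].
        rewrite <- Rmult_assoc, Rinv_r, Rmult_1_l by nra.
        eapply Rle_trans; [exact HAE|]. eapply Rle_trans; [apply HLM|].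
        rewrite Rmult_assoc. apply Rmult_le_compat_l; [lra|].
        rewrite <- Rpow_mult_distr. apply pow_incr. split; [apply nm_ge0|apply HKb].
      * apply Rle_trans with (nm (lcomb e (nszego M) N) ^ 2).
        -- apply pow_incr. split; [apply nm_ge0|]. now apply nm_lcomb_pszego_le.
        -- eapply Rle_trans; [apply HBM|]. fold E. rewrite Rmult_assoc.
           apply Rmult_le_compat_l; lra.
Qed.
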